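(* Let $\{X_i : i\in\mathbb{N}\}$ be a stationary, $\alpha$-mixing sequence of real-valued random variables such that $\mathbb{P}(X_i=X_j)=0$ for all $i\ne j$, and suppose that $$\sum_{n\ge1}\alpha_X(n)<\infty .$$ Let $g(n)\equiv G\in\mathbb{N}$ be constant. For each $i\in\{1,\dots,n\}$ let $$Y_i=\sum_{j=(i-G)\vee1}^{i-1}\bigl(I\{X_i>X_j\}-I\{X_i<X_j\}\bigr),$$ let $\bar Y_n=\frac1n\sum_{i=1}^nY_i$, and let $b_n\in\mathbb{N}$ be such that $b_n=o(\sqrt n)$ and $b_n\to\infty$ as $n\to\infty$. Let $$\hat\sigma_n^2=\frac1n\sum_{i=1}^n(Y_i-\bar Y_n)^2+\frac2n\sum_{j=1}^{b_n}\sum_{i=1}^{n-j}(Y_i-\bar Y_n)(Y_{i+j}-\bar Y_n),$$ and let $$\sigma^2=\mathrm{Var}(Y_{G+1})+2\sum_{k\ge1}\mathrm{Cov}(Y_{G+1},Y_{G+k+1}).$$ Let $\mu=\mathbb{E}Y_{1+G}$, $\nu=\mu/G$, and $\hat\tau_n^2=\frac1G\hat\sigma_n^2$. Let $V_n$ be the local Mann-Kendall statistic of order $G$. Then the following hold. (i) As $n\to\infty$, $\dfrac{\sqrt{nG}\,(V_n-\nu)}{\hat\tau_n}\overset{d}{\to}N(0,1)$. (ii) Let $\hat R_n$ be the permutation distribution, with associated group of transformations the symmetric group $S_n$, based on the test statistic $\sqrt{nG}\,V_n/\hat\tau_n$. Then, as $n\to\infty$, $$\sup_{t\in\mathbb{R}}\bigl|\hat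 R_n(t)-\Phi(t)\bigr|\overset{a.s.}{\to}0 ,$$ where $\Phi$ is the distribution function of a standard Gaussian random variable.
   Context: $\mathbb{N}=\{1,2,\dots\}$; $a\vee b=\max(a,b)$; $I\{\cdot\}$ is the indicator; empty sums are $0$. ''Stationary'' means strictly stationary: all finite-dimensional distributions are invariant under shifts of the index. Strong mixing: for a sequence $\{X_n:n\in\mathbb{N}\}$, let $\mathcal{F}_n=\sigma(X_m:m\le n)$ and $\mathcal{G}_n=\sigma(X_m:m\ge n)$, and $$\alpha_X(n)=\sup_{m\in\mathbb{N}}\ \sup_{A\in\mathcal{F}_m,\,B\in\mathcal{G}_{m+n}}\bigl|\mathbb{P}(A\cap B)-\mathbb{P}(A)\mathbb{P}(B)\bigr| .$$ The sequence is $\alpha$-mixing if $\alpha_X(n)\to0$ as $n\to\infty$. The local Mann-Kendall statistic of order $G$ (for $n>G$) is $$V_n=V_n(X_1,\dots,X_n)=\frac1{nG}\sum_{i=1}^{n-G}\sum_{j=i+1}^{i+G}\bigl(I\{X_i<X_j\}-I\{X_i>X_j\}\bigr).$$ $\hat\tau_n$ denotes the square root of $\hat\tau_n^2$. Permutation distribution: for a statistic $T_n=T_n(X_1,\dots,X_n)$, the permutation distribution based on $T_n$ with group of transformations $S_n$ (permutations of $\{1,\dots,n\}$) is the random distribution function $$\hat R_n(t)=\frac1{n!}\sum_{\pi\in S_n}I\{T_n(X_{\pi(1)},\dots,X_{\pi(n)})\le t\},$$ where every part of the statistic (here including $\hat\tau_n$, via the $Y_i$) is recomputed on the permuted data.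
   Formalization: Part (i) is proved under the additional assumption σ² > 0, without which it is false (for G = 2 there are tie-free geometrically mixing stationary sequences whose partial sums of Y_i are bounded, so σ² = 0); part (ii) is as stated. *)

(* Defs.v *)
(* MathComp-Analysis, over an arbitrary [R : realType].

   Indices are shifted by one: the term X_{i+1} of a sequence indexed by
   {1, 2, ...} is [X i] here, so that X_1, ..., X_n are [X 0], ..., [X n.-1].
   Statistics of X_1, ..., X_n take a whole path [x : nat -> R] together with
   the sample size [n], and only read [x 0], ..., [x n.-1]. *)
From HB Require Import structures.
From mathcomp Require Import all_boot all_order all_algebra all_fingroup.
From mathcomp Require Import all_classical all_reals all_analysis.

Set Implicit Arguments.
Unset Strict Implicit.
Unset Printing Implicit Defensive.

Import Order.TTheory GRing.Theory Num.Theory.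
Import numFieldNormedType.Exports.

Local Open Scope classical_set_scope.
Local Open Scope ring_scope.

Section processes.
Context (d : measure_display) (T : measurableType d) (R : realType)
  (P : probability T R).
Implicit Types X : nat -> {RV P >-> R}.

Definition stationary X : Prop :=
  forall (k : nat) (t : k.-tuple nat) (h : nat) (B : set (k.-tuple R)),
    measurable B ->
    P [set w | B [tuple of [seq X (i + h)%N w | i <- t]]] =
    P [set w | B [tuple of [seq X i w | i <- t]]].

Definition sigma_of X (I : set nat) : set (set T) :=
  <<s \bigcup_(i in I) preimage_set_system setT (X i) measurable >>.

Definition past X (m : nat) : set (set T) :=
  sigma_of X [set i | (i <= m)%N].

Definition future X (m : nat) : set (set T) :=
  sigma_of X [set i | (m <= i)%N].

Definition alpha X (n : nat) : \bar R :=
  ereal_sup [set a | exists m A B, [/\ past X m A, future X (m + n) B &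
    a = `|P (A `&` B) - P A * P B|%E]].

Definition alpha_mixing X : Prop := alpha X n @[n --> \oo] --> 0%E.

Definition cvg_in_distribution (S : nat -> T -> R)
    (Q : probability (measurableTypeR R) R) : Prop :=
  forall t : R, {for t, continuous (fun u : R => Q `]-oo, u]%classic)} ->
    P [set w | S n w <= t] @[n --> \oo] --> Q `]-oo, t]%classic.

End processes.

Section statistics.
Context (R : realType).
Implicit Types (x : nat -> R) (G b n : nat).

Definition mann_kendall G n x : R :=
  (n%:R * G%:R)^-1 *
  \sum_(0 <= i < n - G) \sum_(i.+1 <= j < (i + G).+1)
    ((x i < x j)%R%:R - (x j < x i)%R%:R).

(* The truncated subtraction [i - G] plays the role of the maximum of i - G
   and the first index. *)
Definition Ystat G x (i : nat) : R :=
  \sum_(i - G <= j < i) ((x j < x i)%R%:R - (x i < x j)%R%:R).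

Definition Ymean G n x : R := n%:R^-1 * \sum_(0 <= i < n) Ystat G x i.

Definition sigma2_hat G b n x : R :=
  n%:R^-1 * \sum_(0 <= i < n) (Ystat G x i - Ymean G n x) ^+ 2 +
  2 / n%:R * \sum_(1 <= j < b.+1) \sum_(0 <= i < n - j)
    (Ystat G x i - Ymean G n x) * (Ystat G x (i + j) - Ymean G n x).

(* [sigma2_hat] can be negative; [Num.sqrt] is then 0, and so is any quotient
   by [tau_hat]. *)
Definition tau_hat G b n x : R := Num.sqrt (G%:R^-1 * sigma2_hat G b n x).

Definition studentized G b (c : R) n x : R :=
  Num.sqrt (n%:R * G%:R) * (mann_kendall G n x - c) / tau_hat G b n x.

Definition permute n (s : 'S_n) x : nat -> R :=
  fun i => if insub i is Some k then x (s k : 'I_n) else x i.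

Definition permutation_cdf (S : (nat -> R) -> R) n x (t : R) : R :=
  (n`!%:R)^-1 * \sum_(s : 'S_n) (S (permute s x) <= t)%R%:R.

Definition Phi (t : R) : R := fine (normal_prob 0 1 `]-oo, t]%classic).

End statistics.

Section parameters.
Context (d : measure_display) (T : measurableType d) (R : realType)
  (P : probability T R).
Implicit Types (X : nat -> {RV P >-> R}) (G : nat).

Definition sample_path X (w : T) : nat -> R := fun i => X i w.

Definition Yproc X G (i : nat) : T -> R := fun w => Ystat G (sample_path X w) i.

Definition mu X G : R := fine 'E_P[Yproc X G G].

Definition nu X G : R := mu X G / G%:R.

(* [sigma2] can vanish for a mixing sequence without ties, e.g. when G = 2 and
   the nonzero [Yproc]s are alternately 2 and -2; the normalized sums then have
   no Gaussian limit. *)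
Definition sigma2 X G : \bar R :=
  ('V_P[Yproc X G G] +
   2%:E * \sum_(1 <= k <oo) covariance P (Yproc X G G) (Yproc X G (G + k)))%E.

End parameters.

(* Main.v *)
(* All the statistics are functions of the comparisons between the observations,
   so for fixed n both parts live on a finite probability space: the law of the
   comparison pattern of X_1, ..., X_n in (i), and, in the absence of ties, the
   uniform law on S_n in (ii), where the permutation distribution does not depend
   on the observed path. On both spaces the Y_i form a bounded strongly mixing
   array, up to the first G indices weakly stationary: for permutations, Y's at
   distance more than G are independent, Cov(Y_i, Y_{i+l}) = - l / 3 for
   1 <= l <= G, and the long-run variance is G / 3.

   The central limit theorem for such arrays is proved without blocks. With
   u(s, x) = Phi((t - x) / sqrt(eps^2 + sigma^2 (1 - s))), a solution of the
   backward heat equation, the expectation of u(j / n, S_j) changes at each step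
   by o(1 / n): E[u'(S_j) xi_j] is expanded along the past increments of u'(S_j),
   a finite number of which, together with the second order term, produce the
   long-run variance, the others being controlled by the sum of the mixing
   coefficients. The estimator of the variance is handled lag by lag, each lag
   contributing O(n^{-1/2}) in L^1, which is where b_n = o(sqrt n) enters. The
   uniformity in (ii) is Polya's theorem. *)
Require Import Defs.
From HB Require Import structures.
From mathcomp Require Import all_boot all_order all_algebra all_fingroup.
From mathcomp Require Import all_classical all_reals all_analysis.
From mathcomp Require Import measurable_realfun.
From mathcomp Require Import ring lra zify.

Set Implicit Arguments.
Unset Strict Implicit.
Unset Printing Implicit Defensive.

Import Order.TTheory GRing.Theory Num.Theory.
Import numFieldNormedType.Exports.

Local Open Scope classical_set_scope.
Local Open Scope ring_scope.

(** * Gaussian distribution function and heat kernel *)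

Section taylor.
Context {R : realType}.
Implicit Types (f df : R -> R) (x y C : R).

(** The probability space changes with [n], and in (ii) with the path too. Hence every limit reads:
    there is [N] such that an inequality holds for all [n >= N] and all arrays satisfying
    [weak_array]. In (ii) this yields convergence along every path without ties. Measurability only
    appears in the reduction to comparison patterns.

    The obstacle is that the increments are neither independent nor martingale differences: with
    [dl = n^(-1/2)], the first order term [dl * E[f'(S_j) z_j]] is itself of order [dl^2 = 1 / n],
    the order of the variance term. One factor [dl] comes from the Taylor expansion, the other from
    each past increment of [f'(S)], so the lags beyond [L] add up to at most a constant times [dl^2]
    times a tail of the series of mixing coefficients. This is why summability of the coefficients
    suffices.

    The parameters are fixed in the order: width [eps] of the smoothing, number [L] of expanded
    lags, decoupling distance [M], sample size [n]; each choice depends on the earlier ones. *)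

Lemma derive_within f df x y :
  (forall z : R, x <= z <= y -> is_derive z 1 f (df z)) ->
  {within `[x, y], continuous f}.
Proof.
move=> fdf; apply: derivable_within_continuous => z.
by rewrite in_itv /= => zxy; have [] := fdf z zxy.
Qed.

Lemma mvt_le f df x y : x <= y ->
  (forall z : R, x <= z <= y -> is_derive z 1 f (df z)) ->
  exists2 c, x <= c <= y & f y - f x = df c * (y - x).
Proof.
move=> xy fdf; have [] := @MVT_segment _ f df x y xy.
- move=> z; rewrite in_itv /= => /andP[xz zy].
  by apply: fdf; rewrite !ltW.
- exact: derive_within fdf.
- by move=> c; rewrite in_itv /= => ? ?; exists c.
Qed.

Lemma mvt_abs f df x y : (forall z : R, is_derive z 1 f (df z)) ->
  exists2 c, `|c - x| <= `|y - x| & f y - f x = df c * (y - x).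
Proof.
move=> fdf; have [xy|/ltW yx] := leP x y.
  have [c /andP[? ?] e] := mvt_le xy (fun z _ => fdf z).
  by exists c => //; rewrite !ger0_norm ?subr_ge0 // lerD2r.
have [c /andP[? ?] e] := mvt_le yx (fun z _ => fdf z).
exists c; first by rewrite !ler0_norm ?subr_le0 // lerN2 lerD2r.
by rewrite -opprB e; ring.
Qed.

Lemma lipschitz_of_derive f df C x y : (forall z : R, is_derive z 1 f (df z)) ->
  (forall z, `|df z| <= C) -> `|f y - f x| <= C * `|y - x|.
Proof.
move=> fdf dfC; have [c _ ->] := mvt_abs x y fdf.
by rewrite normrM ler_wpM2r.
Qed.

Lemma taylor1 f df ddf C x y : (forall z : R, is_derive z 1 f (df z)) ->
  (forall z : R, is_derive z 1 df (ddf z)) ->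
  (forall z, `|ddf z| <= C) -> `|f y - f x - df x * (y - x)| <= C * `|y - x| ^+ 2.
Proof.
move=> fdf dfd dC; have [c cx ->] := mvt_abs x y fdf.
rewrite -mulrBl normrM expr2 mulrA ler_wpM2r //.
apply: le_trans (lipschitz_of_derive x c dfd dC) _.
by rewrite ler_wpM2l // (le_trans _ (dC 0)).
Qed.

(** The quadratic term is moved into [g], so that the mean value theorem leaves a first order
    remainder of [df]. Sharp constants are not sought: [C] stands where [C / 6] would do. *)
Lemma taylor2 f df ddf dddf C x y : (forall z : R, is_derive z 1 f (df z)) ->
  (forall z : R, is_derive z 1 df (ddf z)) ->
  (forall z : R, is_derive z 1 ddf (dddf z)) ->
  (forall z, `|dddf z| <= C) ->
  `|f y - f x - df x * (y - x) - ddf x / 2 * (y - x) ^+ 2| <= C * `|y - x| ^+ 3.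
Proof.
move=> fdf dfd ddfd dC.
pose g z := f z - (ddf x / 2) * (z - x) ^+ 2.
have gdg (z : R) : is_derive z 1 g (df z - ddf x * (z - x)).
  have h1 : is_derive z 1 (fun z => (z - x) ^+ 2) ((2 * (z - x)) *: 1).
    have h0 : is_derive z 1 (fun z => z - x) 1.
      rewrite -[X in is_derive _ _ _ X]subr0.
      exact: is_deriveB (is_derive_id _ _) (is_derive_cst _ _ _).
    have := is_deriveX 2 h0.
    by rewrite expr1.
  have h2 := is_deriveB (fdf z) (is_deriveZ (ddf x / 2) h1).
  rewrite [X in is_derive _ _ _ X](_ : _ =
     df z - (ddf x / 2) *: ((2 * (z - x)) *: (1:R))) //.
  by rewrite /GRing.scale /= mulr1 mulrA divfK.
have [c cx gc] := mvt_abs x y gdg.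
have -> : f y - f x - df x * (y - x) - ddf x / 2 * (y - x) ^+ 2
   = (df c - df x - ddf x * (c - x)) * (y - x).
  have -> : f y - f x - df x * (y - x) - ddf x / 2 * (y - x) ^+ 2 =
    (g y - g x) - df x * (y - x) by rewrite /g; ring.
  by rewrite gc; ring.
rewrite normrM exprSr mulrA ler_wpM2r //.
apply: le_trans (taylor1 x c dfd ddfd dC) _.
by rewrite ler_wpM2l ?(le_trans _ (dC 0)) // lerXn2r ?nnegrE.
Qed.

(** A one-sided form, for functions of the variance, which are differentiable only at positive
    arguments. *)
Lemma taylor1_le f df ddf C x y : x <= y ->
  (forall z : R, x <= z <= y -> is_derive z 1 f (df z)) ->
  (forall z : R, x <= z <= y -> is_derive z 1 df (ddf z)) ->
  (forall z, x <= z <= y -> `|ddf z| <= C) ->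
  `|f y - f x - df x * (y - x)| <= C * (y - x) ^+ 2.
Proof.
move=> xy fdf dfd dC; have [c /andP[xc cy] ->] := mvt_le xy fdf.
have C0 : 0 <= C by rewrite (le_trans _ (dC x _)) // lexx.
have dfd' (z : R) : x <= z <= c -> is_derive z 1 df (ddf z).
  by move=> /andP[xz zc]; apply: dfd; rewrite xz (le_trans zc).
have [e /andP[xe ec] dfc] := mvt_le xc dfd'.
rewrite -mulrBl dfc !normrM (ger0_norm (_ : 0 <= y - x)) ?subr_ge0 //.
rewrite (ger0_norm (_ : 0 <= c - x)) ?subr_ge0 //.
rewrite expr2 mulrA ler_wpM2r ?subr_ge0 // ler_pM ?subr_ge0 ?lerD2r //.
by apply: dC; rewrite xe (le_trans ec).
Qed.

End taylor.

Section derive_rules.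
Context {R : realType}.
Implicit Types (f g : R -> R) (x a b c : R).

Lemma is_derive1D f g x a b : is_derive x 1 f a -> is_derive x 1 g b ->
  is_derive x 1 (fun y => f y + g y) (a + b).
Proof. by move=> fa gb; exact: is_deriveD. Qed.

Lemma is_derive1M f g x a b : is_derive x 1 f a -> is_derive x 1 g b ->
  is_derive x 1 (fun y => f y * g y) (f x * b + g x * a).
Proof. by move=> fa gb; exact: is_deriveM. Qed.

Lemma is_derive1Ml f x a c : is_derive x 1 f a ->
  is_derive x 1 (fun y => c * f y) (c * a).
Proof. by move=> fa; exact: is_deriveZ. Qed.

Lemma is_derive1_sqr x : is_derive x 1 (fun y : R => y ^+ 2) (2 * x).
Proof.
have := is_derive1M (is_derive_id x 1) (is_derive_id x 1).
by rewrite mulr1 -mulr2n mulr_natl; under eq_fun do rewrite -expr2.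
Qed.

Lemma is_derive1_affine x a b : is_derive x 1 (fun y : R => a * (y - b)) a.
Proof.
have := is_derive1Ml a (is_derive1D (is_derive_id x 1) (is_derive_cst (- b) x 1)).
by rewrite addr0 mulr1.
Qed.

End derive_rules.

Section gaussian.
Context {R : realType}.
Implicit Types (x y z t : R).

Definition gpdf : R -> R := normal_pdf 0 1.

Lemma gpdfE z : gpdf z = normal_peak 1 * expR (- (z ^+ 2) / 2).
Proof.
by rewrite /gpdf normal_pdfE ?oner_neq0 // /normal_fun subr0 expr1n.
Qed.

Lemma gpdf_ge0 z : 0 <= gpdf z.
Proof. exact: normal_pdf_ge0. Qed.

Lemma normal_peak1_le1 : normal_peak 1 <= 1 :> R.
Proof.
rewrite /normal_peak invf_le1 ?sqrtr_gt0 expr1n mul1r; last first.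
  by rewrite mulrn_wgt0 // pi_gt0.
rewrite -[leLHS]sqrtr1 ler_wsqrtr //.
by have := pi_ge2 R; rewrite mulr2n; lra.
Qed.

(** [1 + y <= expR y] at [y = z ^+ 2 / 4], squared, bounds the density by [(1 + z ^+ 2 / 4) ^- 2].
    The constant 16 comes from replacing [1 + z ^+ 2 / 4] by [4 + z ^+ 2], whose square dominates
    the powers of [z] up to the third. *)
Lemma gpdf_moment_le k z : (k <= 3)%N -> `|z ^+ k * gpdf z| <= 16.
Proof.
move=> k3; rewrite normrM (ger0_norm (gpdf_ge0 z)) normrX.
have e2 : (1 + z ^+ 2 / 4) ^+ 2 * gpdf z <= 1.
  have h : (1 + z ^+ 2 / 4) ^+ 2 <= expR (z ^+ 2 / 2).
    have -> : z ^+ 2 / 2 = z ^+ 2 / 4 + z ^+ 2 / 4 by field.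
    rewrite expRD -expr2 lerXn2r ?nnegrE ?expR_ge0 ?expR_ge1Dx //.
    by have := sqr_ge0 z; nra.
  apply: (le_trans (ler_wpM2r (gpdf_ge0 z) h)).
  rewrite gpdfE mulrCA -expRD mulNr subrr expR0 mulr1.
  exact: normal_peak1_le1.
apply: (@le_trans _ _ (16 * ((1 + z ^+ 2 / 4) ^+ 2 * gpdf z))); last first.
  by rewrite ger_pMr.
rewrite mulrA ler_wpM2r ?gpdf_ge0 //.
have -> : z ^+ 2 = `|z| ^+ 2 by rewrite real_normK ?num_real.
have := normr_ge0 z; set a := `|z| => a0; set c := 4 + a ^+ 2.
have -> : 16 * (1 + a ^+ 2 / 4) ^+ 2 = c * c by rewrite /c; field.
have a2 : 0 <= a ^+ 2 by exact: sqr_ge0.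
have c1 : 1 <= c by rewrite /c; lra.
have ac : a <= c by have := sqr_ge0 (a - 1); rewrite /c sqrrB mulr1 expr1n; lra.
have a2c : a ^+ 2 <= c by rewrite /c; lra.
have c0 : 0 <= c by rewrite (le_trans _ c1).
case: k k3 => [|[|[|[|//]]]] _.
- by rewrite expr0 -[leLHS]mulr1 ler_pM.
- by rewrite expr1 -[leLHS]mulr1 ler_pM.
- by rewrite -[leLHS]mulr1 ler_pM.
- by rewrite exprSr ler_pM.
Qed.

Lemma is_derive_gpdf z : is_derive z 1 gpdf (- z * gpdf z).
Proof.
have h1 := is_derive1Ml (- 2^-1) (is_derive1_sqr z).
have h2 := is_derive1Ml (normal_peak 1) (is_derive1_comp (is_derive_expR _) h1).
have -> : gpdf = (fun y => normal_peak 1 * (expR \o (fun y => - 2^-1 * y ^+ 2)) y).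
  by apply/funext => y; rewrite gpdfE /= mulNr [_ / 2]mulrC -mulNr.
by apply: is_derive_eq h2 _; rewrite /=; field.
Qed.

Definition gpdf1 z := - z * gpdf z.
Definition gpdf2 z := (z ^+ 2 - 1) * gpdf z.

Lemma is_derive_gpdf1 z : is_derive z 1 gpdf1 (gpdf2 z).
Proof.
have := is_derive1M (is_derive1Ml (-1) (is_derive_id z 1)) (is_derive_gpdf z).
have -> : (fun y => -1 * id y * gpdf y) = gpdf1.
  by apply/funext => y; rewrite mulN1r.
by move=> h; apply: is_derive_eq h _; rewrite /gpdf2; ring.
Qed.

Lemma gpdf_le z : `|gpdf z| <= 16.
Proof. by rewrite -[gpdf z]mul1r -(expr0 z) gpdf_moment_le. Qed.

Lemma gpdf1_le z : `|gpdf1 z| <= 16.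
Proof. by rewrite /gpdf1 mulNr normrN -[X in X * _]expr1 gpdf_moment_le. Qed.

Lemma gpdf2_le z : `|gpdf2 z| <= 32.
Proof.
rewrite /gpdf2 mulrBl mul1r (le_trans (ler_normB _ _)) //.
by rewrite (_ : 32 = 16 + 16) ?lerD ?gpdf_le ?gpdf_moment_le //; ring.
Qed.

Lemma PhiE t : (Phi t)%:E = normal_prob 0 1 `]-oo, t]%classic.
Proof. by rewrite /Phi fineK // fin_num_measure. Qed.

Lemma Phi_ge0 t : 0 <= Phi t.
Proof. by rewrite -lee_fin PhiE. Qed.

Lemma Phi_le1 t : Phi t <= 1.
Proof. by rewrite -lee_fin PhiE probability_le1. Qed.

Lemma Phi_le x y : x <= y -> Phi x <= Phi y.
Proof.
move=> xy; rewrite -lee_fin !PhiE le_measure ?inE //.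
by apply: subset_itvl; rewrite bnd_simp.
Qed.

Lemma is_derive_Phi t : is_derive t 1 (@Phi R) (gpdf t).
Proof.
have tu : t < t + 1 by rewrite ltrDl.
have [] := @continuous_FTC1 _ gpdf -oo%O t (t + 1) tu.
- by apply: integrableS (integrable_normal_pdf 0 1).
- by rewrite ltNyr.
- by apply: continuous_normal_pdf; rewrite oner_neq0.
move=> d1 d2; apply: DeriveDef; first exact: d1.
by rewrite -derive1E; exact: d2.
Qed.

Lemma Phi_lipschitz x y : `|Phi y - Phi x| <= 16 * `|y - x|.
Proof. exact: lipschitz_of_derive is_derive_Phi gpdf_le. Qed.

(** The identity as a random variable: [Phi] becomes a cumulative distribution function and inherits
    its limits at both infinities. *)
Let idTR : measurableTypeR R -> R := idfun.

#[local] HB.instance Definition _ :=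
  @isMeasurableFun.Build _ _ _ _ idTR (@measurable_id _ _ setT).

Lemma Phi_tail (e : R) : 0 < e -> exists2 k, 0 < k & 1 - Phi k <= e /\ Phi (- k) <= e.
Proof.
move=> e0.
have c1 := @cvg_cdfy1 _ _ R (normal_prob 0 1) (idTR : {RV (normal_prob 0 1) >-> R}).
have c2 := @cvg_cdfNy0 _ _ R (normal_prob 0 1) (idTR : {RV (normal_prob 0 1) >-> R}).
have {}c1 : Phi r @[r --> +oo] --> (1 : R).
  by rewrite (_ : Phi (R:=R) = fine \o cdf (idTR : {RV (normal_prob 0 1) >-> R})) //; exact:
      fine_cvg c1.
have {}c2 : Phi r @[r --> -oo] --> (0 : R).
  by rewrite (_ : Phi (R:=R) = fine \o cdf (idTR : {RV (normal_prob 0 1) >-> R})) //; exact: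
      fine_cvg c2.
have /cvgrPdist_le /(_ e e0) [k1 [_ h1]] := c1.
have /cvgrPdist_le /(_ e e0) [k2 [_ h2]] := c2.
pose k := Num.max 1 (Num.max (k1 + 1) (1 - k2)).
have k0 : 0 < k by rewrite lt_max ltr01.
exists k => //; split.
  have /h1 : k1 < k by rewrite !lt_max ltrDl ltr01 orbT.
  by rewrite ger0_norm // subr_ge0 Phi_le1.
have /h2 : - k < k2 by rewrite ltrNl !lt_max (_ : - k2 < 1 - k2) ?orbT // ltrDr ltr01.
by rewrite sub0r normrN ger0_norm // Phi_ge0.
Qed.

Variable t : R.

Section space.
Variable r : R.
Hypothesis r0 : 0 < r.

(** The probability that [x] plus a centered Gaussian variable of standard deviation [r] is at most
    [t], thus the indicator of [x <= t] smoothed at scale [r]. [heat1], [heat2], [heat3] are its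
    derivatives in [x]. *)
Definition heat x := Phi ((t - x) / r).
Definition heat1 x := - r^-1 * gpdf ((t - x) / r).
Definition heat2 x := r ^- 2 * gpdf1 ((t - x) / r).
Definition heat3 x := - r ^- 3 * gpdf2 ((t - x) / r).

Let is_derive_arg x : is_derive x 1 (fun y => (t - y) / r) (- r^-1).
Proof.
have := is_derive1_affine x (- r^-1) t.
have -> // : (fun y => - r^-1 * (y - t)) = (fun y => (t - y) / r).
by apply/funext => y; ring.
Qed.

Lemma is_derive_heat x : is_derive x 1 heat (heat1 x).
Proof.
have := is_derive1_comp (is_derive_Phi _) (is_derive_arg x).
by move=> h; apply: is_derive_eq h _; rewrite mulrC.
Qed.

Lemma is_derive_heat1 x : is_derive x 1 heat1 (heat2 x).
Proof.
have := is_derive1Ml (- r^-1) (is_derive1_comp (is_derive_gpdf _) (is_derive_arg x)).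
by move=> h; apply: is_derive_eq h _; rewrite /heat2 /gpdf1; field; rewrite gt_eqF.
Qed.

Lemma is_derive_heat2 x : is_derive x 1 heat2 (heat3 x).
Proof.
have := is_derive1Ml (r ^- 2) (is_derive1_comp (is_derive_gpdf1 _) (is_derive_arg x)).
by move=> h; apply: is_derive_eq h _; rewrite /heat3; field; rewrite gt_eqF.
Qed.

Let heat_le (C c y : R) k : `|y| <= C -> `|c| = r ^- k -> `|c * y| <= C / r ^+ k.
Proof. by move=> yC cr; rewrite normrM cr mulrC ler_wpM2r // invr_ge0 exprn_ge0 // ltW. Qed.

Lemma heat1_le x : `|heat1 x| <= 16 / r.
Proof.
rewrite -[r in _ / r]expr1 heat_le ?gpdf_le // normrN ger0_norm // ?expr1 //.
by rewrite invr_ge0 ltW.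
Qed.

Lemma heat2_le x : `|heat2 x| <= 16 / r ^+ 2.
Proof. by rewrite heat_le ?gpdf1_le // ger0_norm // invr_ge0 exprn_ge0 // ltW. Qed.

Lemma heat3_le x : `|heat3 x| <= 32 / r ^+ 3.
Proof.
by rewrite heat_le ?gpdf2_le // normrN ger0_norm // invr_ge0 exprn_ge0 // ltW.
Qed.

End space.

Lemma is_derive_sqrtV (q : R) : 0 < q ->
  is_derive q 1 (fun q => (Num.sqrt q)^-1) (- (Num.sqrt q)^-1 / (2 * q)).
Proof.
move=> q0; have s0 : 0 < Num.sqrt q by rewrite sqrtr_gt0.
have h := is_deriveV (lt0r_neq0 s0) (is_derive1_sqrt q0).
apply: is_derive_eq h _; rewrite /GRing.scale /=.
rewrite -[X in _ = _ / (2 * X)](sqr_sqrtr (ltW q0)).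
by field; rewrite gt_eqF.
Qed.

(* In the variance variable [r ^+ 2], [heat] solves the heat equation: its
   derivative is half of [heat2]. *)
Lemma heat_equation x (q h : R) : 0 < q -> 0 <= h ->
  `|heat (Num.sqrt (q + h)) x - heat (Num.sqrt q) x - h / 2 * heat2 (Num.sqrt q) x|
  <= 16 / q ^+ 2 * h ^+ 2.
Proof.
move=> q0 h0; pose z (p : R) := (t - x) * (Num.sqrt p)^-1.
have dz (p : R) : 0 < p -> is_derive p 1 z (- z p / (2 * p)).
  move=> p0; apply: is_derive_eq (is_derive1Ml (t - x) (is_derive_sqrtV p0)) _.
  by rewrite /z; ring.
pose f p := Phi (z p).
pose df p := 2^-1 * (gpdf1 (z p) * p^-1).
pose ddf p := - 2^-1 * (gpdf2 (z p) * z p / 2 + gpdf1 (z p)) / p ^+ 2.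
have p_gt0 (p : R) : q <= p <= q + h -> 0 < p.
  by move=> /andP[qp _]; exact: lt_le_trans qp.
have fdf (p : R) : q <= p <= q + h -> is_derive p 1 f (df p).
  move=> /p_gt0 p0; have := is_derive1_comp (is_derive_Phi (z p)) (dz p p0).
  move=> hh; apply: is_derive_eq hh _; rewrite /df /gpdf1.
  by field; rewrite gt_eqF.
have dfd (p : R) : q <= p <= q + h -> is_derive p 1 df (ddf p).
  move=> /p_gt0 p0; have p0' : p != 0 by rewrite gt_eqF.
  have h1 := is_derive1_comp (is_derive_gpdf1 (z p)) (dz p p0).
  have h2 := is_deriveV (p0' : id p != 0) (is_derive_id p 1).
  have := is_derive1Ml 2^-1 (is_derive1M h1 h2).
  move=> hh; apply: is_derive_eq hh _; rewrite /ddf /GRing.scale /=.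
  by field.
have dC (p : R) : q <= p <= q + h -> `|ddf p| <= 16 / q ^+ 2.
  move=> pq; have p0 := p_gt0 _ pq.
  have z1 : `|gpdf2 (z p) * z p| <= 32.
    (* The factor [z p] raises the degree to 3, which is why the moment bound on the density goes
       that far. *)
    rewrite /gpdf2 (_ : _ * z p = z p ^+ 3 * gpdf (z p) - z p ^+ 1 * gpdf (z p)); last by ring.
    rewrite (le_trans (ler_normB _ _)) //.
    by rewrite (_ : 32 = 16 + 16) ?lerD ?gpdf_moment_le //; ring.
  have z2 := gpdf1_le (z p).
  rewrite /ddf normrM ler_pM //; last first.
    rewrite ger0_norm ?invr_ge0 ?exprn_ge0 ?(ltW p0) //.
    rewrite lef_pV2 ?posrE ?exprn_gt0 // lerXn2r ?nnegrE ?(ltW p0) ?(ltW q0) //.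
    by case/andP: pq.
  rewrite normrM normrN (ger0_norm (_ : 0 <= 2^-1)) ?invr_ge0 //.
  have := ler_normD (gpdf2 (z p) * z p / 2) (gpdf1 (z p)).
  rewrite [X in _ <= X + _]normrM (ger0_norm (_ : 0 <= 2^-1)) ?invr_ge0 //.
  by move: z1 z2; lra.
have qh : q <= q + h by rewrite lerDl.
have := taylor1_le qh fdf dfd dC; rewrite (_ : q + h - q = h); last by ring.
congr (`|_| <= _); rewrite /f /heat /df /heat2 /z sqr_sqrtr ?(ltW q0) //.
by ring.
Qed.

End gaussian.

(** * Finite probability spaces and strong mixing *)

Section finite_expectation.
Context {R : realType} (Om : finType) (p : Om -> R).
Hypothesis p_ge0 : forall w, 0 <= p w.
Hypothesis p_sum : \sum_w p w = 1.
Implicit Types (f g : Om -> R) (A B : pred Om).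

Definition fexp f : R := \sum_w p w * f w.

Lemma eq_fexp f g : f =1 g -> fexp f = fexp g.
Proof. by move=> fg; apply: eq_bigr => w _; rewrite fg. Qed.

Lemma fexpD f g : fexp (fun w => f w + g w) = fexp f + fexp g.
Proof. by rewrite -big_split; apply: eq_bigr => w _; rewrite mulrDr. Qed.

Lemma fexpZ c f : fexp (fun w => c * f w) = c * fexp f.
Proof. by rewrite big_distrr; apply: eq_bigr => w _; rewrite mulrCA. Qed.

Lemma fexpN f : fexp (fun w => - f w) = - fexp f.
Proof. by rewrite -mulN1r -fexpZ; apply: eq_fexp => w; rewrite mulN1r. Qed.

Lemma fexpB f g : fexp (fun w => f w - g w) = fexp f - fexp g.
Proof. by rewrite fexpD fexpN. Qed.

Lemma fexp_cst c : fexp (fun=> c) = c.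
Proof. by rewrite /fexp -big_distrl /= p_sum mul1r. Qed.

Lemma fexp_sum (I : Type) (r : seq I) (P : pred I) (F : I -> Om -> R) :
  fexp (fun w => \sum_(i <- r | P i) F i w) = \sum_(i <- r | P i) fexp (F i).
Proof. by rewrite exchange_big; apply: eq_bigr => w _; rewrite big_distrr. Qed.

Lemma fexp_le f g : (forall w, f w <= g w) -> fexp f <= fexp g.
Proof. by move=> fg; apply: ler_sum => w _; rewrite ler_wpM2l. Qed.

Lemma fexp_ge0 f : (forall w, 0 <= f w) -> 0 <= fexp f.
Proof. by move=> f0; apply: sumr_ge0 => w _; rewrite mulr_ge0. Qed.

Lemma fexp_norm_le f C : (forall w, `|f w| <= C) -> `|fexp f| <= C.
Proof.
move=> fC; rewrite -[C]fexp_cst (le_trans (ler_norm_sum _ _ _)) //.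
by apply: ler_sum => w _; rewrite normrM ger0_norm // ler_wpM2l.
Qed.

Lemma fexp_dist_le f g C : (forall w, `|f w - g w| <= C) -> `|fexp f - fexp g| <= C.
Proof. by move=> fC; rewrite -fexpB fexp_norm_le. Qed.

Lemma fexp_pred A : 0 <= fexp (fun w => (A w)%:R) <= 1.
Proof.
rewrite fexp_ge0 //= -[leRHS]fexp_cst fexp_le // => w.
by rewrite lern1 leq_b1.
Qed.

Lemma fexp_cov_pred_le1 A B :
  `|fexp (fun w => (A w && B w)%:R) -
    fexp (fun w => (A w)%:R) * fexp (fun w => (B w)%:R)| <= 1.
Proof.
have /andP[c0 c1] := fexp_pred (fun w => A w && B w).
have /andP[a0 a1] := fexp_pred A; have /andP[b0 b1] := fexp_pred B.
have ab0 := mulr_ge0 a0 b0; have ab1 := mulr_ile1 a0 b0 a1 b1.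
by move: c0 c1 ab0 ab1; rewrite ler_norml; lra.
Qed.

Lemma fexp_markov f c : 0 < c -> (forall w, 0 <= f w) ->
  fexp (fun w => (c <= f w)%R%:R) <= fexp f / c.
Proof.
move=> c0 f0; rewrite ler_pdivlMr // mulrC -fexpZ; apply: fexp_le => w.
by case: (leP c (f w)) => [cf|_]; rewrite ?mulr1 ?mulr0.
Qed.

End finite_expectation.

Section mixing.
Context {R : realType} (Om : finType) (p : Om -> R) (z : nat -> Om -> R).
Hypothesis p_sum : \sum_w p w = 1.
Implicit Types (f g v : Om -> R) (A B : pred Om) (I J : pred nat).
Local Notation E := (fexp p).

(** The finite counterpart of measurability with respect to the coordinates in [I]. *)
Definition determined (T : Type) I (f : Om -> T) : Prop :=
  forall w w', (forall i, I i -> z i w = z i w') -> f w = f w'.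

Let same I w w' := `[< forall i, I i -> z i w = z i w' >].

(** A representative of the atom of [w] in the partition generated by the coordinates in [I].
    Weighted sums over the fibres of [rep I] act as conditional expectations. *)
Let rep I w := odflt w [pick w' | same I w w'].

Let same_rep I w i : I i -> z i (rep I w) = z i w.
Proof. by rewrite /rep; case: pickP => //= w' /asboolP h /h ->. Qed.

Let rep_det I : determined I (rep I).
Proof.
move=> w w' ww'; have e : same I w =1 same I w'.
  by move=> u; apply: asbool_equiv_eq; split=> h i Ii; rewrite -h // ww'.
rewrite /rep (eq_pick e); by case: pickP => //= /(_ w'); rewrite /same asboolT.
Qed.

Let sum_rep I f v : determined I f ->
  \sum_w f w * v w = \sum_u f u * \sum_(w | rep I w == u) v w.
Proof.
move=> fI; rewrite (partition_big (rep I) xpredT) //=; apply: eq_bigr => u _.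
rewrite big_distrr /=; apply: eq_bigr => w /eqP <-.
by congr (_ * _); apply: fI => i Ii; rewrite same_rep.
Qed.

(* [A] is the event that the conditional expectation of [v] given the
   coordinates in [I] is nonnegative. Used on both factors, this reduces the
   covariance of bounded functions to that of two events. *)
Lemma sign_extremal I f v (C : R) : determined I f -> (forall w, `|f w| <= C) ->
  exists A, determined I A /\
    `|\sum_w f w * v w| <= C * \sum_w (2 * (A w)%:R - 1) * v w.
Proof.
move=> fI fC; pose V u := \sum_(w | rep I w == u) v w.
pose A w := 0 <= V (rep I w).
have AI : determined I A by move=> w w' ww'; rewrite /A (rep_det ww').
exists A; split => //.
rewrite (sum_rep _ fI) (@sum_rep I (fun w => 2 * (A w)%:R - 1)); last first.
  by move=> w w' ww'; rewrite (AI _ _ ww').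
rewrite (le_trans (ler_norm_sum _ _ _)) // big_distrr /=.
apply: ler_sum => u _; rewrite normrM -/(V u).
have [[w /eqP wu]|nou] := pselect (exists w, rep I w == u); last first.
  rewrite (_ : V u = 0) ?normr0 ?mulr0 // /V big_pred0 // => w.
  by apply/negP => wu; apply: nou; exists w.
have -> : A u = (0 <= V u :> R).
  rewrite -wu /A; congr (0 <= V _); apply: rep_det => i Ii; exact: same_rep.
have -> : (2 * (0 <= V u :> R)%R%:R - 1) * V u = `|V u|.
  by case: ger0P => _; rewrite ?mulr1 ?mulr0; ring.
by rewrite ler_wpM2r.
Qed.

(** [a] is any majorant of the mixing coefficients, so that one notion covers both [window_alpha]
    and the indicator of [k <= G]. *)
Definition mixing_le (n : nat) (a : nat -> R) : Prop :=
  forall m k A B, determined (fun i => i <= m)%N A ->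
    determined (fun i => m + k <= i < n)%N B ->
    `|E (fun w => (A w && B w)%:R) - E (fun w => (A w)%:R) * E (fun w => (B w)%:R)|
      <= a k.

(** Each function is replaced in turn by the sign of a conditional expectation, at the cost of its
    bound. The factor 4 relates the covariance of two signs, each twice an indicator minus 1, to
    that of the events. *)
Lemma cov_mixing_le n a m k f g (C D : R) : mixing_le n a ->
  determined (fun i => i <= m)%N f -> determined (fun i => m + k <= i < n)%N g ->
  (forall w, `|f w| <= C) -> (forall w, `|g w| <= D) ->
  `|E (fun w => f w * g w) - E f * E g| <= 4 * C * D * a k.
Proof.
move=> mix fI gJ fC gD.
have covE (h h' : Om -> R) : E (fun w => h w * h' w) - E h * E h' =
    \sum_w h w * (p w * (h' w - E h')).
  transitivity (E (fun w => h w * (h' w - E h'))).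
    rewrite [E h * _]mulrC -fexpZ -fexpB; apply: eq_fexp => w; ring.
  by apply: eq_bigr => w _; ring.
have [C0 D0] : (forall w : Om, 0 <= C) /\ (forall w : Om, 0 <= D).
  by split=> w; [exact: le_trans (fC w)|exact: le_trans (gD w)].
have [w0 _ | Om0] := pickP (fun w : Om => true); last first.
  by move: p_sum; rewrite big_pred0 // => /eqP; rewrite eq_sym oner_eq0.
rewrite covE; have [A [AI hA]] := sign_extremal (fun w => p w * (g w - E g)) fI fC.
apply: le_trans hA _; pose sA w := 2 * (A w)%:R - 1 : R.
rewrite -(covE sA) (_ : E _ - _ = E (fun w => g w * sA w) - E g * E sA); last first.
  by rewrite [E g * _]mulrC; congr (_ - _); apply: eq_fexp => w; rewrite mulrC.
rewrite covE; have [B [BJ hB]] := sign_extremal (fun w => p w * (sA w - E sA)) gJ gD.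
rewrite (_ : 4 * C * D * a k = C * (D * (4 * a k))); last by ring.
rewrite ler_wpM2l ?C0 //.
apply: le_trans (ler_norm _) (le_trans hB _).
rewrite ler_wpM2l ?D0 //; pose sB w := 2 * (B w)%:R - 1 : R.
rewrite -(covE sB).
have sE (h : pred Om) : E (fun w => 2 * (h w)%:R - 1) = 2 * E (fun w => (h w)%:R) - 1.
  by rewrite fexpB fexpZ fexp_cst.
rewrite /sA /sB !sE.
have -> : E (fun w => (2 * (B w)%:R - 1) * (2 * (A w)%:R - 1)) =
   4 * E (fun w => (A w && B w)%:R) - 2 * E (fun w => (A w)%:R)
    - 2 * E (fun w => (B w)%:R) + 1.
  rewrite -!fexpZ -[X in _ + X](fexp_cst p_sum) -!fexpB -fexpD.
  by apply: eq_fexp => w; case: (A w); case: (B w); rewrite /=; ring.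
have := le_trans (ler_norm _) (mix m k A B AI BJ).
set x := E _; set y := E _; set u := E _; move=> h.
by rewrite (_ : _ - _ = 4 * (x - y * u)); [rewrite ler_wpM2l | ring].
Qed.

End mixing.

(** * Lindeberg steps for mixing arrays *)

(* [z i] stands for the centered statistic Y_i, replaced by 0 for [i < G], where
   the window of Y_i is truncated. *)
Record weak_array (R : realType) (n G : nat) (K : R) (a gam : nat -> R)
    (Om : finType) (p : Om -> R) (z : nat -> Om -> R) : Prop := WeakArray {
  wa_ge0 : forall w, 0 <= p w;
  wa_sum : \sum_w p w = 1;
  wa_bound : forall i w, `|z i w| <= K;
  wa_mean : forall i, (i < n)%N -> fexp p (z i) = 0;
  wa_cov : forall i l, (G <= i)%N -> (i + l < n)%N ->
    fexp p (fun w => z i w * z (i + l)%N w) = gam l;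
  wa_mix : mixing_le p z n a }.

Section lindeberg_step.
Context {R : realType} (n G : nat) (K : R) (a gam : nat -> R)
  (Om : finType) (p : Om -> R) (z : nat -> Om -> R).
Hypothesis za : weak_array n G K a gam p z.
Local Notation E := (fexp p).
Let p0 := wa_ge0 za.
Let p1 := wa_sum za.
Let zK := wa_bound za.

Lemma wa_K_ge0 : 0 <= K.
Proof.
have [w0 _ | Om0] := pickP (fun w : Om => true); first exact: le_trans (zK 0 w0).
by move: p1; rewrite big_pred0 // => /eqP; rewrite eq_sym oner_eq0.
Qed.
Let K0 := wa_K_ge0.

Lemma wa_gam_le l : (G + l < n)%N -> `|gam l| <= K ^+ 2.
Proof.
move=> Gl; rewrite -(wa_cov za (leqnn G) Gl) (fexp_norm_le p0 p1) // => w.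
by rewrite normrM expr2 ler_pM.
Qed.

Variable dl : R.
Hypothesis dl0 : 0 <= dl.

Definition psum j w : R := dl * \sum_(0 <= i < j) z i w.
Local Notation S := psum.

Lemma psum0 w : S 0 w = 0.
Proof. by rewrite /S big_geq // mulr0. Qed.

Lemma psumS j w : S j.+1 w = S j w + dl * z j w.
Proof. by rewrite /S big_nat_recr //= mulrDr. Qed.

Lemma psum_dist i j w : (i <= j)%N -> `|S j w - S i w| <= dl * K * (j - i)%:R.
Proof.
move=> ij; have [k ->] : exists k, j = (k + i)%N by exists (j - i)%N; rewrite subnK.
rewrite addnK; elim: k => [|k IH]; first by rewrite subrr normr0 mulr0.
rewrite addSn psumS (le_trans (_ : _ <= `|S (k + i) w - S i w| + `|dl * z (k + i)%N w|)) //.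
  by rewrite addrAC ler_normD.
rewrite -natr1 mulrDr mulr1 lerD //.
by rewrite normrM (ger0_norm dl0) ler_wpM2l.
Qed.

Lemma psum_det j : determined z (fun i => i < j)%N (S j).
Proof.
by move=> w w' e; rewrite /S; congr (_ * _); apply: eq_big_nat => i /andP[_ /e].
Qed.

Variables (h : R -> R) (C : R).
Hypothesis hC : forall x, `|h x| <= C.
Hypothesis hL : forall x y, `|h y - h x| <= C * `|y - x|.

Let C0 : 0 <= C. Proof. exact: le_trans (hC 0). Qed.

Lemma lip_psum i j w : (i <= j)%N -> `|h (S j w) - h (S i w)| <= C * (dl * K * (j - i)%:R).
Proof. by move=> ij; rewrite (le_trans (hL _ _)) // ler_wpM2l // psum_dist. Qed.

(* The index [i] is moved back by [M], which costs [O(dl * M)], to open a gap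
   between [h (S (i - M))] and the product. *)
Lemma lag_cov M i l : (G <= i)%N -> (i + l < n)%N -> 
  `|E (fun w => h (S i w) * (z i w * z (i + l)%N w)) - gam l * E (fun w => h (S i w))|
  <= 2 * C * dl * K ^+ 3 * M%:R + 4 * C * K ^+ 2 * `|a M.+1|.
Proof.
move=> Gi il; pose j := (i - M)%N; pose zz w := z i w * z (i + l)%N w.
have zzK w : `|zz w| <= K ^+ 2 by rewrite normrM expr2 ler_pM.
have jM : (i - j)%:R <= M%:R :> R by rewrite ler_nat /j; lia.
have hd w : `|h (S i w) - h (S j w)| <= C * (dl * K * M%:R).
  by rewrite (le_trans (lip_psum _ (leq_subr _ _))) // !ler_wpM2l // mulr_ge0.
have e1 : `|E (fun w => h (S i w) * zz w) - E (fun w => h (S j w) * zz w)|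
    <= C * (dl * K * M%:R) * K ^+ 2.
  by apply: fexp_dist_le => // w; rewrite -mulrBl normrM ler_pM.
have e2 : `|E (fun w => h (S i w)) - E (fun w => h (S j w))| <= C * (dl * K * M%:R).
  exact: fexp_dist_le.
have e3 : `|E (fun w => h (S j w) * zz w) - gam l * E (fun w => h (S j w))|
    <= 4 * C * K ^+ 2 * `|a M.+1|.
  rewrite -(wa_cov za Gi il) mulrC.
  (* The past in [mixing_le] always contains the index 0, hence a separate case: for [j = 0] the sum
     [S j] is the constant 0. *)
  have [j0|j0] := posnP j.
    have e (k : Om -> R) : E (fun w => h (S j w) * k w) = h 0 * E k.
      by rewrite -fexpZ; apply: eq_fexp => w; rewrite j0 psum0.
    rewrite e (_ : E (fun w => h (S j w)) = h 0) ?subrr ?normr0; last first.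
      by rewrite -[RHS](fexp_cst p1); apply: eq_fexp => w; rewrite j0 psum0.
    by rewrite !mulr_ge0 // exprn_ge0.
  apply: le_trans (_ : _ <= 4 * C * K ^+ 2 * a M.+1) _; last first.
    by rewrite ler_wpM2l ?ler_norm // !mulr_ge0 // exprn_ge0.
  apply: (@cov_mixing_le _ _ p z p1 n a j.-1 M.+1 _ zz) => //.
  - exact: wa_mix za.
  - by move=> w w' ww'; rewrite (@psum_det j w w') // => k kj; apply: ww'; lia.
  - by move=> w w' ww'; rewrite /zz (ww' i) ?(ww' (i + l)%N) //=; move: j0; rewrite /j; lia.
have g0 : `|gam l| <= K ^+ 2 by apply: wa_gam_le; lia.
rewrite -/zz.
set x := E _ in e1 *; set y := E _ in e1 e3; set u := E _ in e2 *; set v := E _ in e2 e3.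
have -> : x - gam l * u = (x - y) + (y - gam l * v) - gam l * (u - v) by ring.
rewrite (le_trans (ler_normB _ _)) // [X in _ + X]normrM.
have e4 : `|gam l| * `|u - v| <= K ^+ 2 * (C * (dl * K * M%:R)) by rewrite ler_pM.
have -> : 2 * C * dl * K ^+ 3 * M%:R + 4 * C * K ^+ 2 * `|a M.+1| =
  (C * (dl * K * M%:R) * K ^+ 2 + 4 * C * K ^+ 2 * `|a M.+1|) + K ^+ 2 * (C * (dl * K * M%:R)).
  by ring.
by rewrite lerD // (le_trans (ler_normD _ _)) // lerD.
Qed.

End lindeberg_step.

Section lindeberg_step.
Context {R : realType} (n G : nat) (K : R) (a gam : nat -> R)
  (Om : finType) (p : Om -> R) (z : nat -> Om -> R).
Hypothesis za : weak_array n G K a gam p z.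
Local Notation E := (fexp p).
Let p0 := wa_ge0 za.
Let p1 := wa_sum za.
Let zK := wa_bound za.
Let K0 := wa_K_ge0 za.

Variable dl : R.
Hypothesis dl0 : 0 <= dl.
Local Notation S := (psum z dl).

Variables (f f1 f2 f3 : R -> R) (C : R).
Hypothesis fd : forall x : R, is_derive x 1 f (f1 x).
Hypothesis f1d : forall x : R, is_derive x 1 f1 (f2 x).
Hypothesis f2d : forall x : R, is_derive x 1 f2 (f3 x).
Hypothesis f1C : forall x, `|f1 x| <= C.
Hypothesis f2C : forall x, `|f2 x| <= C.
Hypothesis f3C : forall x, `|f3 x| <= C.

Let C0 : 0 <= C. Proof. exact: le_trans (f1C 0). Qed.

Let dzK i w : `|dl * z i w| <= dl * K.
Proof. by rewrite normrM (ger0_norm dl0) ler_wpM2l. Qed.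

Variables (L M : nat) (tau : R).
Hypothesis tail : forall N, \sum_(L <= l < N) `|a l.+1| <= tau.

(** Error of one expanded lag, per unit of [dl]. The terms are the Taylor remainder of the increment
    of [f1], the cost of [lag_cov], and the passage from [f2] at the earlier partial sum to
    [f2 (S j)]. *)
Definition lag_err : R :=
  C * dl * K ^+ 3 + (2 * C * dl * K ^+ 3 * M%:R + 4 * C * K ^+ 2 * `|a M.+1|)
  + C * dl * K ^+ 3 * L%:R.

Lemma lag_err_ge0 : 0 <= lag_err.
Proof. by rewrite /lag_err !addr_ge0 // !mulr_ge0 // exprn_ge0. Qed.

(* The increments of [f1] along the partial sums: [f1 (S j)] is their sum plus
   the constant [f1 0]. The increment at distance [l] is [O(dl)], so mixing bounds
   its covariance with [z j] by [O(dl) * a l.+1], and for [l < L] it is replaced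
   by its first order expansion. *)
Let D j l w := f1 (S (j - l) w) - f1 (S (j - l.+1) w).

Let far_lag j l : (l < j < n)%N ->
  `|E (fun w => D j l w * z j w)| <= dl * (4 * C * K ^+ 2 * `|a l.+1|).
Proof.
move=> /andP[lj jn].
have e : (j - l = (j - l.+1).+1)%N by lia.
have := @cov_mixing_le _ _ p z p1 n a (j - l.+1) l.+1 (D j l) (z j) (C * (dl * K)) K (wa_mix za).
rewrite (wa_mean za jn) mulr0 subr0 => /(_ _ _ _ _)/le_trans -> //.
- move=> w w' ww'; rewrite /D !(@psum_det _ _ z dl _ w w') // => i ij; apply: ww'; lia.
- by move=> w w' ww'; apply: ww'; lia.
- move=> w; rewrite /D e (le_trans (lipschitz_of_derive _ _ f1d f2C)) //.
  by rewrite ler_wpM2l // psumS addrAC subrr add0r.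
- rewrite [leRHS](_ : _ = 4 * (C * (dl * K)) * K * `|a l.+1|); last by ring.
  by rewrite ler_wpM2l ?ler_norm // !mulr_ge0.
Qed.

Let near_lag j l : (l < L)%N -> (L + G <= j < n)%N ->
  `|E (fun w => D j l w * z j w) - dl * (gam l.+1 * E (fun w => f2 (S j w)))|
  <= dl * lag_err.
Proof.
move=> lL /andP[Lj jn]; pose k := (j - l.+1)%N.
have e : (j - l = k.+1)%N by rewrite /k; lia.
have ek : j = (k + l.+1)%N by rewrite /k; lia.
have Gk : (G <= k)%N by rewrite /k; lia.
pose zz w := z k w * z (k + l.+1)%N w.
have e1 : `|E (fun w => D j l w * z j w) - dl * E (fun w => f2 (S k w) * zz w)|
    <= C * (dl * K) ^+ 2 * K.
  rewrite -fexpZ; apply: fexp_dist_le => // w; rewrite /zz -ek.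
  rewrite (_ : _ - _ = (D j l w - f2 (S k w) * (dl * z k w)) * z j w); last by ring.
  rewrite normrM ler_pM // /D e -/k.
  have := taylor1 (S k w) (S k.+1 w) f1d f2d f3C.
  have -> : S k.+1 w - S k w = dl * z k w by rewrite psumS addrAC subrr add0r.
  move/le_trans; apply; rewrite ler_wpM2l // lerXn2r ?nnegrE ?mulr_ge0 //.
have kl : (k + l.+1 < n)%N by rewrite -ek.
have e2 := lag_cov za dl0 f2C (fun x y => lipschitz_of_derive x y f2d f3C) M Gk kl.
have e3 : `|E (fun w => f2 (S k w)) - E (fun w => f2 (S j w))| <= C * (dl * K * L%:R).
  apply: fexp_dist_le => // w; rewrite distrC.
  rewrite (le_trans (lip_psum za dl0 _ (fun x y => lipschitz_of_derive x y f2d f3C) w (_ : (k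
      <= j)%N))) //.
    by rewrite /k leq_subr.
  by rewrite !ler_wpM2l ?mulr_ge0 // ler_nat /k; lia.
have g0 : `|gam l.+1| <= K ^+ 2 by apply: (wa_gam_le za); lia.
have e4 : `|gam l.+1 * (E (fun w => f2 (S k w)) - E (fun w => f2 (S j w)))|
   <= K ^+ 2 * (C * (dl * K * L%:R)) by rewrite normrM ler_pM.
rewrite -/zz in e2.
move: e1 e2 e3 e4; set x := E _; set y := E _; set u := E _; set v := E _ => e1 e2 e3 e4.
have -> : x - dl * (gam l.+1 * v) = (x - dl * y) + dl * (y - gam l.+1 * u) +
   dl * (gam l.+1 * (u - v)) by ring.
have e5 : `|dl * (y - gam l.+1 * u)| <= dl * (2 * C * dl * K ^+ 3 * M%:R + 4 * C * K ^+ 2 * `|a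
    M.+1|).
  by rewrite normrM (ger0_norm dl0) ler_wpM2l.
have e6 : `|dl * (gam l.+1 * (u - v))| <= dl * (K ^+ 2 * (C * (dl * K * L%:R))).
  by rewrite normrM (ger0_norm dl0) ler_wpM2l.
rewrite (le_trans (ler_normD _ _)) //.
rewrite [leRHS](_ : _ = (C * (dl * K) ^+ 2 * K + dl * (2 * C * dl * K ^+ 3 * M%:R + 4 * C * K
    ^+ 2 * `|a M.+1|))
  + dl * (K ^+ 2 * (C * (dl * K * L%:R)))); last by rewrite /lag_err; ring.
by rewrite lerD // (le_trans (ler_normD _ _)) // lerD.
Qed.

(** Half of the long-run variance truncated at [L] lags: [gam 0 / 2] is due to the second order
    Taylor term, the sum to the first order one. *)
Let sigL := gam 0 / 2 + \sum_(0 <= l < L) gam l.+1.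

Lemma first_order j : (L + G <= j < n)%N ->
  `|E (fun w => f1 (S j w) * z j w) -
      dl * ((\sum_(0 <= l < L) gam l.+1) * E (fun w => f2 (S j w)))|
  <= dl * (4 * C * K ^+ 2 * tau + L%:R * lag_err).
Proof.
move=> Ljn; have [Lj jn] := andP Ljn.
have -> : E (fun w => f1 (S j w) * z j w) =
   \sum_(0 <= l < j) E (fun w => D j l w * z j w).
  have -> : E (fun w => f1 (S j w) * z j w) =
     E (fun w => f1 0 * z j w + \sum_(0 <= l < j) D j l w * z j w).
    apply: eq_fexp => w; rewrite -big_distrl /= -mulrDl; congr (_ * _).
    rewrite (@telescope_sumr_eq _ 0 j (fun l => - f1 (S (j - l) w))) // ?subn0 ?subnn ?psum0.
      by ring.
    by move=> l _; rewrite /D opprK addrC.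
  rewrite fexpD fexpZ (wa_mean za jn) mulr0 add0r fexp_sum.
  by [].
have Lj' : (L <= j)%N by lia.
rewrite (big_cat_nat (n := L)) //= addrAC.
rewrite (le_trans (ler_normD _ _)) // [4 * _ * _ * _ + _]addrC mulrDr lerD //; last first.
  rewrite (le_trans (ler_norm_sum _ _ _)) //.
  apply: (@le_trans _ _ (\sum_(L <= l < j) dl * (4 * C * K ^+ 2 * `|a l.+1|))).
    by apply: ler_sum_nat => l /andP[_ lj]; apply: far_lag; rewrite lj.
  by rewrite -!mulr_sumr !ler_wpM2l // !mulr_ge0 // exprn_ge0.
rewrite mulr_suml mulr_sumr -sumrB.
rewrite (le_trans (ler_norm_sum _ _ _)) //.
rewrite (_ : dl * (L%:R * _) = \sum_(0 <= l < L) dl * lag_err); last first.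
  by rewrite sumr_const_nat subn0 -[RHS]mulr_natl mulrCA.
by apply: ler_sum_nat => l /andP[_ lL]; exact: near_lag.
Qed.

Lemma lindeberg_step j : (L + G <= j < n)%N ->
  `|E (fun w => f (S j.+1 w)) - E (fun w => f (S j w)) -
      dl ^+ 2 * (sigL * E (fun w => f2 (S j w)))|
  <= dl ^+ 2 * (4 * C * K ^+ 2 * tau + (L%:R + 1) * lag_err).
Proof.
move=> Ljn; have [Lj jn] := andP Ljn.
pose q w := z j w * z (j + 0)%N w.
have e1 : `|E (fun w => f (S j.+1 w)) - (E (fun w => f (S j w)) +
   dl * E (fun w => f1 (S j w) * z j w) + dl ^+ 2 / 2 * E (fun w => f2 (S j w) * q w))|
   <= C * (dl * K) ^+ 3.
  rewrite -!fexpZ -!fexpD; apply: fexp_dist_le => // w; rewrite /q addn0.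
  have tay := taylor2 (S j w) (S j.+1 w) fd f1d f2d f3C.
  have dS : S j.+1 w - S j w = dl * z j w by rewrite psumS addrAC subrr add0r.
  rewrite dS in tay.
  rewrite (_ : _ - _ = f (S j.+1 w) - f (S j w) - f1 (S j w) * (dl * z j w) - f2 (S j w) / 2 *
      (dl * z j w) ^+ 2);
    last by field.
  apply: le_trans tay _; rewrite ler_wpM2l // lerXn2r ?nnegrE ?mulr_ge0 //.
have Gj : (G <= j)%N by lia.
have jn0 : (j + 0 < n)%N by rewrite addn0.
have e2 := lag_cov za dl0 f2C (fun x y => lipschitz_of_derive x y f2d f3C) M Gj jn0.
have e3 := first_order Ljn.
rewrite -/q in e2; move: e1 e2 e3.
set x := E _; set y := E _; set u := E _; set v := E _; set t := E _ => e1 e2 e3.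
have e2' : `|dl ^+ 2 / 2 * (v - gam 0 * t)| <= dl ^+ 2 / 2 * (2 * C * dl * K ^+ 3 * M%:R + 4 *
    C * K ^+ 2 * `|a M.+1|).
  by rewrite normrM ger0_norm ?ler_wpM2l // mulr_ge0 ?exprn_ge0 ?invr_ge0.
have e3' : `|dl * (u - dl * ((\sum_(0 <= l < L) gam l.+1) * t))| <=
  dl * (dl * (4 * C * K ^+ 2 * tau + L%:R * lag_err)).
  by rewrite normrM (ger0_norm dl0) ler_wpM2l.
rewrite (_ : x - y - _ = (x - (y + dl * u + dl ^+ 2 / 2 * v)) + dl ^+ 2 / 2 * (v - gam 0 * t)
  + dl * (u - dl * ((\sum_(0 <= l < L) gam l.+1) * t))); last first.
  by rewrite /sigL; field.
rewrite (le_trans (ler_normD _ _)) //.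
apply: le_trans (lerD (le_trans (ler_normD _ _) (lerD e1 e2')) e3') _.
have e4 : 0 <= C * dl * K ^+ 3 * L%:R by rewrite !mulr_ge0 // exprn_ge0.
have e5 : 0 <= 2 * C * dl * K ^+ 3 * M%:R + 4 * C * K ^+ 2 * `|a M.+1|.
  by rewrite addr_ge0 // !mulr_ge0 // exprn_ge0.
have : dl ^+ 2 * (C * dl * K ^+ 3 + (2 * C * dl * K ^+ 3 * M%:R + 4 * C * K ^+ 2 * `|a M.+1|) /
    2) <= dl ^+ 2 * lag_err.
  by rewrite ler_wpM2l ?exprn_ge0 // /lag_err; move: e4 e5; lra.
move: (lag_err) => LE; set B := (2 * C * _ * _ * _ + _); move=> h.
rewrite [leRHS](_ : _ = dl ^+ 2 * LE + dl * (dl * (4 * C * K ^+ 2 * tau + L%:R * LE))); last by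
    ring.
by rewrite lerD2r (le_trans _ h) // le_eqVlt; apply/orP; left; apply/eqP; field.
Qed.

(** Meant for the steps [j < L + G], too close to the start for the expansion. Their number does not
    depend on [n], so a bound of order [dl] is enough. *)
Lemma crude_step j :
  `|E (fun w => f (S j.+1 w)) - E (fun w => f (S j w))| <= C * (dl * K).
Proof.
apply: fexp_dist_le => // w; rewrite (le_trans (lipschitz_of_derive _ _ fd f1C)) //.
by rewrite ler_wpM2l // psumS addrAC subrr add0r.
Qed.

End lindeberg_step.

Lemma sqrtr_sqr_ge0 (R : rcfType) (x : R) : 0 <= x -> Num.sqrt (x ^+ 2) = x.
Proof. by move=> x0; rewrite sqrtr_sqr ger0_norm. Qed.

Lemma invsqrt_small (R : realType) (e : R) : 0 < e ->
  exists N, forall n, (N <= n)%N -> (0 < n)%N /\ (Num.sqrt n%:R)^-1 <= e.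
Proof.
move=> e0; have e20 : 0 < e ^+ 2 by rewrite exprn_gt0.
exists (Num.bound (e ^- 2)).+1 => n Nn.
have n0 : (0 < n)%N by apply: leq_trans Nn.
split=> //; have ne : e ^- 2 <= n%:R.
  have /archi_boundP/ltW/le_trans : 0 <= e ^- 2 by rewrite invr_ge0 ltW.
  by apply; rewrite ler_nat; exact: ltnW.
rewrite -[e]invrK lef_pV2 ?posrE ?invr_gt0 ?sqrtr_gt0 ?ltr0n //.
by rewrite -[e^-1]sqrtr_sqr_ge0 // ?ler_wsqrtr ?exprVn // invr_ge0 ltW.
Qed.

(** * Telescoping along the heat equation *)

Section heat_telescope.
Context {R : realType} (n G : nat) (K : R) (a gam : nat -> R)
  (Om : finType) (p : Om -> R) (z : nat -> Om -> R).
Hypothesis za : weak_array n G K a gam p z.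
Hypothesis n0 : (0 < n)%N.
Local Notation E := (fexp p).
Let p0 := wa_ge0 za.
Let p1 := wa_sum za.
Let K0 := wa_K_ge0 za.
Local Notation dl := (Num.sqrt (n%:R : R))^-1.
Local Notation S := (psum z dl).

Let dl0 : 0 <= dl. Proof. by rewrite invr_ge0 sqrtr_ge0. Qed.
Let dl2 : dl ^+ 2 = n%:R^-1. Proof. by rewrite exprVn sqr_sqrtr. Qed.
Let ndl2 : n%:R * dl ^+ 2 = 1. Proof. by rewrite dl2 divff // pnatr_eq0 -lt0n. Qed.

Variables (s2 eps rho tau t : R) (L M : nat).
Hypothesis s20 : 0 <= s2.
Hypothesis eps0 : 0 < eps.
Hypothesis eps1 : eps <= 1.
Hypothesis LG : (L + G <= n)%N.
Hypothesis tail : forall N, \sum_(L <= l < N) `|a l.+1| <= tau.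
Hypothesis gam_rho : `|gam 0 + 2 * (\sum_(0 <= l < L) gam l.+1) - s2| <= rho.

(** A common bound for the three space derivatives, of sizes [16 / r], [16 / r ^+ 2] and
    [32 / r ^+ 3], since [r >= eps] and [eps <= 1]. *)
Let C := 32 / eps ^+ 3.
(* [u j] is the expectation of [u n], a smoothed indicator, after adding to its
   argument the centered Gaussian variable of variance [s2 * (n - j) / n] which
   replaces the increments not yet summed. *)
Let q j := eps ^+ 2 + s2 * ((n - j)%:R * dl ^+ 2).
Let u j := heat t (Num.sqrt (q j)).

Let q_ge j : eps ^+ 2 <= q j.
Proof. by rewrite lerDl !mulr_ge0 // exprn_ge0. Qed.
Let q_gt0 j : 0 < q j.
Proof. by rewrite (lt_le_trans _ (q_ge j)) // exprn_gt0. Qed.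
Let r_ge j : eps <= Num.sqrt (q j).
Proof. by rewrite -[eps]sqrtr_sqr_ge0 ?ler_wsqrtr // ltW. Qed.
Let r_gt0 j : 0 < Num.sqrt (q j).
Proof. by rewrite (lt_le_trans _ (r_ge j)). Qed.
Let C0 : 0 <= C.
Proof. by rewrite mulr_ge0 // invr_ge0 exprn_ge0 // ltW. Qed.

Let C_ge (c : R) k j : c <= 32 -> (k <= 3)%N -> c / Num.sqrt (q j) ^+ k <= C.
Proof.
move=> c32 k3; have rk : 0 < Num.sqrt (q j) ^+ k by rewrite exprn_gt0.
apply: (@le_trans _ _ (32 / Num.sqrt (q j) ^+ k)).
  by rewrite ler_wpM2r // invr_ge0 ltW.
rewrite ler_wpM2l // lef_pV2 ?posrE ?exprn_gt0 //.
apply: (@le_trans _ _ (eps ^+ k)).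
  by rewrite ler_wiXn2l // ltW.
by rewrite lerXn2r ?nnegrE // ltW.
Qed.

Let h1C j x : `|heat1 t (Num.sqrt (q j)) x| <= C.
Proof.
by apply: le_trans (heat1_le _ (r_gt0 j) _) _; rewrite -[Num.sqrt _]expr1 C_ge // ler_nat.
Qed.
Let h2C j x : `|heat2 t (Num.sqrt (q j)) x| <= C.
Proof. by apply: le_trans (heat2_le _ (r_gt0 j) _) _; rewrite C_ge // ler_nat. Qed.
Let h3C j x : `|heat3 t (Num.sqrt (q j)) x| <= C.
Proof. by apply: le_trans (heat3_le _ (r_gt0 j) _) _; rewrite C_ge // ler_nat. Qed.

Let B := 16 / eps ^+ 4 * s2 ^+ 2.
Let B0 : 0 <= B.
Proof. by rewrite !mulr_ge0 ?exprn_ge0 // invr_ge0 exprn_ge0 // ltW. Qed.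

Let time_step j x : (j < n)%N ->
  `|u j x - u j.+1 x - dl ^+ 2 * (s2 / 2 * heat2 t (Num.sqrt (q j.+1)) x)|
  <= dl ^+ 2 * (B * dl ^+ 2).
Proof.
move=> jn; have qE : q j = q j.+1 + s2 * dl ^+ 2.
  have -> : q j = eps ^+ 2 + s2 * ((n - j.+1).+1%:R * dl ^+ 2) by rewrite /q -subSn.
  by rewrite /q -natr1; ring.
have h0 : 0 <= s2 * dl ^+ 2 by rewrite mulr_ge0 // exprn_ge0.
have := heat_equation t x (q_gt0 j.+1) h0; rewrite -qE -/(u j x) -/(u j.+1 x) => h.
have -> : dl ^+ 2 * (s2 / 2 * heat2 t (Num.sqrt (q j.+1)) x) =
  s2 * dl ^+ 2 / 2 * heat2 t (Num.sqrt (q j.+1)) x by ring.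
apply: le_trans h _.
rewrite (_ : dl ^+ 2 * (B * dl ^+ 2) = 16 / eps ^+ 4 * (s2 * dl ^+ 2) ^+ 2); last first.
  by rewrite /B; ring.
rewrite ler_wpM2r ?exprn_ge0 // ler_wpM2l // lef_pV2 ?posrE ?exprn_gt0 //.
rewrite (_ : eps ^+ 4 = (eps ^+ 2) ^+ 2); last by rewrite -exprM.
by rewrite lerXn2r ?nnegrE ?exprn_ge0 // ltW.
Qed.

Let time_step_mean j : (j < n)%N ->
  `|E (fun w => u j (S j w)) - E (fun w => u j.+1 (S j w)) -
     dl ^+ 2 * (s2 / 2 * E (fun w => heat2 t (Num.sqrt (q j.+1)) (S j w)))|
  <= dl ^+ 2 * (B * dl ^+ 2).
Proof.
move=> jn; rewrite -!fexpZ -!fexpB; apply: fexp_norm_le => // w.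
exact: time_step.
Qed.

(** As [n * dl ^+ 2 = 1], this bounds the total of the main steps. Its terms come from the far lags,
    the expanded lags together with the Taylor remainder, the truncation of the long-run variance,
    and the discretization of time. *)
Definition telescope_err : R :=
  4 * C * K ^+ 2 * tau + (L%:R + 1) * lag_err K a dl C L M + C * rho + B * dl ^+ 2.

Let main_step j : (L + G <= j < n)%N ->
  `|E (fun w => u j.+1 (S j.+1 w)) - E (fun w => u j (S j w))|
  <= dl ^+ 2 * telescope_err.
Proof.
move=> Ljn; have [_ jn] := andP Ljn.
have r0 := r_gt0 j.+1.
have e1 := lindeberg_step za dl0 (is_derive_heat t _) (is_derive_heat1 t r0)
  (is_derive_heat2 t r0) (h1C j.+1) (h2C j.+1) (h3C j.+1) M tail Ljn.
have e2 := time_step_mean jn.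
rewrite -/(u j.+1) in e1; move: e1 e2.
set x := E _; set y := E _; set v := E _; set v' := E _ => e1 e2.
have e3 : `|dl ^+ 2 * ((gam 0 / 2 + \sum_(0 <= l < L) gam l.+1 - s2 / 2) * v)| <=
   dl ^+ 2 * (C * rho).
  rewrite normrM ger0_norm ?exprn_ge0 // ler_wpM2l ?exprn_ge0 // normrM mulrC.
  rewrite ler_pM // ?(fexp_norm_le p0 p1) //.
  rewrite (_ : _ - _ = (gam 0 + 2 * (\sum_(0 <= l < L) gam l.+1) - s2) / 2); last by field.
  rewrite normrM [`|2^-1|]ger0_norm ?invr_ge0 //.
  by have := normr_ge0 (gam 0 + 2 * (\sum_(0 <= l < L) gam l.+1) - s2); move: gam_rho; lra.
(* The second derivative gained in space cancels the one lost in time, up to the difference between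
   [s2] and its truncation. *)
rewrite (_ : x - v' = (x - y - dl ^+ 2 * ((gam 0 / 2 + \sum_(0 <= l < L) gam l.+1) * v))
  + dl ^+ 2 * ((gam 0 / 2 + \sum_(0 <= l < L) gam l.+1 - s2 / 2) * v)
  - (v' - y - dl ^+ 2 * (s2 / 2 * v))); last by ring.
rewrite (le_trans (ler_normB _ _)) //.
apply: le_trans (lerD (le_trans (ler_normD _ _) (lerD e1 e3)) e2) _.
by rewrite /telescope_err le_eqVlt; apply/orP; left; apply/eqP; ring.
Qed.

Definition crude_err : R := C * (dl * K) + dl ^+ 2 * (s2 * C + B * dl ^+ 2).

Let initial_step j : (j < n)%N ->
  `|E (fun w => u j.+1 (S j.+1 w)) - E (fun w => u j (S j w))| <= crude_err.
Proof.
move=> jn; have r0 := r_gt0 j.+1.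
have e1 := crude_step za dl0 (is_derive_heat t _) (h1C j.+1) j.
have e2 := time_step_mean jn.
rewrite -/(u j.+1) in e1; move: e1 e2.
set x := E _; set y := E _; set v' := E _; set v := E _ => e1 e2.
have e3 : `|dl ^+ 2 * (s2 / 2 * v)| <= dl ^+ 2 * (s2 * C).
  rewrite normrM ger0_norm ?exprn_ge0 // ler_wpM2l ?exprn_ge0 // normrM.
  have s2h : `|s2 / 2| <= s2 by rewrite ger0_norm; move: s20; lra.
  by rewrite ler_pM // (fexp_norm_le p0 p1).
rewrite (_ : x - v' = (x - y) - dl ^+ 2 * (s2 / 2 * v)
  - (v' - y - dl ^+ 2 * (s2 / 2 * v))); last by ring.
rewrite (le_trans (ler_normB _ _)) //.
apply: le_trans (lerD (le_trans (ler_normB _ _) (lerD e1 e3)) e2) _.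
by rewrite /crude_err le_eqVlt; apply/orP; left; apply/eqP; ring.
Qed.

(** The two expectations are the ends of one telescoping sum: at time 0 the partial sum is 0 and the
    whole variance [eps ^+ 2 + s2] is Gaussian, at time [n] only the smoothing [eps] remains. *)
Lemma heat_telescope :
  `|E (fun w => Phi ((t - S n w) / eps)) - Phi (t / Num.sqrt (eps ^+ 2 + s2))|
  <= telescope_err + (L + G)%:R * crude_err.
Proof.
have -> : Phi (t / Num.sqrt (eps ^+ 2 + s2)) = E (fun w => u 0 (S 0 w)).
  rewrite -[LHS](fexp_cst p1); apply: eq_fexp => w.
  by rewrite /u /heat psum0 subr0 /q subn0 ndl2 mulr1.
have -> : E (fun w => Phi ((t - S n w) / eps)) = E (fun w => u n (S n w)).
  apply: eq_fexp => w; rewrite /u /heat /q subnn mul0r mulr0 addr0.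
  by rewrite sqrtr_sqr_ge0 // ltW.
rewrite -(telescope_sumr (fun j => E (fun w => u j (S j w)))) //.
have te0 : 0 <= telescope_err.
  have tau0 : 0 <= tau by rewrite (le_trans _ (tail 0)) // big_geq.
  have rho0 : 0 <= rho by rewrite (le_trans _ gam_rho).
  have L1 : 0 <= L%:R + 1 :> R by rewrite natr1.
  have le0 := lag_err_ge0 za dl0 (h1C 0) L M.
  by rewrite /telescope_err !addr_ge0 // !mulr_ge0 // ?invr_ge0 ?exprn_ge0 // ltW.
rewrite (big_cat_nat (n := (L + G)%N)) //= addrC.
rewrite (le_trans (ler_normD _ _)) // lerD //.
  rewrite (le_trans (ler_norm_sum _ _ _)) //.
  apply: (@le_trans _ _ (\sum_(L + G <= j < n) dl ^+ 2 * telescope_err)).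
    by apply: ler_sum_nat => j /main_step.
  rewrite sumr_const_nat -[leLHS]mulr_natl mulrA ler_piMl // -[leRHS]ndl2.
  by rewrite ler_wpM2r ?exprn_ge0 // ler_nat leq_subr.
rewrite (le_trans (ler_norm_sum _ _ _)) //.
apply: (@le_trans _ _ (\sum_(0 <= j < L + G) crude_err)).
  by apply: ler_sum_nat => j /andP[_ jLG]; apply: initial_step; exact: leq_trans LG.
by rewrite sumr_const_nat subn0 -[leLHS]mulr_natl.
Qed.

End heat_telescope.

(** Choosing [e / (c + 1)] rather than [e / c] allows [c = 0]. *)
Lemma mul_small (R : realFieldType) (c e : R) : 0 <= c -> 0 < e -> c * (e / (c + 1)) <= e.
Proof.
move=> c0 e0; rewrite mulrA ler_pdivrMr ?ltr_wpDl // mulrC.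
by rewrite ler_wpM2l ?lerDl // ltW.
Qed.

Record lag_limits (R : realType) (a gam : nat -> R) (s2 : R) : Prop := LagLimits {
  ll_tail : forall e : R, 0 < e -> exists L, forall N, \sum_(L <= l < N) `|a l.+1| <= e;
  ll_var : forall e : R, 0 < e -> exists L0, forall L, (L0 <= L)%N ->
    `|gam 0 + 2 * (\sum_(0 <= l < L) gam l.+1) - s2| <= e }.

Section clt.
Context {R : realType} (G : nat) (K : R) (a gam : nat -> R) (s2 : R).
Hypothesis K0 : 0 <= K.
Hypothesis ll : lag_limits a gam s2.

(** [L] is taken large for the tail of the mixing coefficients and for the truncated variance; what
    is left after [M] is chosen is of order [dl]. The threshold depends neither on the array nor on
    [t]. *)
Lemma smoothed_clt (eps eta : R) : 0 <= s2 -> 0 < eps <= 1 -> 0 < eta ->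
  exists N, forall n, (N <= n)%N ->
  forall (Om : finType) (p : Om -> R) (z : nat -> Om -> R),
  weak_array n G K a gam p z -> forall t,
  `|fexp p (fun w => Phi ((t - psum z (Num.sqrt n%:R)^-1 n w) / eps)) -
    Phi (t / Num.sqrt (eps ^+ 2 + s2))| <= eta.
Proof.
move=> s20 /andP[eps0 eps1] eta0; have e0 : 0 < eta / 4 by rewrite divr_gt0.
have [C CE] : exists C, C = 32 / eps ^+ 3 by eexists.
have [B BE] : exists B, B = 16 / eps ^+ 4 * s2 ^+ 2 by eexists.
have C0 : 0 <= C by rewrite CE mulr_ge0 // invr_ge0 exprn_ge0 // ltW.
have B0 : 0 <= B by rewrite BE !mulr_ge0 ?exprn_ge0 // invr_ge0 exprn_ge0 // ltW.
pose c := 4 * C * K ^+ 2.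
have c0 : 0 <= c by rewrite mulr_ge0 ?exprn_ge0 // mulr_ge0.
have small (d : R) : 0 <= d -> 0 < eta / 4 / (d + 1).
  by move=> d0; rewrite divr_gt0 // ltr_wpDl.
have [L1 tailL1] := ll_tail ll (small _ c0).
have [L2 varL2] := ll_var ll (small _ C0).
pose L := maxn L1 L2.
have tailL N : \sum_(L <= l < N) `|a l.+1| <= eta / 4 / (c + 1).
  apply: le_trans (tailL1 N); have [NL|LN] := leqP N L.
    by rewrite big_geq // sumr_ge0.
  by rewrite [leRHS](big_cat_nat (leq_maxl L1 L2) (ltnW LN)) /= lerDr sumr_ge0.
have varL := varL2 L (leq_maxr _ _).
have cL0 : 0 <= (L%:R + 1) * c by rewrite mulr_ge0 // natr1.
(* [a M.+1] is bounded as a tail reduced to its first term. [M] comes after [L] because this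
   coefficient is paid once for each expanded lag. *)
have [M /(_ M.+1)] := ll_tail ll (small _ cL0).
rewrite big_nat1 => aM.
(* Collects the coefficients of the terms of order [dl]; those of higher order are absorbed since
   [dl <= 1]. *)
pose D := (L%:R + 1) * (C * K ^+ 3 + 2 * C * K ^+ 3 * M%:R + C * K ^+ 3 * L%:R) + B
  + (L + G)%:R * (C * K + s2 * C + B).
have D0 : 0 <= D.
  by rewrite /D natr1; repeat (apply: addr_ge0 || apply: mulr_ge0); rewrite ?exprn_ge0.
have [N1 hN1] := invsqrt_small (small _ D0).
have [N2 hN2] := invsqrt_small (@ltr01 R).
exists (maxn (maxn N1 N2) (L + G)%N) => n.
rewrite !geq_max => /andP[/andP[/hN1[n0 d1] /hN2[_ d2]] LGn] Om p z za t.
have := heat_telescope za n0 t M s20 eps0 eps1 LGn tailL varL.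
move/le_trans; apply; rewrite /telescope_err /crude_err -CE -BE.
set dl := (Num.sqrt _)^-1; have dl0 : 0 <= dl by rewrite invr_ge0 sqrtr_ge0.
rewrite -/dl in d1 d2.
have dl2 : dl ^+ 2 <= dl by rewrite expr2 ler_piMl.
have h1 : c * (eta / 4 / (c + 1)) <= eta / 4 by exact: mul_small.
have h2 : C * (eta / 4 / (C + 1)) <= eta / 4 by exact: mul_small.
have h3 : ((L%:R + 1) * c) * `|a M.+1| <= eta / 4.
  by apply: le_trans (mul_small cL0 e0); rewrite ler_wpM2l.
have h4 : D * dl <= eta / 4 by apply: le_trans (mul_small D0 e0); rewrite ler_wpM2l.
have h5 : B * dl ^+ 2 <= B * dl by rewrite ler_wpM2l.
have h6 : (L + G)%:R * (C * (dl * K) + dl ^+ 2 * (s2 * C + B * dl ^+ 2)) <=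
   (L + G)%:R * (C * K + s2 * C + B) * dl.
  rewrite -mulrA ler_wpM2l //.
  have -> : (C * K + s2 * C + B) * dl = C * (dl * K) + dl * (s2 * C + B) by ring.
  rewrite lerD2l ler_pM ?exprn_ge0 ?addr_ge0 ?mulr_ge0 ?exprn_ge0 //.
  by rewrite lerD2l ler_piMr // (le_trans dl2).
rewrite [leRHS](_ : _ = eta / 4 + eta / 4 + eta / 4 + eta / 4); last by field.
have -> : 4 * C * K ^+ 2 * (eta / 4 / (c + 1)) + (L%:R + 1) * lag_err K a dl C L M +
   C * (eta / 4 / (C + 1)) + B * dl ^+ 2 = 
   c * (eta / 4 / (c + 1)) + C * (eta / 4 / (C + 1)) + ((L%:R + 1) * c) * `|a M.+1|
   + ((L%:R + 1) * (C * K ^+ 3 + 2 * C * K ^+ 3 * M%:R + C * K ^+ 3 * L%:R)) * dl + B * dl ^+ 2.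
  by rewrite /lag_err -/c; ring.
apply: (@le_trans _ _ (c * (eta / 4 / (c + 1)) + C * (eta / 4 / (C + 1)) + ((L%:R + 1) * c) *
    `|a M.+1| + D * dl)).
  rewrite (_ : D * dl = ((L%:R + 1) * (C * K ^+ 3 + 2 * C * K ^+ 3 * M%:R + C * K ^+ 3 * L%:R)) * dl
    + B * dl + (L + G)%:R * (C * K + s2 * C + B) * dl); last by rewrite /D; ring.
  by move: h5 h6; lra.
by rewrite !lerD.
Qed.

Lemma sqrt_add_le (x y : R) : 0 <= x -> 0 <= y -> Num.sqrt (x ^+ 2 + y ^+ 2) <= x + y.
Proof.
move=> x0 y0; rewrite -[leRHS]sqrtr_sqr_ge0 ?addr_ge0 // ler_wsqrtr // sqrrD.
by rewrite lerD2r lerDl mulrn_wge0 // mulr_ge0.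
Qed.

(** The indicator of [W <= y] is squeezed between smoothed indicators whose thresholds are shifted
    by [k * eps] down and up, with errors [Phi (- k)] and [1 - Phi k]. So [k] is chosen for the
    tails, and [eps] according to [k], to make both the shift and the extra variance [eps ^+ 2]
    negligible. *)
Lemma cdf_clt (y eta : R) : 0 < s2 -> 0 < eta ->
  exists N, forall n, (N <= n)%N ->
  forall (Om : finType) (p : Om -> R) (z : nat -> Om -> R),
  weak_array n G K a gam p z ->
  `|fexp p (fun w => (psum z (Num.sqrt n%:R)^-1 n w <= y)%R%:R) -
    Phi (y / Num.sqrt s2)| <= eta.
Proof.
move=> s20 eta0; have e0 : 0 < eta / 3 by rewrite divr_gt0.
have [k k0 [k1 k2]] := Phi_tail e0.
pose s := Num.sqrt s2; have s0 : 0 < s by rewrite sqrtr_gt0.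
pose D := 16 * (`|y| / s ^+ 2 + k / s).
have D0 : 0 <= D.
  by rewrite /D mulr_ge0 ?addr_ge0 ?mulr_ge0 ?invr_ge0 ?exprn_ge0 // ltW.
pose eps := Num.min 1 (eta / 3 / (D + 1)).
have eps0 : 0 < eps by rewrite lt_min ltr01 divr_gt0 // ltr_wpDl.
have eps01 : 0 < eps <= 1 by rewrite eps0 ge_min lexx.
have [N hN] := smoothed_clt (ltW s20) eps01 e0; exists N => n /hN{}hN Om p z za.
have p0 := wa_ge0 za; have p1 := wa_sum za.
pose r := Num.sqrt (eps ^+ 2 + s2).
have r_ge : s <= r by rewrite ler_wsqrtr // lerDr exprn_ge0 // ltW.
have r0 : 0 < r by exact: lt_le_trans r_ge.
have r_le : r <= s + eps.
  rewrite addrC /r -[s2](sqr_sqrtr (ltW s20)); apply: sqrt_add_le; exact: ltW.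
have close (b : R) : `|b| <= k -> `|Phi ((y + b * eps) / r) - Phi (y / s)| <= eta / 3.
  move=> bk; apply: le_trans (Phi_lipschitz _ _) _.
  apply: (@le_trans _ _ (D * eps)); last first.
    by apply: le_trans (mul_small D0 e0); rewrite ler_wpM2l // ge_min lexx orbT.
  rewrite /D -mulrA ler_wpM2l // [leRHS]mulrDl.
  rewrite (_ : _ - _ = b * eps / r - y * ((r - s) / (s * r))); last first.
    by field; rewrite !gt_eqF.
  rewrite (le_trans (ler_normB _ _)) // [leLHS]addrC lerD //.
    rewrite normrM -[leRHS]mulrA ler_wpM2l // ger0_norm; last first.
      by rewrite divr_ge0 ?subr_ge0 // mulr_ge0 // ltW.
    rewrite [leRHS]mulrC ler_pM ?subr_ge0 ?invr_ge0 ?mulr_ge0 ?(ltW s0) ?(ltW r0) //.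
      by rewrite lerBlDl.
    by rewrite lef_pV2 ?posrE ?exprn_gt0 ?mulr_gt0 // expr2 ler_wpM2l // ltW.
  rewrite normrM normfV (gtr0_norm r0) normrM (gtr0_norm eps0) mulrAC.
  by rewrite ler_wpM2r ?(ltW eps0) // ler_pM ?invr_ge0 ?(ltW r0) // lef_pV2 ?posrE.
have kk : `|k| <= k by rewrite gtr0_norm.
have kk' : `|- k| <= k by rewrite normrN.
have := close _ kk; have := close _ kk'; rewrite -/s => cl2 cl1.
have := hN Om p z za (y + k * eps); have := hN Om p z za (y + - k * eps).
rewrite -/r => sm2 sm1.
set Pr := fexp p _.
have up : Pr <= fexp p (fun w => Phi ((y + k * eps - psum z (Num.sqrt n%:R)^-1 n w) / eps)) +
    (1 - Phi k).
  rewrite -[1 - Phi k](fexp_cst p1) -fexpD; apply: fexp_le => // w.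
  case: (leP (psum _ _ _ _) y) => [Wy|_]; last by rewrite addr_ge0 ?Phi_ge0 ?subr_ge0 ?Phi_le1.
  rewrite addrCA lerDl subr_ge0 Phi_le // ler_pdivlMr //.
  by rewrite addrAC lerDr subr_ge0.
have lo : fexp p (fun w => Phi ((y + - k * eps - psum z (Num.sqrt n%:R)^-1 n w) / eps)) - Phi
    (- k) <= Pr.
  rewrite -[Phi (- k)](fexp_cst p1) -fexpB; apply: fexp_le => // w.
  case: (leP (psum _ _ _ _) y) => [Wy|yW].
    by rewrite (le_trans _ (Phi_le1 ((y + - k * eps - psum z (Num.sqrt n%:R)^-1 n w) / eps)))
        // gerBl Phi_ge0.
  rewrite subr_le0 Phi_le // ler_pdivrMr // addrAC gerDr subr_le0.
  exact: ltW.
move: cl1 cl2 sm1 sm2 up lo k1 k2; rewrite !ler_norml => /andP[? ?] /andP[? ?] /andP[? ?]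
    /andP[? ?] ? ? ? ?.
by apply/andP; split; lra.
Qed.

End clt.

(** * Consistency of the long-run variance estimator *)

Section sample_variance.
Context {R : realType}.
Implicit Types (d z : nat -> R) (n b j G : nat) (K m : R).

Definition smean n d : R := n%:R^-1 * \sum_(0 <= i < n) d i.

(** [sigma2_hat] with an arbitrary sequence in place of the [Ystat]s, which can then be centered and
    modified at the first indices. *)
Definition lrv_hat b n d : R :=
  n%:R^-1 * \sum_(0 <= i < n) (d i - smean n d) ^+ 2 +
  2 / n%:R * \sum_(1 <= j < b.+1) \sum_(0 <= i < n - j)
    (d i - smean n d) * (d (i + j)%N - smean n d).

Definition lag_sum n d j : R := \sum_(0 <= i < n - j) d i * d (i + j)%N.

Definition lrv_raw b n d : R :=
  n%:R^-1 * lag_sum n d 0 + 2 / n%:R * \sum_(1 <= j < b.+1) lag_sum n d j.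

Lemma lrv_hat_shift b n d m : (0 < n)%N ->
  lrv_hat b n (fun i => d i - m) = lrv_hat b n d.
Proof.
move=> n0; have e : smean n (fun i => d i - m) = smean n d - m.
  rewrite /smean sumrB mulrBr sumr_const_nat subn0; congr (_ - _).
  by rewrite -[X in _ * X]mulr_natl mulKf // pnatr_eq0 -lt0n.
have e2 i : d i - m - (smean n d - m) = d i - smean n d by ring.
rewrite /lrv_hat e; under eq_bigr do rewrite e2.
congr (_ + _ * _); apply: eq_bigr => j _.
by under eq_bigr do rewrite !e2.
Qed.

Lemma sum_norm_le d K k l : (forall i, `|d i| <= K) -> (k <= l)%N ->
  `|\sum_(k <= i < l) d i| <= (l - k)%:R * K.
Proof.
move=> dK kl; rewrite (le_trans (ler_norm_sum _ _ _)) //.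
apply: le_trans (ler_sum _ (fun i _ => dK i)) _.
by rewrite sumr_const_nat mulr_natl.
Qed.

(** Both sums of [n - j] terms met in the expansion equal [n] times the mean up to [j] terms: the
    last ones, [P], or the first ones, [Q]. *)
Lemma centered_lag n d K j : (0 < n)%N -> (forall i, `|d i| <= K) ->
  `|\sum_(0 <= i < n - j) (d i - smean n d) * (d (i + j)%N - smean n d) - lag_sum n d j|
  <= 3 * n%:R * smean n d ^+ 2 + 2 * j%:R * K * `|smean n d|.
Proof.
move=> n0 dK; set dl := smean n d.
have K0 : 0 <= K by exact: le_trans (dK 0%N).
have rhs0 : 0 <= 3 * n%:R * dl ^+ 2 + 2 * j%:R * K * `|dl|.
  by apply: addr_ge0; apply: mulr_ge0; rewrite ?sqr_ge0 // !mulr_ge0.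
have [nj|jn] := ltnP n j.
  rewrite /lag_sum (_ : n - j = 0)%N; last by lia.
  by rewrite !big_geq // subrr normr0.
pose P := \sum_(n - j <= i < n) d i; pose Q := \sum_(0 <= i < j) d i.
have ndl : \sum_(0 <= i < n) d i = n%:R * dl.
  by rewrite /dl /smean mulrA divff ?mul1r // pnatr_eq0 -lt0n.
have eP : \sum_(0 <= i < n - j) d i = n%:R * dl - P.
  by rewrite -ndl (big_cat_nat (leq0n (n - j)) (leq_subr j n)) /= addrK.
have eQ : \sum_(0 <= i < n - j) d (i + j)%N = n%:R * dl - Q.
  rewrite -ndl (big_cat_nat (leq0n j) jn) /= addrC addrK.
  by rewrite -[in RHS](add0n j) big_addn.
have hP : `|P| <= j%:R * K.
  by have := sum_norm_le dK (leq_subr j n); rewrite subKn.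
have hQ : `|Q| <= j%:R * K.
  by have := sum_norm_le dK (leq0n j); rewrite subn0.
have -> : \sum_(0 <= i < n - j) (d i - dl) * (d (i + j)%N - dl) - lag_sum n d j =
   - dl * (\sum_(0 <= i < n - j) d i) - dl * (\sum_(0 <= i < n - j) d (i + j)%N)
   + (n - j)%:R * dl ^+ 2.
  rewrite /lag_sum -sumrB !mulr_sumr -sumrB.
  have -> : (n - j)%:R * dl ^+ 2 = \sum_(0 <= i < n - j) dl ^+ 2.
    by rewrite sumr_const_nat subn0 mulr_natl.
  by rewrite -big_split /=; apply: eq_bigr => i _; ring.
rewrite eP eQ natrB //.
rewrite [X in `|X|](_ : _ = dl * (P + Q) - (n%:R + j%:R) * dl ^+ 2); last by ring.
rewrite (le_trans (ler_normB _ _)) // [leRHS]addrC lerD //; last first.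
  have c0 : 0 <= n%:R + j%:R :> R by rewrite addr_ge0.
  rewrite ger0_norm; last by rewrite mulr_ge0 ?sqr_ge0.
  rewrite ler_wpM2r ?sqr_ge0 //.
  have : j%:R <= n%:R :> R by rewrite ler_nat.
  have : 0 <= n%:R :> R by []. lra.
rewrite normrM mulrC ler_wpM2r // (le_trans (ler_normD _ _)) //.
by move: hP hQ; lra.
Qed.

(** The squared empirical mean will be of order [1 / n] in expectation, so the first term is of
    order [b / n]. In the second one the mean is merely bounded by [K], which [b = o(sqrt n)]
    permits. *)
Lemma lrv_hat_raw b n d K : (0 < n)%N -> (0 < b)%N -> (forall i, `|d i| <= K) ->
  `|lrv_hat b n d - lrv_raw b n d| <=
  9 * b%:R * smean n d ^+ 2 + 4 * b%:R ^+ 2 / n%:R * K ^+ 2.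
Proof.
move=> n0 b0 dK; have K0 : 0 <= K by exact: le_trans (dK 0%N).
set dl := smean n d.
have nR : 0 < n%:R :> R by rewrite ltr0n.
have dlK : `|dl| <= K.
  rewrite /dl /smean normrM ger0_norm ?invr_ge0 // ler_pdivrMl //.
  by have := sum_norm_le dK (leq0n n); rewrite subn0.
pose D j := \sum_(0 <= i < n - j) (d i - dl) * (d (i + j)%N - dl) - lag_sum n d j.
have -> : lrv_hat b n d - lrv_raw b n d = n%:R^-1 * D 0%N + 2 / n%:R * \sum_(1 <= j < b.+1) D j.
  rewrite /lrv_hat /lrv_raw -/dl /D sumrB subn0 !mulrBr.
  have -> : \sum_(0 <= i < n) (d i - dl) ^+ 2 = \sum_(0 <= i < n) (d i - dl) * (d (i + 0)%N - dl).
    by apply: eq_bigr => i _; rewrite addn0 expr2.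
  by ring.
have hD j : (j <= b)%N -> `|D j| <= 3 * n%:R * dl ^+ 2 + 2 * b%:R * K ^+ 2.
  move=> jb; rewrite (le_trans (centered_lag j n0 dK)) // lerD2l.
  rewrite expr2 mulrA ler_pM ?mulr_ge0 // ler_wpM2r // ler_wpM2l // ler_nat //.
have h0 : `|n%:R^-1 * D 0%N| <= 3 * dl ^+ 2.
  have := centered_lag 0 n0 dK; rewrite -/(D 0%N) mulr0 !mul0r addr0 => h.
  rewrite normrM ger0_norm ?invr_ge0 // ler_pdivrMl //.
  by apply: le_trans h _; rewrite -/dl le_eqVlt; apply/orP; left; apply/eqP; ring.
have h1 : `|2 / n%:R * \sum_(1 <= j < b.+1) D j| <= 2 / n%:R * (b%:R * (3 * n%:R * dl ^+ 2 + 2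
    * b%:R * K ^+ 2)).
  rewrite normrM (ger0_norm (_ : 0 <= 2 / n%:R)) ?divr_ge0 // ler_wpM2l ?divr_ge0 //.
  rewrite (le_trans (ler_norm_sum _ _ _)) //.
  apply: (@le_trans _ _ (\sum_(1 <= j < b.+1) (3 * n%:R * dl ^+ 2 + 2 * b%:R * K ^+ 2))).
    by apply: ler_sum_nat => j /andP[_ jb]; exact: hD.
  by rewrite sumr_const_nat subn1 -[leLHS]mulr_natl.
rewrite (le_trans (ler_normD _ _)) // (le_trans (lerD h0 h1)) //.
rewrite (_ : 2 / n%:R * _ = 6 * b%:R * dl ^+ 2 + 4 * b%:R ^+ 2 / n%:R * K ^+ 2); last first.
  by field; rewrite gt_eqF.
rewrite addrA lerD2r -mulrDl ler_wpM2r ?sqr_ge0 //.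
by have : 1 <= b%:R :> R by [rewrite ler1n]; lra.
Qed.

(** In each lag only the products with [i < G] change, each by at most [2 * K ^+ 2]. *)
Lemma lrv_raw_start b n d z K G : (0 < n)%N -> (0 < b)%N ->
  (forall i, `|d i| <= K) -> (forall i, `|z i| <= K) ->
  (forall i, (G <= i)%N -> d i = z i) ->
  `|lrv_raw b n d - lrv_raw b n z| <= 6 * b%:R * G%:R * K ^+ 2 / n%:R.
Proof.
move=> n0 b0 dK zK dz; have K0 : 0 <= K by exact: le_trans (dK 0%N).
have nR : 0 < n%:R :> R by rewrite ltr0n.
have h j : `|lag_sum n d j - lag_sum n z j| <= 2 * G%:R * K ^+ 2.
  rewrite /lag_sum -sumrB (le_trans (ler_norm_sum _ _ _)) //.
  apply: (@le_trans _ _ (\sum_(0 <= i < n - j) (i < G)%N%:R * (2 * K ^+ 2))).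
    apply: ler_sum => i _; have [iG|Gi] := ltnP i G.
      rewrite mul1r (le_trans (ler_normB _ _)) // !normrM mulr2n mulrDl mul1r.
      by rewrite lerD // expr2 ler_pM.
    by rewrite mul0r !dz ?subrr ?normr0 // (leq_trans Gi) // leq_addr.
  rewrite -mulr_suml [leRHS](_ : _ = G%:R * (2 * K ^+ 2)); last by ring.
  rewrite ler_wpM2r ?mulr_ge0 ?exprn_ge0 //.
  have [le|/ltnW le] := leqP (n - j) G.
    apply: (@le_trans _ _ (\sum_(0 <= i < n - j) 1)).
      by apply: ler_sum => i _; case: ltnP.
    by rewrite sumr_const_nat subn0 ler_nat.
  rewrite (big_cat_nat (leq0n G) le) /= [X in _ + X]big1_seq ?addr0; last first.
    by move=> i; rewrite mem_index_iota => /andP[_ /andP[Gi _]]; rewrite ltnNge Gi.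
  apply: (@le_trans _ _ (\sum_(0 <= i < G) 1)).
    by apply: ler_sum => i _; case: ltnP.
  by rewrite sumr_const_nat subn0.
rewrite /lrv_raw.
rewrite (_ : _ - _ = n%:R^-1 * (lag_sum n d 0 - lag_sum n z 0)
   + 2 / n%:R * \sum_(1 <= j < b.+1) (lag_sum n d j - lag_sum n z j)); last first.
  by rewrite sumrB; ring.
have h0 : `|n%:R^-1 * (lag_sum n d 0 - lag_sum n z 0)| <= n%:R^-1 * (2 * G%:R * K ^+ 2).
  by rewrite normrM ger0_norm ?invr_ge0 // ler_wpM2l ?invr_ge0.
have h1 : `|2 / n%:R * \sum_(1 <= j < b.+1) (lag_sum n d j - lag_sum n z j)| <=
   2 / n%:R * (b%:R * (2 * G%:R * K ^+ 2)).
  rewrite normrM (ger0_norm (_ : 0 <= 2 / n%:R)) ?divr_ge0 // ler_wpM2l ?divr_ge0 //.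
  rewrite (le_trans (ler_norm_sum _ _ _)) //.
  apply: (@le_trans _ _ (\sum_(1 <= j < b.+1) (2 * G%:R * K ^+ 2))).
    by apply: ler_sum => j _; exact: h.
  by rewrite sumr_const_nat subn1 -[leLHS]mulr_natl.
rewrite (le_trans (ler_normD _ _)) // (le_trans (lerD h0 h1)) //.
rewrite (_ : _ + _ = (2 + 4 * b%:R) * (G%:R * K ^+ 2) / n%:R); last by field; rewrite gt_eqF.
rewrite ler_wpM2r ?invr_ge0 // -[leRHS]mulrA ler_wpM2r ?mulr_ge0 ?exprn_ge0 //.
by have : 1 <= b%:R :> R by [rewrite ler1n]; lra.
Qed.

End sample_variance.

Section variance.
Context {R : realType} (Om : finType) (p : Om -> R).
Hypothesis p0 : forall w, 0 <= p w.
Hypothesis p1 : \sum_w p w = 1.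
Local Notation E := (fexp p).

Lemma fexp_cov (f g : Om -> R) :
  E (fun w => (f w - E f) * (g w - E g)) = E (fun w => f w * g w) - E f * E g.
Proof.
transitivity (E (fun w => f w * g w - E g * f w - (E f * g w - E f * E g))).
  by apply: eq_fexp => w; ring.
by rewrite !fexpB !fexpZ fexp_cst //; ring.
Qed.

(** Adding the term of index [k] adds its variance and twice its covariances with the earlier terms,
    at most [2 * Cs] in all. *)
Lemma var_sum_le (x : nat -> Om -> R) (c : nat -> R) (m : nat) (Cs : R) :
  (forall i h, (i + h < m)%N -> `|E (fun w => (x i w - E (x i)) * (x (i + h)%N w - E (x (i +
      h)%N)))| <= c h) ->
  (forall N, \sum_(0 <= h < N) c h <= Cs) -> (forall h, 0 <= c h) ->
  E (fun w => (\sum_(0 <= i < m) x i w - E (fun w => \sum_(0 <= i < m) x i w)) ^+ 2)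
  <= 2 * m%:R * Cs.
Proof.
move=> xc cC c0; pose y i w := x i w - E (x i).
have -> : E (fun w => (\sum_(0 <= i < m) x i w - E (fun w => \sum_(0 <= i < m) x i w)) ^+ 2)
   = E (fun w => (\sum_(0 <= i < m) y i w) ^+ 2).
  by apply: eq_fexp => w; rewrite fexp_sum sumrB.
suff : forall k, (k <= m)%N -> E (fun w => (\sum_(0 <= i < k) y i w) ^+ 2) <= 2 * k%:R * Cs.
  by apply.
elim=> [_|k IH km].
  rewrite mulr0 mul0r (_ : (fun _ => _) = fun=> 0) ?fexp_cst //.
  by apply/funext => w; rewrite big_geq // expr0n.
have -> : E (fun w => (\sum_(0 <= i < k.+1) y i w) ^+ 2) =
   E (fun w => (\sum_(0 <= i < k) y i w) ^+ 2) +
   (2 * (\sum_(0 <= i < k) E (fun w => y i w * y (i + (k - i))%N w)) + E (fun w => y k w * y (k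
       + 0)%N w)).
  rewrite -fexp_sum -fexpZ -!fexpD; apply: eq_fexp => w.
  rewrite big_nat_recr //= sqrrD addn0 -expr2 [RHS]addrA; congr (_ + _ + _).
  rewrite -mulr_natl mulr_suml; congr (_ * _); rewrite [LHS]big_nat [RHS]big_nat.
  by apply: eq_bigr => i /andP[_ ik]; rewrite subnKC // ltnW.
rewrite -natr1 (_ : 2 * _ * _ = 2 * k%:R * Cs + 2 * Cs); last by ring.
rewrite lerD ?IH //; first exact: ltnW.
apply: (@le_trans _ _ (2 * \sum_(0 <= i < k) c i.+1 + c 0%N)).
  rewrite lerD //; last first.
    by apply: le_trans (ler_norm _) _; apply: xc; rewrite addn0.
  rewrite ler_wpM2l //.
  have -> : \sum_(0 <= i < k) c i.+1 = \sum_(0 <= i < k) c (k - i)%N.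
    rewrite big_nat_rev /= [LHS]big_nat [RHS]big_nat.
    by apply: eq_bigr => i /andP[_ ik]; rewrite add0n subnSK.
  apply: ler_sum_nat => i /andP[_ ik].
  by apply: le_trans (ler_norm _) _; apply: xc; lia.
have := cC k.+1; rewrite big_nat_recl // => h; have := c0 0%N; lra.
Qed.

(** The pointwise inequality [|x| <= x ^+ 2 / (2 * r) + r / 2] replaces Cauchy-Schwarz; it is used
    with [r] the square root of [n]. *)
Lemma fexp_abs_le (x : Om -> R) (V r : R) : 0 < r -> E (fun w => x w ^+ 2) <= V ->
  E (fun w => `|x w|) <= (V / r + r) / 2.
Proof.
move=> r0 xV; apply: (@le_trans _ _ (E (fun w => (2 * r)^-1 * x w ^+ 2 + r / 2))).
  apply: fexp_le => // w; rewrite -(real_normK (num_real (x w))).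
  have : 0 <= (`|x w| - r) ^+ 2 / (2 * r) by rewrite divr_ge0 ?sqr_ge0 // mulr_ge0 // ltW.
  by rewrite (_ : (`|x w| - r) ^+ 2 / (2 * r) = (2 * r)^-1 * `|x w| ^+ 2 + r / 2 - `|x w|);
    [rewrite subr_ge0 | field; rewrite gt_eqF].
rewrite fexpD (fexp_cst p1) fexpZ [leRHS]mulrDl lerD2r.
rewrite (_ : V / r / 2 = (2 * r)^-1 * V); last by field; rewrite gt_eqF.
by rewrite ler_wpM2l // invr_ge0 mulr_ge0 // ltW.
Qed.

End variance.

Section lag_moments.
Context {R : realType} (n G : nat) (K A : R) (a gam : nat -> R)
  (Om : finType) (p : Om -> R) (z : nat -> Om -> R).
Hypothesis za : weak_array n G K a gam p z.
Hypothesis a_ge0 : forall k, 0 <= a k.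
Hypothesis a_anti : forall k l, (k <= l)%N -> a l <= a k.
Hypothesis aA : forall N, \sum_(1 <= h < N) a h <= A.
Local Notation E := (fexp p).
Let p0 := wa_ge0 za.
Let p1 := wa_sum za.
Let K0 := wa_K_ge0 za.
Let zK := wa_bound za.

Let A0 : 0 <= A. Proof. by rewrite (le_trans _ (aA 1)) // big_geq. Qed.

Let aA1 j : (0 < j)%N -> a j <= A.
Proof.
move=> j0; apply: le_trans (aA j.+1); rewrite big_nat_recr //= lerDr sumr_ge0 //.
Qed.

Let sum_pos N : \sum_(0 <= h < N) (if (0 < h)%N then a h else 0) <= A.
Proof.
case: N => [|N]; first by rewrite big_geq.
rewrite big_nat_recl //= add0r.
by apply: le_trans (aA N.+1); rewrite big_add1.
Qed.

Let cov_le m k f g C D := @cov_mixing_le R Om p z p1 n a m k f g C D (wa_mix za).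

Let zmul_le2 i j w : `|z i w * z j w| <= K ^+ 2.
Proof. by rewrite normrM expr2 ler_pM. Qed.

Let zz_mean i j : (0 < j)%N -> (i + j < n)%N ->
  `|E (fun w => z i w * z (i + j)%N w)| <= 4 * K ^+ 2 * a j.
Proof.
move=> j0 ij; have := @cov_le i j (z i) (z (i + j)%N) K K.
rewrite (wa_mean za ij) mulr0 subr0 expr2 mulrA; apply=> // w w' ww'.
- by apply: ww'.
- by apply: ww'; lia.
Qed.

Definition sum_var_bound : R := K ^+ 2 + 4 * K ^+ 2 * A.

Lemma sum_var : E (fun w => (\sum_(0 <= i < n) z i w) ^+ 2) <= 2 * n%:R * sum_var_bound.
Proof.
pose c (h : nat) := (h == 0%N)%:R * K ^+ 2 + 4 * K ^+ 2 * (if (0 < h)%N then a h else 0).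
have := @var_sum_le R Om p p1 z c n sum_var_bound.
have -> : E (fun w => \sum_(0 <= i < n) z i w) = 0.
  by rewrite fexp_sum big_nat big1 // => i /andP[_ /(wa_mean za)].
under eq_fexp do rewrite subr0.
apply.
- move=> i h ih; rewrite (wa_mean za ih) (wa_mean za (leq_ltn_trans (leq_addr h i) ih)).
  under eq_fexp do rewrite !subr0.
  rewrite /c; case: posnP => [h0|h0] in ih *.
    rewrite h0 mulr0 addr0 mul1r; apply: fexp_norm_le => // w; exact: zmul_le2.
  by rewrite mul0r add0r zz_mean.
- move=> N; rewrite big_split /= -mulr_suml -mulr_sumr lerD //.
    rewrite ler_piMl ?exprn_ge0 //; case: N => [|N]; first by rewrite big_geq.
    by rewrite big_nat_recl //= big1 ?addr0.
  by rewrite ler_wpM2l ?mulr_ge0 ?exprn_ge0.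
- move=> h; rewrite addr_ge0 // mulr_ge0 ?exprn_ge0 //; first by rewrite mulr_ge0 ?exprn_ge0.
  by case: ifP.
Qed.

(** One term for each range of the distance [h] between two products of lag [j]: [h = 0],
    [0 < h <= j], and [h > j], where the gap is [h - j]. In the middle range 4 bounds the mean of
    the product of all four factors, and [16 * A] the product of the two means, each of order [a j],
    with [a j <= a h]. *)
Definition lag_var_bound : R :=
  2 * K ^+ 4 + (4 + 16 * A) * K ^+ 4 * A + 4 * K ^+ 4 * A.

(* Each lag is treated on its own: bounding at once the variance of the sum of the
   [b] lags would need [b ^+ 3 = o(n)] instead of [b ^+ 2 = o(n)]. The products
   [z i * z (i + j)] and [z (i + h) * z (i + h + j)] overlap when [h <= j]; then
   [z i] is at distance [h] from the three other factors. *)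
Lemma lag_var j : (j < n)%N ->
  E (fun w => (lag_sum n (z^~ w) j - E (fun w => lag_sum n (z^~ w) j)) ^+ 2)
  <= 2 * n%:R * lag_var_bound.
Proof.
move=> jn; pose x i w := z i w * z (i + j)%N w.
have K40 : 0 <= K ^+ 4 by rewrite exprn_ge0.
have LV0 : 0 <= lag_var_bound.
  by repeat (apply: addr_ge0 || apply: mulr_ge0).
pose c (h : nat) := (h == 0%N)%:R * (2 * K ^+ 4) +
  (4 + 16 * A) * K ^+ 4 * (if (0 < h)%N then a h else 0) +
  4 * K ^+ 4 * (if (j < h)%N then a (h - j)%N else 0).
have c1 h : 0 <= (h == 0%N)%:R * (2 * K ^+ 4) by rewrite !mulr_ge0.
have c2 h : 0 <= (4 + 16 * A) * K ^+ 4 * (if (0 < h)%N then a h else 0).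
  by rewrite mulr_ge0 ?mulr_ge0 ?addr_ge0 ?mulr_ge0 //; case: ifP.
have c3 h : 0 <= 4 * K ^+ 4 * (if (j < h)%N then a (h - j)%N else 0).
  by rewrite mulr_ge0 ?mulr_ge0 //; case: ifP.
have h := @var_sum_le R Om p p1 x c (n - j) lag_var_bound.
apply: (@le_trans _ _ (2 * (n - j)%:R * lag_var_bound)); last first.
  by rewrite ler_wpM2r // ler_wpM2l // ler_nat leq_subr.
apply: h; last by move=> h; rewrite !addr_ge0.
- move=> i h ih; rewrite fexp_cov // /x.
  have [h0|h0] := posnP h.
    apply: (@le_trans _ _ (2 * K ^+ 4)); last first.
      by rewrite /c h0 eqxx mul1r -addrA lerDl addr_ge0 ?(c2 0%N) ?(c3 0%N).
    rewrite (le_trans (ler_normB _ _)) // mulr2n mulrDl mul1r lerD //.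
      apply: fexp_norm_le => // w; rewrite normrM (_ : K ^+ 4 = K ^+ 2 * K ^+ 2); last by ring.
      by rewrite ler_pM // h0 addn0.
    rewrite normrM (_ : K ^+ 4 = K ^+ 2 * K ^+ 2); last by ring.
    by rewrite ler_pM // (fexp_norm_le p0 p1).
  have [hj|jh] := leqP h j.
    apply: (@le_trans _ _ ((4 + 16 * A) * K ^+ 4 * a h)); last first.
      by rewrite /c h0 (gtn_eqF h0) mul0r add0r lerDl.
    rewrite (le_trans (ler_normB _ _)) // 2!mulrDl lerD //.
      pose g w := z (i + j)%N w * (z (i + h)%N w * z (i + h + j)%N w).
      have gK w : `|g w| <= K * K ^+ 2 by rewrite normrM ler_pM.
      have := @cov_le i h (z i) g K (K * K ^+ 2).
      rewrite (wa_mean za _) ?mul0r ?subr0; last by lia.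
      have -> : E (fun w => z i w * g w) =
        E (fun w => z i w * z (i + j)%N w * (z (i + h)%N w * z (i + h + j)%N w)).
        by apply: eq_fexp => w; rewrite /g mulrA.
      rewrite (_ : 4 * K * (K * K ^+ 2) = 4 * K ^+ 4); last by ring.
      apply=> // w w' ww'; first by apply: ww'.
      by rewrite /g !ww' //; lia.
    have j0 : (0 < j)%N by exact: leq_trans hj.
    have e1 : `|E (fun w => z i w * z (i + j)%N w)| <= 4 * K ^+ 2 * a j.
      by apply: zz_mean => //; lia.
    have e2 : `|E (fun w => z (i + h)%N w * z (i + h + j)%N w)| <= 4 * K ^+ 2 * a j.
      by apply: zz_mean => //; lia.
    rewrite normrM (le_trans (ler_pM _ _ e1 e2)) //.
    rewrite (_ : 16 * A * K ^+ 4 * a h = 4 * K ^+ 2 * A * (4 * K ^+ 2 * a h)); last by ring.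
    rewrite ler_pM ?mulr_ge0 ?exprn_ge0 // ler_wpM2l ?mulr_ge0 ?exprn_ge0 //.
      exact: aA1.
    exact: a_anti.
  apply: (@le_trans _ _ (4 * K ^+ 4 * a (h - j)%N)); last first.
    by rewrite /c jh lerDr addr_ge0.
  rewrite (_ : 4 * K ^+ 4 = 4 * K ^+ 2 * K ^+ 2); last by ring.
  apply: (@cov_le (i + j)%N) => // w w' ww'.
    by rewrite !ww' //; lia.
  by rewrite !ww' //; lia.
- move=> N; rewrite !big_split /= -mulr_suml -!mulr_sumr !lerD //.
  + rewrite ler_piMl ?mulr_ge0 //; case: N => [|N]; first by rewrite big_geq.
    by rewrite big_nat_recl //= big1 ?addr0.
  + by rewrite ler_wpM2l ?mulr_ge0 ?addr_ge0 ?mulr_ge0.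
  rewrite ler_wpM2l ?mulr_ge0 //.
  have [Nj|jN] := leqP N j.
    rewrite big_nat big1 // => h /andP[_ hN]; rewrite ltnNge ltnW //.
    exact: leq_trans Nj.
  rewrite (big_cat_nat (leq0n j) (ltnW jN)) /= big_nat big1 ?add0r; last first.
    by move=> h /andP[_ hj]; rewrite ltnNge ltnW.
  rewrite -{1}[j]add0n big_addn; apply: le_trans (sum_pos (N - j)).
  rewrite le_eqVlt; apply/orP; left; apply/eqP; apply: eq_bigr => h _.
  by rewrite -{1}[j]add0n ltn_add2r addnK.
Qed.

End lag_moments.

Lemma start_sum (R : realType) (n G : nat) (K : R) (d z : nat -> R) : (G <= n)%N ->
  (forall i, `|d i| <= K) -> (forall i, `|z i| <= K) ->
  (forall i, (G <= i)%N -> d i = z i) ->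
  `|\sum_(0 <= i < n) d i - \sum_(0 <= i < n) z i| <= 2 * G%:R * K.
Proof.
move=> Gn dK zK dz; rewrite -sumrB (big_cat_nat (leq0n G) Gn) /= [X in _ + X]big_nat.
rewrite [X in _ + X]big1 ?addr0 => [|i /andP[Gi _]]; last by rewrite dz ?subrr.
have h i : `|d i - z i| <= 2 * K.
  by rewrite (le_trans (ler_normB _ _)) // mulr2n mulrDl mul1r lerD.
apply: le_trans (sum_norm_le h (leq0n G)) _.
by rewrite subn0 mulrCA mulrA.
Qed.

Section lrv_consistency.
Context {R : realType} (n G : nat) (K A : R) (a gam : nat -> R)
  (Om : finType) (p : Om -> R) (z : nat -> Om -> R).
Hypothesis za : weak_array n G K a gam p z.
Hypothesis a_ge0 : forall k, 0 <= a k.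
Hypothesis a_anti : forall k l, (k <= l)%N -> a l <= a k.
Hypothesis aA : forall N, \sum_(1 <= h < N) a h <= A.
Variables (b : nat) (d : nat -> Om -> R) (s2 : R).
Hypothesis b0 : (0 < b)%N.
Hypothesis Gbn : (G + b < n)%N.
Hypothesis dK : forall i w, `|d i w| <= K.
Hypothesis dz : forall i w, (G <= i)%N -> d i w = z i w.
Local Notation E := (fexp p).
Let p0 := wa_ge0 za.
Let p1 := wa_sum za.
Let K0 := wa_K_ge0 za.
Let zK := wa_bound za.
Let n0 : (0 < n)%N. Proof. by lia. Qed.
Let GLn : (G <= n)%N. Proof. by lia. Qed.
Let nR : 0 < n%:R :> R. Proof. by rewrite ltr0n. Qed.
Let nR0 : n%:R != 0 :> R. Proof. by rewrite gt_eqF. Qed.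
Let bR : 1 <= b%:R :> R. Proof. by rewrite ler1n. Qed.
Let K20 : 0 <= K ^+ 2. Proof. by rewrite exprn_ge0. Qed.
Let T j w := lag_sum n (z^~ w) j.

Let mean_sq : E (fun w => smean n (d^~ w) ^+ 2) <= (4 * sum_var_bound K A + 8 * G%:R ^+ 2 * K
    ^+ 2) / n%:R.
Proof.
have := sum_var za a_ge0 aA; set V := sum_var_bound K A => hV.
apply: (@le_trans _ _ (E (fun w => 2 / n%:R ^+ 2 * (\sum_(0 <= i < n) z i w) ^+ 2 + 2 / n%:R ^+
    2 * (2 * G%:R * K) ^+ 2))).
  apply: fexp_le => // w; have := start_sum GLn (dK^~ w) (zK^~ w) (@dz^~ w); rewrite /smean
      exprMn exprVn.
  set x := \sum_(0 <= i < n) d i w; set y := \sum_(0 <= i < n) z i w => xy.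
  rewrite [leRHS](_ : _ = n%:R ^- 2 * (2 * y ^+ 2 + 2 * (2 * G%:R * K) ^+ 2)); last by ring.
  rewrite ler_wpM2l ?invr_ge0 ?exprn_ge0 //.
  have h1 : (x - y) ^+ 2 <= (2 * G%:R * K) ^+ 2.
    by rewrite -(real_normK (num_real (x - y))) lerXn2r ?nnegrE // !mulr_ge0.
  have h2 := sqr_ge0 (x - 2 * y).
  rewrite (_ : x ^+ 2 = 2 * y ^+ 2 + 2 * (x - y) ^+ 2 - (x - 2 * y) ^+ 2); last by ring.
  by move: h1 h2; set u := _ ^+ 2; set v := _ ^+ 2; set t := _ ^+ 2; lra.
rewrite fexpD (fexp_cst p1) fexpZ.
apply: (@le_trans _ _ (2 / n%:R ^+ 2 * (2 * n%:R * V) + 2 / n%:R ^+ 2 * (2 * G%:R * K) ^+ 2)).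
  by rewrite lerD2r ler_wpM2l // divr_ge0 // exprn_ge0.
rewrite [leRHS]mulrDl lerD //.
  by rewrite le_eqVlt; apply/orP; left; apply/eqP; field.
rewrite (_ : 2 / n%:R ^+ 2 * (2 * G%:R * K) ^+ 2 = 8 * G%:R ^+ 2 * K ^+ 2 / n%:R * n%:R^-1);
    last by field.
rewrite ler_piMr ?divr_ge0 ?mulr_ge0 ?exprn_ge0 // invf_le1 // ler1n //.
Qed.

Let mean_lag j : (j <= b)%N -> `|E (T j) - n%:R * gam j| <= (j + 2 * G)%:R * K ^+ 2.
Proof.
move=> jb; rewrite /T /lag_sum fexp_sum.
have Gj : (G <= n - j)%N by lia.
rewrite (big_cat_nat (leq0n G) Gj) /=.
have -> : \sum_(G <= i < n - j) E (fun w => z i w * z (i + j)%N w) = (n - j - G)%:R * gam j.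
  rewrite mulr_natl -sumr_const_nat [LHS]big_nat [RHS]big_nat.
  by apply: eq_bigr => i /andP[Gi ij]; apply: (wa_cov za Gi); lia.
have hg : `|gam j| <= K ^+ 2 by apply: (wa_gam_le za); lia.
have hs : `|\sum_(0 <= i < G) E (fun w => z i w * z (i + j)%N w)| <= G%:R * K ^+ 2.
  rewrite -[G in leRHS]subn0; apply: sum_norm_le => // i.
  by apply: fexp_norm_le => // w; rewrite normrM expr2 ler_pM.
rewrite [X in `|X|](_ : _ = \sum_(0 <= i < G) E (fun w => z i w * z (i + j)%N w) - (j + G)%:R *
    gam j); last first.
  by rewrite -subnDA natrB; [ring | lia].
rewrite (_ : (j + 2 * G)%N = (G + (j + G))%N); last by lia.
rewrite [X in _ <= X * _]natrD [leRHS]mulrDl (le_trans (ler_normB _ _)) // lerD // normrM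
    ger0_norm //.
by rewrite ler_wpM2l.
Qed.

Definition lrv_rate : R :=
  9 * (4 * sum_var_bound K A + 8 * G%:R ^+ 2 * K ^+ 2) + 12 * G%:R * K ^+ 2 +
  3 * (lag_var_bound K A + 1) + 7 * K ^+ 2.

Let r := Num.sqrt (n%:R : R).
Let r0 : 0 < r. Proof. by rewrite sqrtr_gt0. Qed.
Let r2 : r ^+ 2 = n%:R. Proof. by rewrite sqr_sqrtr. Qed.

Let lag_dev j : (j <= b)%N -> E (fun w => `|T j w - E (T j)|) <= r * (lag_var_bound K A + 1).
Proof.
move=> jb; have jn : (j < n)%N by lia.
apply: le_trans (fexp_abs_le p0 p1 r0 (lag_var za a_ge0 a_anti aA jn)) _.
rewrite -r2 [leLHS](_ : _ = r * (lag_var_bound K A + 2^-1)); last by field; rewrite gt_eqF.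
by rewrite ler_wpM2l ?(ltW r0) // lerD2l; lra.
Qed.

(** The fluctuations of the lags give the term in [b / r]. The crude bound in the centering and the
    [j] products missing from lag [j] are responsible for its square. The last term is the bias of
    stopping at lag [b]. *)
Lemma lrv_hat_L1 : E (fun w => `|lrv_hat b n (d^~ w) - s2|) <=
  lrv_rate * (b%:R / r + (b%:R / r) ^+ 2) +
  `|gam 0 + 2 * (\sum_(0 <= l < b) gam l.+1) - s2|.
Proof.
pose V := 4 * sum_var_bound K A + 8 * G%:R ^+ 2 * K ^+ 2.
pose LV := lag_var_bound K A + 1.
have A0 : 0 <= A by rewrite (le_trans _ (aA 1)) // big_geq.
have V0 : 0 <= V.
  by rewrite /V /sum_var_bound; repeat (apply: addr_ge0 || apply: mulr_ge0); rewrite ?exprn_ge0.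
have LV0 : 0 <= LV.
  rewrite /LV /lag_var_bound.
  by repeat (apply: addr_ge0 || apply: mulr_ge0); rewrite ?exprn_ge0.
pose g := gam 0 + 2 * (\sum_(0 <= l < b) gam l.+1) - s2.
pose m := n%:R^-1 * E (T 0) + 2 / n%:R * \sum_(1 <= j < b.+1) E (T j) - s2.
have hm : `|m - g| <= n%:R^-1 * ((1 + 2 * b%:R) * ((b + 2 * G)%:R * K ^+ 2)).
  have hj j : (j <= b)%N -> `|E (T j) - n%:R * gam j| <= (b + 2 * G)%:R * K ^+ 2.
    move=> jb; apply: le_trans (mean_lag jb) _.
    by rewrite ler_wpM2r // ler_nat leq_add2r.
  rewrite (_ : m - g = n%:R^-1 * ((E (T 0) - n%:R * gam 0) + 2 * \sum_(1 <= j < b.+1) (E (T j)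
      - n%:R * gam j))); last first.
    have gE : \sum_(0 <= l < b) gam l.+1 = \sum_(1 <= j < b.+1) gam j by rewrite big_add1.
    by rewrite /m /g sumrB -mulr_sumr gE; field.
  rewrite normrM ger0_norm ?invr_ge0 // ler_wpM2l ?invr_ge0 //.
  rewrite (le_trans (ler_normD _ _)) // [leRHS]mulrDl mul1r lerD ?hj // normrM ger0_norm // -mulrA.
  rewrite ler_wpM2l // (le_trans (ler_norm_sum _ _ _)) //.
  apply: (@le_trans _ _ (\sum_(1 <= j < b.+1) (b + 2 * G)%:R * K ^+ 2)).
    by apply: ler_sum_nat => j /andP[_ jb]; exact: hj.
  by rewrite sumr_const_nat subn1 -[leLHS]mulr_natl.
apply: (@le_trans _ _ (E (fun w =>
   9 * b%:R * smean n (d^~ w) ^+ 2 + (n%:R^-1 * `|T 0 w - E (T 0)| +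
   2 / n%:R * \sum_(1 <= j < b.+1) `|T j w - E (T j)|) +
   (4 * b%:R ^+ 2 / n%:R * K ^+ 2 + 6 * b%:R * G%:R * K ^+ 2 / n%:R
    + (`|m - g| + `|g|))))).
  apply: fexp_le => // w.
  have h1 := lrv_hat_raw n0 b0 (dK^~ w).
  have h2 := lrv_raw_start n0 b0 (dK^~ w) (zK^~ w) (fun i => @dz i w).
  have h3 : `|lrv_raw b n (z^~ w) - s2 - m| <= n%:R^-1 * `|T 0 w - E (T 0)| +
   2 / n%:R * \sum_(1 <= j < b.+1) `|T j w - E (T j)|.
    rewrite (_ : _ - m = n%:R^-1 * (T 0 w - E (T 0)) + 2 / n%:R * \sum_(1 <= j < b.+1) (T j w -
        E (T j))); last first.
      by rewrite /m /lrv_raw -/(T 0 w) sumrB; ring.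
    rewrite (le_trans (ler_normD _ _)) // !normrM !(ger0_norm (_ : 0 <= n%:R^-1)) ?invr_ge0 //.
    by rewrite (ger0_norm (_ : 0 <= 2)) // lerD2l ler_wpM2l ?divr_ge0 // ler_norm_sum.
  rewrite [X in `|X|](_ : _ = (lrv_hat b n (d^~ w) - lrv_raw b n (d^~ w)) +
    (lrv_raw b n (d^~ w) - lrv_raw b n (z^~ w)) + (lrv_raw b n (z^~ w) - s2 - m)
    + ((m - g) + g)); last by ring.
  have h4 := ler_normD (m - g) g.
  have := ler_normD ((lrv_hat b n (d^~ w) - lrv_raw b n (d^~ w)) +
    (lrv_raw b n (d^~ w) - lrv_raw b n (z^~ w)) + (lrv_raw b n (z^~ w) - s2 - m)) ((m - g) + g).
  have := ler_normD ((lrv_hat b n (d^~ w) - lrv_raw b n (d^~ w)) +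
    (lrv_raw b n (d^~ w) - lrv_raw b n (z^~ w))) (lrv_raw b n (z^~ w) - s2 - m).
  have := ler_normD (lrv_hat b n (d^~ w) - lrv_raw b n (d^~ w))
    (lrv_raw b n (d^~ w) - lrv_raw b n (z^~ w)).
  by move: h1 h2 h3 h4; lra.
rewrite fexpD (fexp_cst p1) fexpD fexpZ fexpD fexpZ fexpZ (fexp_sum p (index_iota 1 b.+1))
    [leLHS]addrA [leLHS]addrA -/g lerD2r -[leLHS]addrA.
have e1 : 9 * b%:R * E (fun w => smean n (d^~ w) ^+ 2) <= 9 * b%:R * (V / n%:R).
  by rewrite ler_wpM2l ?mulr_ge0.
have e2 : n%:R^-1 * E (fun w => `|T 0 w - E (T 0)|) +
   2 / n%:R * \sum_(1 <= j < b.+1) E (fun w => `|T j w - E (T j)|) <=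
   n%:R^-1 * (r * LV) + 2 / n%:R * (b%:R * (r * LV)).
  rewrite lerD // ler_wpM2l ?divr_ge0 ?invr_ge0 ?lag_dev //.
  apply: (@le_trans _ _ (\sum_(1 <= j < b.+1) r * LV)).
    by apply: ler_sum_nat => j /andP[_ jb]; exact: lag_dev.
  by rewrite sumr_const_nat subn1 -[leLHS]mulr_natl.
apply: le_trans (lerD (lerD e1 e2) (lerD (lexx _) hm)) _.
have r1 : r^-1 <= 1.
  by rewrite invf_le1 // -[1]sqrtr1 ler_wsqrtr // ler1n.
have rV : 0 < r^-1 by rewrite invr_gt0.
have br : r^-1 <= b%:R / r by rewrite ler_peMl // ltW.
have b00 : 0 <= b%:R / r by rewrite (le_trans _ br) // ltW.
have nr : n%:R^-1 = r^-1 * r^-1 by rewrite -r2 expr2 invfM.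
(* All terms are now polynomial in [r^-1] and [be]. As [r^-1 <= be] and [r^-1 <= 1], each monomial
   is at most [be] or [be ^+ 2]. *)
pose be := b%:R / r; rewrite -/be in br b00 *.
have bre : b%:R * r^-1 = be by [].
have rr : r^-1 * r = 1 by rewrite mulVf // gt_eqF.
have s1 : r^-1 * be <= be by rewrite ler_piMl.
have s2' : r^-1 * r^-1 <= r^-1 by rewrite ler_piMl // ltW.
have GK : 0 <= G%:R * K ^+ 2 by rewrite mulr_ge0.
rewrite [leLHS](_ : _ = 9 * V * (r^-1 * be) + (r^-1 + 2 * be) * LV +
  (4 * K ^+ 2 * be ^+ 2 + 6 * (G%:R * K ^+ 2) * (r^-1 * be)) +
  ((r^-1 * be + 2 * be ^+ 2) * K ^+ 2 + (2 * (r^-1 * r^-1) + 4 * (r^-1 * be)) * (G%:R * K ^+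
      2))); last first.
  rewrite nr natrD natrM /be; field; rewrite gt_eqF //.
rewrite /lrv_rate -/V -/LV.
have t1 : 9 * V * (r^-1 * be) <= 9 * V * be by rewrite ler_wpM2l // mulr_ge0.
have t2 : (r^-1 + 2 * be) * LV <= 3 * be * LV by rewrite ler_wpM2r //; move: br; lra.
have t3 : 6 * (G%:R * K ^+ 2) * (r^-1 * be) <= 6 * (G%:R * K ^+ 2) * be by rewrite ler_wpM2l //
    mulr_ge0.
have t4 : (r^-1 * be + 2 * be ^+ 2) * K ^+ 2 <= (be + 2 * be ^+ 2) * K ^+ 2.
  by rewrite ler_wpM2r // lerD2r.
have t5 : (2 * (r^-1 * r^-1) + 4 * (r^-1 * be)) * (G%:R * K ^+ 2) <= 6 * be * (G%:R * K ^+ 2).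
  by rewrite ler_wpM2r //; move: br s1 s2'; lra.
have u1 : 0 <= V * be ^+ 2 by rewrite mulr_ge0 // exprn_ge0.
have u2 : 0 <= LV * be ^+ 2 by rewrite mulr_ge0 // exprn_ge0.
have u3 : 0 <= G%:R * K ^+ 2 * be ^+ 2 by rewrite mulr_ge0 // exprn_ge0.
have u4 : 0 <= K ^+ 2 * be ^+ 2 by rewrite mulr_ge0 // exprn_ge0.
have u5 : 0 <= K ^+ 2 * be by rewrite mulr_ge0.
by move: t1 t2 t3 t4 t5 u1 u2 u3 u4 u5; lra.
Qed.

End lrv_consistency.

(** * Studentized central limit theorem *)

Lemma sqrt_dist_le (R : realType) (x y : R) : 0 < x -> 0 <= y ->
  `|Num.sqrt y - Num.sqrt x| <= `|y - x| / Num.sqrt x.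
Proof.
move=> x0 y0; have s0 : 0 < Num.sqrt x by rewrite sqrtr_gt0.
have -> : y - x = (Num.sqrt y - Num.sqrt x) * (Num.sqrt y + Num.sqrt x).
  by rewrite -subr_sqr !sqr_sqrtr // ltW.
rewrite ler_pdivlMr // normrM.
by rewrite ler_wpM2l // ger0_norm ?addr_ge0 ?sqrtr_ge0 // lerDr sqrtr_ge0.
Qed.

Section studentized_clt.
Context {R : realType} (G : nat) (K A : R) (a gam : nat -> R) (s2 : R) (b : nat -> nat).
Hypothesis K0 : 0 <= K.
Hypothesis s20 : 0 < s2.
Hypothesis ll : lag_limits a gam s2.
Hypothesis a_ge0 : forall k, 0 <= a k.
Hypothesis a_anti : forall k l, (k <= l)%N -> a l <= a k.
Hypothesis aA : forall N, \sum_(1 <= h < N) a h <= A.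
Hypothesis b_gt0 : forall n, (0 < b n)%N.
Hypothesis b_small : forall e : R, 0 < e -> exists N, forall n, (N <= n)%N ->
  (b n)%:R <= e * Num.sqrt n%:R.
Hypothesis b_large : forall B, exists N, forall n, (N <= n)%N -> (B <= b n)%N.

Lemma lrv_hat_cvg (nu eta : R) : 0 < nu -> 0 < eta ->
  exists N, forall n, (N <= n)%N ->
  forall (Om : finType) (p : Om -> R) (z d : nat -> Om -> R),
  weak_array n G K a gam p z ->
  (forall i w, `|d i w| <= K) -> (forall i w, (G <= i)%N -> d i w = z i w) ->
  fexp p (fun w => (nu <= `|lrv_hat (b n) n (d^~ w) - s2|)%R%:R) <= eta.
Proof.
move=> nu0 eta0; pose ep := nu * eta / 2.
have ep0 : 0 < ep by rewrite divr_gt0 ?mulr_gt0.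
have [L hL] := ll_var ll ep0.
pose c := 2 * `|lrv_rate G K A|; have c0 : 0 <= c by rewrite mulr_ge0.
(* The bound [2^-1] serves twice: it gives [2 * b n <= n], whence [G + b n < n], and [x ^+ 2 <= x]
   for the ratio [x] below. *)
pose e := Num.min (2^-1) (ep / (c + 1)).
have e0 : 0 < e by rewrite lt_min invr_gt0 ltr0n divr_gt0 // ltr_wpDl.
have e1 : e <= 2^-1 by rewrite ge_min lexx.
have e2 : e <= ep / (c + 1) by rewrite ge_min lexx orbT.
have [N1 h1] := b_small e0; have [N2 h2] := b_large L.
exists (maxn (maxn N1 N2) (2 * G + 5)) => n; rewrite !geq_max.
move=> /andP[/andP[/h1{}h1 /h2{}h2] nG] Om p z d za dK dz.
have r0 : 0 < Num.sqrt (n%:R : R) by rewrite sqrtr_gt0 ltr0n; lia.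
have be : (b n)%:R / Num.sqrt n%:R <= e by rewrite ler_pdivrMr.
have be0 : 0 <= (b n)%:R / Num.sqrt (n%:R : R) by rewrite divr_ge0 // ltW.
have bn : (2 * b n <= n)%N.
  rewrite -(ler_nat R) natrM; apply: (@le_trans _ _ (Num.sqrt n%:R)).
    by move: h1; have := ler_wpM2r (ltW r0) e1; lra.
  rewrite -[leRHS]sqr_sqrtr // expr2 ler_peMl ?(ltW r0) //.
  by rewrite -[leLHS]sqrtr1 ler_wsqrtr // ler1n; lia.
have Gbn : (G + b n < n)%N by lia.
apply: le_trans (fexp_markov (wa_ge0 za) nu0 _) _ => //.
rewrite ler_pdivrMr //.
apply: le_trans (lrv_hat_L1 za a_ge0 a_anti aA s2 (b_gt0 n) Gbn dK dz) _.
have := hL _ h2; set x := _ / _ in be be0 *; set g := `|_| => hg.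
have : lrv_rate G K A * (x + x ^+ 2) <= ep.
  apply: le_trans (mul_small c0 ep0).
  apply: (@le_trans _ _ (c * x)); last by rewrite ler_wpM2l // (le_trans be).
  rewrite /c mulrAC mulrC.
  apply: (@le_trans _ _ ((x + x ^+ 2) * `|lrv_rate G K A|)).
    by rewrite ler_wpM2l ?ler_norm // addr_ge0 // exprn_ge0.
  rewrite ler_wpM2r // mulr2n mulrDl !mul1r lerD2l expr2 ler_piMl //.
  by move: be e1; lra.
by move: hg; rewrite /ep; lra.
Qed.

(** Slutsky's argument with explicit margins. One half of [th] absorbs [rem] and the first [G]
    terms, both divided by the root of [n]; the other half absorbs the replacement of the estimated
    standard deviation by [s], off an event of probability at most [e]. *)
Lemma studentized_clt (t c eta : R) : 0 <= c -> 0 < eta ->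
  exists N, forall n, (N <= n)%N ->
  forall (Om : finType) (p : Om -> R) (z d : nat -> Om -> R) (rem : Om -> R),
  weak_array n G K a gam p z ->
  (forall i w, `|d i w| <= K) -> (forall i w, (G <= i)%N -> d i w = z i w) ->
  (forall w, `|rem w| <= c) ->
  `|fexp p (fun w => ((Num.sqrt n%:R)^-1 * (\sum_(0 <= i < n) d i w + rem w)
       / Num.sqrt (lrv_hat (b n) n (d^~ w)) <= t)%R%:R) - Phi t| <= eta.
Proof.
move=> c0 eta0; pose e := eta / 4; have e0 : 0 < e by rewrite divr_gt0.
pose s := Num.sqrt s2; have s0 : 0 < s by rewrite sqrtr_gt0.
have s16 : 0 <= 16 / s by rewrite divr_ge0 // ltW.
pose th := e / (16 / s + 1).
have th0 : 0 < th by rewrite divr_gt0 // ltr_wpDl.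
pose th' := th / 2 / (`|t| + 1).
have th'0 : 0 < th' by rewrite !divr_gt0 // ltr_wpDl.
(* With [s2 / 2] the estimator is positive on the good event, so that the inequality can be
   multiplied by its root. *)
pose nu := Num.min (s * th') (s2 / 2).
have nu0 : 0 < nu by rewrite lt_min mulr_gt0 // divr_gt0.
pose c' := c + 2 * G%:R * K.
have c'0 : 0 <= c' by rewrite addr_ge0 // !mulr_ge0.
have [N1 h1] := lrv_hat_cvg nu0 e0.
have [N2 h2] := cdf_clt G K0 ll (t * s + th) s20 e0.
have [N3 h3] := cdf_clt G K0 ll (t * s - th) s20 e0.
have small0 : 0 < th / 2 / (c' + 1) by rewrite !divr_gt0 // ltr_wpDl.
have [N4 h4] := invsqrt_small small0.
exists (maxn (maxn N1 N2) (maxn (maxn N3 N4) G)) => n; rewrite !geq_max.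
move=> /andP[/andP[n1 n2] /andP[/andP[n3 /h4[n0 dlc]] Gn]] Om p z d rem za dK dz remc.
have {}h1 := h1 n n1 Om p z d za dK dz.
have {}h2 := h2 n n2 Om p z za; have {}h3 := h3 n n3 Om p z za.
have p0 := wa_ge0 za.
set dl := (Num.sqrt (n%:R : R))^-1 in dlc h2 h3 *.
have dl0 : 0 <= dl by rewrite invr_ge0 sqrtr_ge0.
rewrite -/s in h2 h3.
pose D w := \sum_(0 <= i < n) d i w + rem w.
have hD w : `|dl * D w - psum z dl n w| <= th / 2.
  rewrite /psum -mulrBr normrM ger0_norm //.
  apply: le_trans (_ : _ <= c' * (th / 2 / (c' + 1))) _; last by rewrite mul_small // divr_gt0.
  rewrite mulrC ler_pM //.
  have := start_sum Gn (dK^~ w) (fun i => wa_bound za i w) (fun i => dz i w).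
  move: (remc w); rewrite /D /c' !ler_norml; lra.
pose S w := Num.sqrt (lrv_hat (b n) n (d^~ w)).
have good w : `|lrv_hat (b n) n (d^~ w) - s2| < nu -> 0 < S w /\ `|t * S w - t * s| <= th / 2.
  rewrite lt_min => /andP[g1 g2].
  have l0 : 0 < lrv_hat (b n) n (d^~ w) by move: g2; rewrite ltr_norml; move: s20; lra.
  split; first by rewrite sqrtr_gt0.
  rewrite -mulrBr normrM.
  apply: le_trans (_ : _ <= `|t| * th') _; last by rewrite mul_small // divr_gt0.
  rewrite ler_wpM2l //; apply: le_trans (sqrt_dist_le s20 (ltW l0)) _.
  by rewrite -/s ler_pdivrMr // mulrC ltW.
pose bad w : R := (nu <= `|lrv_hat (b n) n (d^~ w) - s2|)%R%:R.
set Pr := fexp p _.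
have up : Pr <= fexp p (fun w => (psum z dl n w <= t * s + th)%R%:R) + fexp p bad.
  rewrite -fexpD; apply: fexp_le => // w; rewrite /bad.
  case: (leP nu) => [_|/good[S0 hS]]; first by rewrite ler_wpDl // lern1 leq_b1.
  rewrite addr0; case: (leP _ t) => [hS1|_]; last by rewrite ler0n.
  case: (leP (psum _ _ _ _)) => // hW; exfalso; move: hS1; rewrite -/(S w) -/(D w) leNgt =>
      /negP; apply.
  by rewrite ltr_pdivlMr //; have := hD w; move: hS; rewrite !ler_norml; lra.
have lo : fexp p (fun w => (psum z dl n w <= t * s - th)%R%:R) <= Pr + fexp p bad.
  rewrite -fexpD; apply: fexp_le => // w; rewrite /bad.
  case: (leP nu) => [_|/good[S0 hS]].
    by rewrite ler_wpDl ?ler0n // lern1 leq_b1.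
  rewrite addr0; case: (leP (psum _ _ _ _)) => [hW|_]; last by rewrite ler0n.
  case: (leP _ t) => // hS1; exfalso; move: hS1; rewrite -/(S w) -/(D w) ltNge => /negP; apply.
  by rewrite ler_pdivrMr //; have := hD w; move: hS; rewrite !ler_norml; lra.
have Pclose (u : R) : `|u| <= th -> `|Phi ((t * s + u) / s) - Phi t| <= e.
  move=> uth; apply: le_trans (Phi_lipschitz _ _) _.
  rewrite (_ : (t * s + u) / s - t = u / s); last by field; rewrite gt_eqF.
  rewrite normrM normfV (gtr0_norm s0) mulrCA mulrC.
  apply: le_trans (mul_small s16 e0); rewrite ler_wpM2l //.
have := Pclose th; have := Pclose (- th).
rewrite normrN gtr0_norm // => /(_ (lexx _)) q1 /(_ (lexx _)) q2.
have e4 : e * 4 = eta by rewrite /e; field.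
move: h1 h2 h3 q1 q2 up lo; rewrite -/(fexp p bad) !ler_norml.
by move: (fexp p bad) => B; lra.
Qed.

End studentized_clt.

(** * Mann-Kendall statistics *)

Section statistics.
Context {R : realType}.
Implicit Types (x : nat -> R) (G b n i j : nat).

(** Turning bounds of summation into indicators lets the double sum in [mk_rem_le] be exchanged. *)
Lemma sum_interval (f : nat -> R) (k l n : nat) : (l <= n)%N ->
  \sum_(0 <= j < n) (k <= j < l)%N%:R * f j = \sum_(k <= j < l) f j.
Proof.
move=> ln; have [lk|kl] := leqP l k.
  rewrite [RHS]big_geq // big1 // => j _.
  by rewrite (_ : (k <= j < l)%N = false) ?mul0r //; lia.
rewrite (big_cat_nat (leq0n k) (leq_trans (ltnW kl) ln)) /=.
rewrite [X in _ + X](big_cat_nat (ltnW kl) ln) /=.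
have -> : \sum_(0 <= j < k) (k <= j < l)%N%:R * f j = 0.
  by rewrite big_nat big1 // => j /andP[_ jk]; rewrite leqNgt jk mul0r.
have -> : \sum_(l <= j < n) (k <= j < l)%N%:R * f j = 0.
  by rewrite big_nat big1 // => j /andP[lj _]; rewrite [(j < l)%N]ltnNge lj andbF mul0r.
rewrite add0r addr0.
by rewrite [LHS]big_nat [RHS]big_nat; apply: eq_bigr => j ->; rewrite mul1r.
Qed.

Definition cmp x i j : R := (x i < x j)%R%:R - (x j < x i)%R%:R.

Lemma cmp_le1 x i j : `|cmp x i j| <= 1.
Proof.
by rewrite /cmp; case: ltgtP => _; rewrite ?subr0 ?sub0r ?subrr ?normrN ?normr1 ?normr0.
Qed.

Lemma YstatE G x i : Ystat G x i = \sum_(i - G <= j < i) cmp x j i.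
Proof. by []. Qed.

Lemma Ystat_le G x i : `|Ystat G x i| <= G%:R.
Proof.
rewrite YstatE (le_trans (ler_norm_sum _ _ _)) //.
apply: (@le_trans _ _ (\sum_(i - G <= j < i) 1)).
  by apply: ler_sum => j _; exact: cmp_le1.
by rewrite sumr_const_nat ler_nat; lia.
Qed.

(* The pairs [(i, j)] with [n - G <= i] are counted by the sum of the Y's but not
   by [mann_kendall]. *)
Definition mk_rem G n x : R :=
  n%:R * G%:R * mann_kendall G n x - \sum_(0 <= i < n) Ystat G x i.

(** Summed over the earlier index, the Y's run over the pairs [i < j <= i + G] with [j < n]. The
    rows [i < n - G] are complete and cancel; the [G] others have at most [G] terms each. *)
Lemma mk_rem_le G n x : (0 < G)%N -> (G < n)%N -> `|mk_rem G n x| <= G%:R ^+ 2.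
Proof.
move=> G0 Gn; have nG0 : n%:R * G%:R != 0 :> R.
  by rewrite mulf_neq0 // pnatr_eq0 -lt0n // (ltn_trans G0).
rewrite /mk_rem /mann_kendall mulrA divff // mul1r.
pose F i j := (i.+1 <= j < (i + G).+1)%N%:R * cmp x i j.
have -> : \sum_(0 <= i < n) Ystat G x i = \sum_(0 <= i < n) \sum_(0 <= j < n) F i j.
  rewrite exchange_big_nat /= [LHS]big_nat [RHS]big_nat.
  apply: eq_bigr => j /andP[_ jn].
  rewrite YstatE -(@sum_interval _ _ _ n) //; last exact: ltnW.
  by apply: eq_bigr => i _; rewrite /F; congr (_%:R * _); congr nat_of_bool; lia.
rewrite (big_cat_nat (leq0n (n - G)) (leq_subr G n)) /= opprD addrA.
have -> : \sum_(0 <= i < n - G) \sum_(0 <= j < n) F i j =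
  \sum_(0 <= i < n - G) \sum_(i.+1 <= j < (i + G).+1) ((x i < x j)%R%:R - (x j < x i)%R%:R).
  rewrite [LHS]big_nat [RHS]big_nat; apply: eq_bigr => i /andP[_ iG].
  by rewrite sum_interval //; lia.
rewrite subrr sub0r normrN (le_trans (ler_norm_sum _ _ _)) //.
apply: (@le_trans _ _ (\sum_(n - G <= i < n) G%:R)).
  apply: ler_sum => i _; rewrite (le_trans (ler_norm_sum _ _ _)) //.
  apply: (@le_trans _ _ (\sum_(0 <= j < n) (i.+1 <= j < (i + G).+1)%N%:R * 1)).
    apply: ler_sum => j _; rewrite /F normrM ger0_norm // ler_wpM2l //.
    exact: cmp_le1.
  apply: (@le_trans _ _ (\sum_(0 <= j < maxn n (i + G).+1) (i.+1 <= j < (i + G).+1)%N%:R * 1)).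
    rewrite [leRHS](big_cat_nat (leq0n n) (leq_maxl _ _)) /= lerDl sumr_ge0 //.
  rewrite (@sum_interval (fun=> 1) i.+1 (i + G).+1 _ (leq_maxr _ _)).
  by rewrite sumr_const_nat ler_nat; lia.
by rewrite sumr_const_nat subKn ?(ltnW Gn) // expr2 mulr_natr.
Qed.

Lemma sigma2_hatE G b n x : sigma2_hat G b n x = lrv_hat b n (Ystat G x).
Proof. by []. Qed.

Lemma studentizedE G b (m : R) n x : (0 < G)%N -> (0 < n)%N ->
  studentized G b (m / G%:R) n x =
  (Num.sqrt n%:R)^-1 * (\sum_(0 <= i < n) (Ystat G x i - m) + mk_rem G n x)
    / Num.sqrt (lrv_hat b n (fun i => Ystat G x i - m)).
Proof.
move=> G0 n0; have gR : 0 < G%:R :> R by rewrite ltr0n.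
have nR : 0 < n%:R :> R by rewrite ltr0n.
rewrite lrv_hat_shift // /studentized /tau_hat sigma2_hatE.
rewrite !sqrtrM ?invr_ge0 ?ler0n // sqrtrV ?ler0n //.
rewrite sumrB sumr_const_nat subn0 /mk_rem -[m *+ n]mulr_natl.
set s := Num.sqrt (lrv_hat _ _ _); set V := mann_kendall G n x; set Y := \sum_(_ <= _ < _) _.
have -> : Y - n%:R * m + (n%:R * G%:R * V - Y) = n%:R * G%:R * (V - m / G%:R).
  by field; rewrite gt_eqF.
have sn : Num.sqrt n%:R != 0 :> R by rewrite gt_eqF // sqrtr_gt0.
have sg : Num.sqrt G%:R != 0 :> R by rewrite gt_eqF // sqrtr_gt0.
(* The inverse of [s] is generalized because [s] may be 0; the identity holds in that case too. *)
rewrite [(_^-1 * s)^-1]invfM invrK; move: s^-1 => si.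
set U := V - m / G%:R.
rewrite -[X in _ * (X * _ * U)](sqr_sqrtr (ltW nR)) -[X in _ * (_ * X * U)](sqr_sqrtr (ltW gR)).
by field; rewrite ?sn ?sg.
Qed.

Lemma Ystat_eq G x x' i :
  (forall j, (i - G <= j < i)%N -> cmp x j i = cmp x' j i) ->
  Ystat G x i = Ystat G x' i.
Proof. by move=> xx'; rewrite !YstatE; exact: eq_big_nat. Qed.

End statistics.

(** * Uniform permutations *)

Section cmp.
Context {R : realType}.
Implicit Types (x : nat -> R).

Lemma cmpC x i j : cmp x j i = - cmp x i j.
Proof. by rewrite /cmp opprB. Qed.

Lemma cmp_sqr x i j : x i <> x j -> cmp x i j * cmp x i j = 1.
Proof.
by move=> /eqP; rewrite /cmp; case: ltgtP => // _ _; rewrite ?subr0 ?sub0r ?mulrNN mulr1.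
Qed.

(* Of three distinct reals the least and the greatest lie on the same side of
   the two others, the middle one does not. *)
Lemma cmp_cycle x i j k : x i <> x j -> x i <> x k -> x j <> x k ->
  cmp x j i * cmp x k i + cmp x i j * cmp x k j + cmp x j k * cmp x i k = 1.
Proof.
move=> /eqP + /eqP + /eqP; rewrite /cmp.
case: (ltgtP (x i) (x j)) => // h1 _; case: (ltgtP (x i) (x k)) => // h2 _;
  case: (ltgtP (x j) (x k)) => // h3 _; rewrite /=; lra.
Qed.

End cmp.

Section permutations.
Context {R : realType} (n : nat) (x : nat -> R).
Hypothesis x_inj : forall i j, (i < n)%N -> (j < n)%N -> x i = x j -> i = j.

Definition unif : 'S_n -> R := fun=> (n`!%:R)^-1.
Local Notation E := (fexp unif).
Local Notation y s := (permute s x).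

Lemma unif_ge0 s : 0 <= unif s. Proof. by rewrite invr_ge0. Qed.

Lemma unif_sum : \sum_s unif s = 1.
Proof.
rewrite sumr_const -[LHS]mulr_natr card_Sn.
by rewrite mulVf // pnatr_eq0 -lt0n fact_gt0.
Qed.

Definition swap_nat (i j k : nat) := if k == i then j else if k == j then i else k.

Lemma permuteE (s : 'S_n) (x' : nat -> R) i (hi : (i < n)%N) : permute s x' i = x' (s (Ordinal hi)).
Proof. by rewrite /permute insubT. Qed.

Lemma permute_ge (s : 'S_n) (x' : nat -> R) i : (n <= i)%N -> permute s x' i = x' i.
Proof. by move=> ni; rewrite /permute insubF // ltnNge ni. Qed.

Lemma permuteM (s t : 'S_n) : permute (t * s)%g x = permute t (y s).
Proof.
apply/funext => i; have [ni|hi] := leqP n i; first by rewrite !permute_ge.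
by rewrite !(permuteE _ _ hi) permM; case: (t _) => k hk; rewrite (permuteE _ _ hk).
Qed.

Lemma permute_tperm (i j : nat) (hi : (i < n)%N) (hj : (j < n)%N) (x' : nat -> R) :
  permute (tperm (Ordinal hi) (Ordinal hj)) x' = x' \o swap_nat i j.
Proof.
apply/funext => k /=; rewrite /swap_nat; have [nk|hk] := leqP n k.
  by rewrite permute_ge // !gtn_eqF ?(leq_trans hi) ?(leq_trans hj).
rewrite (permuteE _ _ hk); case: tpermP => [[->]|[->]|].
- by rewrite eqxx.
- by case: (j =P i) => [->|_]; rewrite ?eqxx.
by move=> /eqP + /eqP; rewrite -!val_eqE /= => /negbTE -> /negbTE ->.
Qed.

Lemma permute_inj (s : 'S_n) i j : (i < n)%N -> (j < n)%N -> y s i = y s j -> i = j.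
Proof.
move=> hi hj; rewrite (permuteE _ _ hi) (permuteE _ _ hj) => /x_inj -/(_ (ltn_ord _) (ltn_ord _)).
by move=> /val_inj/perm_inj [].
Qed.

Lemma fexp_permute (t : 'S_n) (F : (nat -> R) -> R) :
  E (fun s => F (permute t (y s))) = E (fun s => F (y s)).
Proof.
rewrite [RHS](reindex_inj (mulgI t)); apply: eq_bigr => s _.
by rewrite permuteM.
Qed.

Local Notation C s i j := (cmp (y s) i j).

Lemma fexp_swap i j (F : (nat -> R) -> R) : (i < n)%N -> (j < n)%N ->
  E (fun s => F (y s \o swap_nat i j)) = E (fun s => F (y s)).
Proof.
move=> hi hj; rewrite -(fexp_permute (tperm (Ordinal hi) (Ordinal hj))).
by apply: eq_fexp => s; rewrite permute_tperm.
Qed.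

Let y_neq (s : 'S_n) i j : (i < n)%N -> (j < n)%N -> i <> j -> y s i <> y s j.
Proof. by move=> hi hj ij /(permute_inj hi hj). Qed.

Lemma mean_cmp i j : (i < n)%N -> (j < n)%N -> E (fun s => C s i j) = 0.
Proof.
move=> hi hj; have := fexp_swap (fun y => cmp y i j) hi hj.
have -> : E (fun s => cmp (y s \o swap_nat i j) i j) = - E (fun s => C s i j).
  rewrite -fexpN; apply: eq_fexp => s; rewrite -cmpC /cmp /= /swap_nat eqxx.
  by case: eqVneq => [->|_]; rewrite ?eqxx.
by lra.
Qed.

(** Exchanging the values at [i] and [j] changes the sign of the first factor and leaves the second
    one alone. *)
Lemma cov_cmp_disjoint i j k l : (i < n)%N -> (j < n)%N ->
  k <> i -> k <> j -> l <> i -> l <> j ->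
  E (fun s => C s i j * C s k l) = 0.
Proof.
move=> hi hj /eqP/negbTE ki /eqP/negbTE kj /eqP/negbTE li /eqP/negbTE lj.
have := fexp_swap (fun y => cmp y i j * cmp y k l) hi hj.
have -> : E (fun s => cmp (y s \o swap_nat i j) i j * cmp (y s \o swap_nat i j) k l)
  = - E (fun s => C s i j * C s k l).
  rewrite -fexpN; apply: eq_fexp => s; rewrite -mulNr -cmpC.
  rewrite /cmp /= /swap_nat eqxx ki kj li lj.
  by case: eqVneq => [->|_]; rewrite ?eqxx.
by lra.
Qed.

(** By exchangeability the three products of [cmp_cycle] have the same mean, and they add up to
    1. *)
Lemma cov_cmp_third i j k : (i < n)%N -> (j < n)%N -> (k < n)%N ->
  i <> j -> i <> k -> j <> k -> E (fun s => C s j i * C s k i) = 3^-1.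
Proof.
move=> hi hj hk ij ik jk.
have [/eqP/negbTE nij /eqP/negbTE nik /eqP/negbTE njk] := And3 ij ik jk.
have e1 : E (fun s => C s i j * C s k j) = E (fun s => C s j i * C s k i).
  rewrite -(fexp_swap (fun y => cmp y j i * cmp y k i) hi hj); apply: eq_fexp => s.
  by rewrite /cmp /= /swap_nat !eqxx [j == i]eq_sym nij [k == i]eq_sym nik [k == j]eq_sym njk.
have e2 : E (fun s => C s j k * C s i k) = E (fun s => C s j i * C s k i).
  rewrite -(fexp_swap (fun y => cmp y j i * cmp y k i) hi hk); apply: eq_fexp => s.
  by rewrite /cmp /= /swap_nat !eqxx [j == i]eq_sym nij [k == i]eq_sym nik njk.
have : E (fun s => C s j i * C s k i + C s i j * C s k j + C s j k * C s i k) = 1.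
  rewrite -[RHS](fexp_cst unif_sum); apply: eq_fexp => s.
  by rewrite cmp_cycle //; exact: y_neq.
by rewrite !fexpD e1 e2; lra.
Qed.

Variable G : nat.
Definition perm_gam (l : nat) : R :=
  if l == 0%N then (G%:R ^+ 2 + 2 * G%:R) / 3 else
  if (l <= G)%N then - l%:R / 3 else 0.

Let sum_pick (f : nat -> R) j u v : \sum_(u <= k < v) (k == j)%:R * f k = (u <= j < v)%N%:R * f j.
Proof.
case: (boolP (u <= j < v)%N) => [/andP[uj jv]|nj].
  rewrite (bigD1_seq j) ?mem_index_iota ?uj ?iota_uniq //= eqxx big1 ?addr0 // => k /negbTE ->.
  by rewrite mul0r.
rewrite mul0r big_nat big1 // => k kuv; case: eqVneq => [kj|_]; last by rewrite mul0r.
by rewrite -kj kuv in nj.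
Qed.

Let cov_cmp0 i j k : (i < n)%N -> (j < i)%N -> (k < i)%N ->
  E (fun s => C s j i * C s k i) = 3^-1 + (k == j)%:R * (2 / 3).
Proof.
move=> hi ji ki; case: eqVneq => [->|kj].
  rewrite -[E _](_ : E (fun=> 1) = _); first by rewrite fexp_cst ?unif_sum // mul1r; field.
  by apply: eq_fexp => s; rewrite cmp_sqr //; apply: y_neq => //; lia.
rewrite mul0r addr0; apply: cov_cmp_third; lia.
Qed.

Let cov_cmpS i i' j k : (i' < n)%N -> (i < i')%N -> (j < i)%N -> (k < i')%N ->
  E (fun s => C s j i * C s k i') = (k == j)%:R / 3 - (k == i)%:R / 3.
Proof.
move=> hi' ii' ji ki'.
have [hi hj hk] : [/\ i < n, j < n & k < n]%N by split; lia.
case: (eqVneq k j) => [->|kj].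
  rewrite (ltn_eqF ji) mul0r subr0 mul1r -(@cov_cmp_third j i i') //; try lia.
  by apply: eq_fexp => s; rewrite cmpC [cmp _ j i']cmpC mulrNN.
case: (eqVneq k i) => [->|ki].
  rewrite mul0r mul1r sub0r -(@cov_cmp_third i j i') //; try lia.
  by rewrite -fexpN; apply: eq_fexp => s; rewrite [cmp _ i i']cmpC mulrN.
rewrite !mul0r subrr; apply: cov_cmp_disjoint => //; try exact/eqP; lia.
Qed.

(** For [l = 0] each of the [G ^+ 2] pairs gives 1/3, and each of the [G] diagonal ones 2/3 more.
    For [0 < l <= G], the [G - l] positions common to both windows give 1/3 each, while position
    [i], which lies in the second window, gives -1/3 with each of the [G] positions of the first. *)
Lemma Ystat_cov i l : (G <= i)%N -> (i + l < n)%N ->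
  E (fun s => Ystat G (y s) i * Ystat G (y s) (i + l)) = perm_gam l.
Proof.
move=> Gi il.
have -> : E (fun s => Ystat G (y s) i * Ystat G (y s) (i + l)) =
  \sum_(i - G <= j < i) \sum_(i + l - G <= k < i + l) E (fun s => C s j i * C s k (i + l)%N).
  under [RHS]eq_bigr do rewrite -fexp_sum.
  rewrite -fexp_sum; apply: eq_fexp => s; rewrite !YstatE mulr_suml.
  by apply: eq_bigr => j _; rewrite mulr_sumr.
have count (f : nat -> R) c : (forall j, f j = c) -> \sum_(i - G <= j < i) f j = G%:R * c.
  move=> fc; under eq_bigr do rewrite fc.
  by rewrite sumr_const_nat -[LHS]mulr_natl subKn.
rewrite /perm_gam; have [->|l0] := posnP l.
  rewrite addn0; transitivity (\sum_(i - G <= j < i) (G%:R / 3 + 2 / 3) : R).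
    rewrite [LHS]big_nat [RHS]big_nat; apply: eq_bigr => j ji.
    transitivity (\sum_(i - G <= k < i) (3^-1 + (k == j)%:R * (2 / 3)) : R).
      by rewrite [LHS]big_nat [RHS]big_nat; apply: eq_bigr => k /andP[_ ki]; apply: cov_cmp0; lia.
    by rewrite big_split /= (count _ 3^-1) // sum_pick ji mul1r.
  by rewrite (count _ (G%:R / 3 + 2 / 3)) //; field.
rewrite /=.
transitivity (\sum_(i - G <= j < i) ((i + l - G <= j)%N%:R / 3 - (l <= G)%N%:R / 3) : R).
  rewrite [LHS]big_nat [RHS]big_nat; apply: eq_bigr => j /andP[_ ji].
  transitivity (\sum_(i + l - G <= k < i + l) ((k == j)%:R / 3 - (k == i)%:R / 3) : R).
    by rewrite [LHS]big_nat [RHS]big_nat; apply: eq_bigr => k /andP[_ ki]; apply: cov_cmpS; lia.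
  rewrite sumrB !sum_pick; congr (_%:R / _ - _%:R / _); congr nat_of_bool; lia.
rewrite sumrB [X in _ - X](count _ ((l <= G)%N%:R / 3)) // -mulr_suml.
case: leqP => lG; last first.
  rewrite mul0r mulr0 subr0 big_nat big1 ?mul0r // => j /andP[_ ji].
  by rewrite (_ : (i + l - G <= j)%N = false) //; lia.
have -> : \sum_(i - G <= j < i) (i + l - G <= j)%N%:R = (G - l)%:R :> R.
  have h1 : (i - G <= i + l - G)%N by lia.
  have h2 : (i + l - G <= i)%N by lia.
  rewrite (big_cat_nat h1 h2) /= big_nat big1 ?add0r => [|j /andP[_ jl]]; last first.
    by rewrite leqNgt jl.
  rewrite big_nat (eq_bigr (fun=> 1)) => [|j /andP[-> _]] //.
  rewrite -big_nat sumr_const_nat; congr (_%:R); lia.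
by rewrite natrB // mul1r; field.
Qed.

End permutations.

Section permutation_mixing.
Context {R : realType}.

Lemma sorting_perm n (W : {set 'I_n}) (u v : 'I_n -> R) : injective v ->
  exists2 h, h \in Sym W & {in W &, forall i j, u i < u j -> v (h i) < v (h j)}.
Proof.
(* By the rearrangement inequality, a maximizer of [f] will do. *)
move=> v_inj; pose f (h : 'S_n) := \sum_i u i * v (h i).
have H1 : (1%g : 'S_n) \in Sym W by rewrite inE perm_on1.
case: (@arg_maxP _ _ _ (1%g : 'S_n) (fun h => h \in Sym W) f H1) => h hW hmax.
exists h => // i j iW jW uij; rewrite ltNge; apply/negP => vle.
have ij : i != j by apply: contraTneq uij => ->; rewrite ltxx.
have vlt : v (h j) < v (h i).
  rewrite lt_neqAle vle andbT; apply: contra ij => /eqP/v_inj/perm_inj ->.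
  exact: eqxx.
have tW : (tperm i j * h)%g \in Sym W.
  rewrite groupM // inE /perm_on; apply/fintype.subsetP => k; rewrite inE.
  by case: tpermP => [->|->|]; rewrite ?eqxx.
have : f (tperm i j * h)%g <= f h := hmax _ tW.
rewrite leNgt => /negP; apply.
have fE (g : 'S_n) : f g = u i * v (g i) + (u j * v (g j) + \sum_(k | (k != i) && (k != j)) u k
    * v (g k)).
  by rewrite /f (bigD1 i) //= (bigD1 j) //= eq_sym.
rewrite !fE !permM tpermL tpermR.
rewrite [X in _ < _ + (_ + X)](eq_bigr (fun k => u k * v (h k))); last first.
  by move=> k /andP[ki kj]; rewrite permM tpermD // eq_sym.
set S := \sum_(_ | _) _.
suff : 0 < (u j - u i) * (v (h i) - v (h j)) by lra.
by rewrite mulr_gt0 // subr_gt0.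
Qed.

Variables (n : nat) (x : nat -> R) (G : nat).
Hypothesis x_inj : forall i j, (i < n)%N -> (j < n)%N -> x i = x j -> i = j.
Local Notation E := (fexp (@unif R n)).
Local Notation y s := (permute s x).
Let p0 := @unif_ge0 R n.
Let p1 := @unif_sum R n.

Definition perm_array (i : nat) (s : 'S_n) : R := if (G <= i)%N then Ystat G (y s) i else 0.
Local Notation z := perm_array.

Let E_mulg (h : 'S_n) (F : 'S_n -> R) : E (fun s => F (h * s)%g) = E F.
Proof. by rewrite [RHS](reindex_inj (mulgI h)). Qed.

Variables (m k : nat) (A B : pred 'S_n).
Hypothesis AI : determined z (fun i => i <= m)%N A.
Hypothesis BI : determined z (fun i => m + k <= i < n)%N B.
Hypothesis Gk : (G < k)%N.
Hypothesis mkn : (m + k < n)%N.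

Let W : {set 'I_n} := [set i : 'I_n | (i <= m)%N]%SET.
Let H := Sym W.

(** As [k > G], the windows of the [Y]s of index at least [m + k] begin after [m], where [h] moves
    nothing. *)
Let B_inv h s : h \in H -> B (h * s)%g = B s.
Proof.
rewrite inE => hW; apply: BI => i /andP[mi iN]; rewrite /z; case: ifP => // Gi.
have out j : (m < j)%N -> (j < n)%N -> permute (h * s) x j = y s j.
  move=> mj jn; rewrite !(permuteE _ _ jn) permM (out_perm hW) // inE /=.
  by rewrite -ltnNge.
by apply: Ystat_eq => j ji; rewrite /cmp !out //; lia.
Qed.

Let A_order s s' : (forall i j, (i <= m)%N -> (j <= m)%N -> cmp (y s) i j = cmp (y s') i j) ->
  A s = A s'.
Proof.
move=> ss'; apply: AI => i im; rewrite /z; case: ifP => // Gi.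
by apply: Ystat_eq => j ji; apply: ss'; lia.
Qed.

(* Averaging over the permutations of the first window does not change [B] and
   makes [A] constant. *)
Let avg s : R := \sum_(h in H) (A (h * s)%g)%:R.

(** [A] only sees the order of the values at the indices up to [m]. Some [h0] in [H] gives the
    values of [s] there the order of those of [s'], and multiplication by [h0] only reindexes the
    average. *)
Let avg_cst s s' : avg s = avg s'.
Proof.
have xI (t : 'S_n) : injective (fun i : 'I_n => x (t i)).
  by move=> i j /x_inj -/(_ (ltn_ord _) (ltn_ord _))/val_inj/perm_inj.
have [h0 h0H h0s] := sorting_perm W (fun i => x (s' i)) (xI s).
rewrite /avg (reindex_inj (mulIg h0)) /=.
apply: eq_big => [h|h]; rewrite groupMr // => hH; congr (_%:R); congr nat_of_bool.
apply: A_order => i j im jm.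
have [iN jN] : (i < n)%N /\ (j < n)%N by lia.
rewrite /cmp !(permuteE _ _ iN) !(permuteE _ _ jN) !permM.
move: hH; rewrite inE => hH.
have [iW jW] : h (Ordinal iN) \in W /\ h (Ordinal jN) \in W.
  by rewrite !(perm_closed _ hH) !inE.
case: (eqVneq (h (Ordinal iN)) (h (Ordinal jN))) => [->|hij]; first by rewrite !ltxx.
have : x (s' (h (Ordinal iN))) != x (s' (h (Ordinal jN))).
  by apply: contra hij => /eqP/xI ->.
case: (ltgtP (x (s' (h (Ordinal iN)))) (x (s' (h (Ordinal jN))))) => // lt _.
  by have lt' := h0s _ _ iW jW lt; rewrite lt' (lt_gtF lt').
by have lt' := h0s _ _ jW iW lt; rewrite lt' (lt_gtF lt').
Qed.

Lemma perm_independent :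
  E (fun s => (A s && B s)%:R) = E (fun s => (A s)%:R) * E (fun s => (B s)%:R).
Proof.
have H0 : #|H|%:R != 0 :> R by rewrite pnatr_eq0 -lt0n cardG_gt0.
pose c := avg 1%g.
(* Used for the indicator of [B] and for the constant 1; comparing the two gives the
   factorization. *)
have expand (F : 'S_n -> R) : (forall h s, h \in H -> F (h * s)%g = F s) ->
  #|H|%:R * E (fun s => (A s)%:R * F s) = c * E F.
  move=> Finv; transitivity (\sum_(h in H) E (fun s => (A (h * s)%g)%:R * F (h * s)%g)).
    rewrite -sumr_const mulr_suml; apply: eq_bigr => h _.
    by rewrite mul1r (E_mulg h (fun s => (A s)%:R * F s)).
  rewrite -fexp_sum -fexpZ; apply: eq_fexp => s.
  rewrite /c (avg_cst 1%g s) mulr_suml; apply: eq_bigr => h hH.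
  by rewrite Finv.
apply: (mulfI H0); rewrite mulrA.
have -> : E (fun s => (A s && B s)%:R) = E (fun s => (A s)%:R * (B s)%:R).
  by apply: eq_fexp => s; case: (A s); case: (B s); rewrite ?mul1r ?mul0r.
rewrite expand => [|h s hH]; last by rewrite B_inv.
congr (_ * _); have := expand (fun=> 1) (fun _ _ _ => erefl).
by rewrite fexp_cst // mulr1 => <-; congr (_ * _); apply: eq_fexp => s; rewrite mulr1.
Qed.

End permutation_mixing.

Section permutation_array.
Context {R : realType} (n : nat) (x : nat -> R) (G : nat).
Hypothesis x_inj : forall i j, (i < n)%N -> (j < n)%N -> x i = x j -> i = j.

Lemma perm_mixing : mixing_le (@unif R n) (perm_array x G) n (fun k => (k <= G)%N%:R).
Proof.
move=> m k A B AI BI; case: leqP => [_|Gk].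
  by rewrite fexp_cov_pred_le1 //; [exact: unif_ge0 | exact: unif_sum].
have [nm|mkn] := leqP n (m + k); last first.
  by rewrite (perm_independent x_inj AI BI Gk mkn) subrr normr0.
have Bc s : B s = B 1%g by apply: BI => i /andP[mi iN]; lia.
have -> : fexp (@unif R n) (fun s => (A s && B s)%:R) = (B 1%g)%:R * fexp (@unif R n) (fun s =>
    (A s)%:R).
  rewrite -fexpZ; apply: eq_fexp => s; rewrite Bc.
  by case: (A s); case: (B _); rewrite ?mul1r ?mul0r.
have -> : fexp (@unif R n) (fun s => (B s)%:R) = (B 1%g)%:R.
  by rewrite -[RHS](fexp_cst (@unif_sum R n)); apply: eq_fexp => s; rewrite Bc.
by rewrite mulrC subrr normr0.
Qed.

Lemma perm_weak_array :
  weak_array n G G%:R (fun k => (k <= G)%N%:R) (perm_gam G) (@unif R n) (perm_array x G).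
Proof.
split.
- exact: unif_ge0.
- exact: unif_sum.
- by move=> i s; rewrite /perm_array; case: ifP => _; [exact: Ystat_le | rewrite normr0].
- move=> i hi; have [Gi|iG] := leqP G i; last first.
    rewrite -[RHS](fexp_cst (@unif_sum R n)); apply: eq_fexp => s.
    by rewrite /perm_array leqNgt iG.
  transitivity (fexp (@unif R n) (fun s => Ystat G (permute s x) i)).
    by apply: eq_fexp => s; rewrite /perm_array Gi.
  rewrite fexp_sum big_nat big1 // => j /andP[_ ji].
  by apply: mean_cmp => //; lia.
- move=> i l Gi il; rewrite -(Ystat_cov x_inj Gi il); apply: eq_fexp => s.
  by rewrite /perm_array Gi (leq_trans Gi) // leq_addr.
- exact: perm_mixing.
Qed.

(** The limit is [(G ^+ 2 + 2 * G) / 3] minus two thirds of [1 + ... + G]. Both sequences vanish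
    beyond [G], so the limits are attained. *)
Lemma perm_lag_limits : lag_limits (fun k => (k <= G)%N%:R) (@perm_gam R G) (G%:R / 3).
Proof.
split=> [e e0|e e0].
  exists G => N; rewrite big_nat big1 ?(ltW e0) // => l /andP[Gl _].
  by rewrite ltnNge Gl normr0.
exists G => L GL; rewrite (big_cat_nat (leq0n G) GL) /=.
have -> : \sum_(G <= l < L) @perm_gam R G l.+1 = 0.
  by rewrite big_nat big1 // => l /andP[Gl _]; rewrite /perm_gam /= ltnNge Gl.
have -> : \sum_(0 <= l < G) @perm_gam R G l.+1 = - (G%:R * (G%:R + 1) / 6).
  transitivity (\sum_(0 <= l < G) (- l.+1%:R / 3) : R).
    by rewrite [LHS]big_nat [RHS]big_nat; apply: eq_bigr => l /andP[_ lG]; rewrite /perm_gam /= lG.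
  elim: G => [|g IH]; first by rewrite big_geq // mul0r mul0r oppr0.
  by rewrite big_nat_recr //= IH -natr1; field.
rewrite /perm_gam /= [X in `|X|](_ : _ = 0) ?normr0 ?(ltW e0) //.
by rewrite addr0; field.
Qed.

End permutation_array.

(** * Polya's theorem *)

Section polya.
Context {R : realType} (F : nat -> R -> R).
Hypothesis F_homo : forall n s t, s <= t -> F n s <= F n t.
Hypothesis F_ge0 : forall n t, 0 <= F n t.
Hypothesis F_le1 : forall n t, F n t <= 1.
Hypothesis F_cvg : forall t eta, 0 < eta ->
  exists N, forall n, (N <= n)%N -> `|F n t - Phi t| <= eta.

Lemma eventually_finite (Q : nat -> nat -> Prop) M :
  (forall i, exists N, forall n, (N <= n)%N -> Q i n) ->
  exists N, forall n, (N <= n)%N -> forall i, (i <= M)%N -> Q i n.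
Proof.
move=> hQ; elim: M => [|M [N hN]].
  by have [N hN] := hQ 0%N; exists N => n /hN ? i; rewrite leqn0 => /eqP ->.
have [N' hN'] := hQ M.+1; exists (maxn N N') => n; rewrite geq_max => /andP[n1 n2] i.
by rewrite leq_eqVlt => /predU1P[->|]; [exact: hN' | exact: hN].
Qed.

Lemma polya eta : 0 < eta ->
  exists N, forall n, (N <= n)%N -> forall t, `|F n t - Phi t| <= eta.
Proof.
move=> eta0; have e0 : 0 < eta / 2 by rewrite divr_gt0.
have [k k0 [k1 k2]] := Phi_tail e0.
(* Mesh of the grid: 16 is the Lipschitz constant of [Phi], which thus varies by at most [eta / 2]
   between neighbours. Outside [[-k, k]] the tails do the same. *)
pose dl := eta / 2 / 16; have dl0 : 0 < dl by rewrite divr_gt0.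
pose M := Num.bound (2 * k / dl).
have hM : 2 * k <= M%:R * dl.
  rewrite -ler_pdivrMr //; apply: ltW; apply: archi_boundP.
  by rewrite divr_ge0 ?mulr_ge0 // ltW.
pose g i := - k + i%:R * dl.
have [N hN] := eventually_finite M (fun i => F_cvg (g i) e0).
exists N => n /hN{}hN t.
have hg i : (i <= M)%N -> F n (g i) <= Phi (g i) + eta / 2 /\ Phi (g i) - eta / 2 <= F n (g i).
  by move=> /hN; rewrite ler_norml => /andP[]; lra.
have [tk|kt] := ltP t (- k).
  have [h _] := hg 0%N isT; rewrite /g mul0r addr0 in h.
  have := F_homo n (ltW tk); have := Phi_le (ltW tk); have := Phi_ge0 t; have := F_ge0 n t.
  by rewrite ler_norml; lra.
have gM : k <= g M by rewrite /g; lra.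
have [Mt|tM] := leP (g M) t.
  have [_ h] := hg M (leqnn M); have := F_homo n Mt; have := Phi_le Mt.
  have := Phi_le gM; have := Phi_le1 t; have := F_le1 n t.
  by rewrite ler_norml; lra.
have exi : exists i, t < g i by exists M.
have [i ti imin] := ex_minnP exi.
have i0 : (0 < i)%N.
  by rewrite lt0n; apply: contraTneq ti => ->; rewrite /g mul0r addr0 -leNgt.
have iM : (i <= M)%N by exact: imin.
have ti' : g i.-1 <= t.
  by rewrite leNgt; apply/negP => /imin; rewrite leqNgt prednK // leqnn.
have gg : g i = g i.-1 + dl by rewrite /g -{1}(prednK i0) -natr1; ring.
have [h1 _] := hg i iM; have [_ h2] := hg i.-1 (leq_trans (leq_pred i) iM).
have := Phi_lipschitz (g i.-1) (g i).
rewrite (_ : g i - g i.-1 = dl); last by rewrite gg; ring.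
rewrite (gtr0_norm dl0) (_ : 16 * dl = eta / 2); last by rewrite /dl; field.
rewrite ler_norml => /andP[_ h3].
have := F_homo n (ltW ti); have := F_homo n ti'; have := Phi_le (ltW ti); have := Phi_le ti'.
by move: h1 h2 h3; rewrite ler_norml; lra.
Qed.

Lemma polya_sup :
  sup (range (fun t => `|F n t - Phi t|)) @[n --> \oo] --> (0 : R).
Proof.
apply/cvgrPdist_le => eta eta0; have [N hN] := polya eta0.
exists N => // n /= /hN{}hN; rewrite sub0r normrN.
have ne : range (fun t => `|F n t - Phi t|) !=set0 by exists `|F n 0 - Phi 0|; exists 0.
have ub : ubound (range (fun t => `|F n t - Phi t|)) eta by move=> _ [t _ <-].
rewrite ger0_norm; first exact: ge_sup.
by apply: le_trans (ub_le_sup _ _); [| exists eta | exists 0 => //].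
Qed.

End polya.

(** * Limit of the permutation distribution *)

Section permutation_clt.
Context {R : realType} (G : nat) (b : nat -> nat).
Hypothesis G_gt0 : (0 < G)%N.
Hypothesis b_gt0 : forall n, (0 < b n)%N.
Hypothesis b_small : forall e : R, 0 < e -> exists N, forall n, (N <= n)%N ->
  (b n)%:R <= e * Num.sqrt n%:R.
Hypothesis b_large : forall B, exists N, forall n, (N <= n)%N -> (B <= b n)%N.

Lemma permutation_cdfE (S : (nat -> R) -> R) n x t :
  permutation_cdf S n x t = fexp (@unif R n) (fun s => (S (permute s x) <= t)%R%:R).
Proof. by rewrite /permutation_cdf big_distrr. Qed.

(** The path is fixed and deterministic: the randomness is that of the permutation alone, and the
    comparisons of a uniform permutation have mean 0, whence the centering at 0. *)
Lemma permutation_clt (x : nat -> R) : injective x ->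
  sup (range (fun t => `|permutation_cdf (studentized G (b n) 0 n) n x t - Phi t|))
  @[n --> \oo] --> (0 : R).
Proof.
move=> x_inj; apply: polya_sup => [n s t st|n t|n t|t eta eta0].
- rewrite !permutation_cdfE; apply: fexp_le => [?|w]; first exact: unif_ge0.
  by rewrite ler_nat; case: leP => // ws; rewrite (le_trans ws).
- by rewrite permutation_cdfE; case/andP: (@fexp_pred _ _ _ (@unif_ge0 R n) (@unif_sum R n)
    (fun s => studentized G (b n) 0 n (permute s x) <= t)).
- by rewrite permutation_cdfE; case/andP: (@fexp_pred _ _ _ (@unif_ge0 R n) (@unif_sum R n)
    (fun s => studentized G (b n) 0 n (permute s x) <= t)).
have s20 : 0 < G%:R / 3 :> R by rewrite divr_gt0 // ltr0n.
have a_anti k l : (k <= l)%N -> (l <= G)%N%:R <= (k <= G)%N%:R :> R.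
  by move=> kl; rewrite ler_nat; case: (leqP l G) => // lG; rewrite (leq_trans kl).
have aA N : \sum_(1 <= h < N) (h <= G)%N%:R <= G%:R :> R.
  have [NG|GN] := leqP N G.+1.
    apply: (@le_trans _ _ (\sum_(1 <= h < N) 1)); last by rewrite sumr_const_nat ler_nat; lia.
    by apply: ler_sum => h _; rewrite lern1 leq_b1.
  have h1 : (1 <= G.+1)%N by [].
  rewrite (big_cat_nat h1 (ltnW GN)) /= [X in _ + X]big_nat [X in _ + X]big1 ?addr0 => [|h
      /andP[Gh _]].
    apply: (@le_trans _ _ (\sum_(1 <= h < G.+1) 1)); last by rewrite sumr_const_nat subn1.
    by apply: ler_sum => h _; rewrite lern1 leq_b1.
  by rewrite leqNgt Gh.
have c0 : 0 <= G%:R ^+ 2 :> R by rewrite exprn_ge0.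
have [N hN] := studentized_clt G (ler0n R G) s20 (perm_lag_limits G) (fun=> ler0n _ _) a_anti aA
  b_gt0 b_small b_large t c0 eta0.
exists (maxn N G.+1) => n; rewrite geq_max => /andP[Nn Gn].
have n0 : (0 < n)%N by exact: leq_trans Gn.
pose d i (s : 'S_n) := Ystat G (permute s x) i - 0.
have inj_n i j : (i < n)%N -> (j < n)%N -> x i = x j -> i = j by move=> _ _ /x_inj.
have := hN n Nn _ _ _ d (fun s => mk_rem G n (permute s x)) (perm_weak_array G inj_n).
have dG i s : `|d i s| <= G%:R by rewrite /d subr0 Ystat_le.
have dz i s : (G <= i)%N -> d i s = perm_array x G i s.
  by move=> Gi; rewrite /d subr0 /perm_array Gi.
move=> /(_ dG dz (fun s => mk_rem_le _ G_gt0 Gn)).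
rewrite permutation_cdfE; congr (`|_ - _| <= _); apply: eq_fexp => s.
by rewrite -[X in studentized _ _ X](mul0r (G%:R^-1)) studentizedE.
Qed.

End permutation_clt.

(** * Comparison patterns of a stationary process *)

Section finite_valued.
Context (d : measure_display) (T : measurableType d).

Lemma measurable_finite_preimage (Om : finType) (f : T -> Om) (Q : pred Om) :
  (forall o, measurable (f @^-1` [set o])) -> measurable [set w | Q (f w)].
Proof.
move=> mf; have -> : [set w | Q (f w)] = \bigcup_(o in [set o | Q o]) f @^-1` [set o].
  apply/seteqP; split=> [w Qw | w [q Qq]]; first by exists (f w).
  by move=> /= ->.
by apply: fin_bigcup_measurable => // ; exact: finite_finset.
Qed.

Lemma measurable_ffun_fiber (I : finType) (g : I -> T -> bool) (o : {ffun I -> bool}) :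
  (forall i, measurable_fun setT (g i)) ->
  measurable ((fun w => [ffun i => g i w]) @^-1` [set o]).
Proof.
move=> mg; have -> : (fun w => [ffun i => g i w]) @^-1` [set o] =
    \bigcap_(i in setT) (g i @^-1` [set o i]).
  apply/seteqP; split=> [w ow i _ | w ow]; first by rewrite /= -ow ffunE.
  by apply/ffunP => i; rewrite ffunE; exact: ow.
apply: fin_bigcap_measurable => [|i _]; first exact: finite_finset.
by rewrite -[X in measurable X]setTI; exact: mg.
Qed.

Context (R : realType) (P : probability T R).

Definition law (Om : finType) (f : T -> Om) (o : Om) : R := fine (P (f @^-1` [set o])).

Lemma fexp_law (Om : finType) (f : T -> Om) (g : Om -> R) :
  (forall o, measurable (f @^-1` [set o])) ->
  'E_P[fun w => g (f w)]%E = (fexp (law f) g)%:E.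
Proof.
move=> mf; rewrite unlock.
have -> : (fun w => (g (f w))%:E) = (fun w => \sum_o ((g o)%:E * (\1_(f @^-1` [set o]) w)%:E))%E.
  apply/funext => w; rewrite (bigD1 (f w)) //= big1 ?adde0.
    by rewrite indicE mem_set // mule1.
  move=> o /eqP of_; rewrite indicE memNset ?mule0 // => /= fo.
  by apply: of_.
rewrite integral_sum //; last first.
  by move=> o; apply: integrableZl => //; exact: integrable_indic.
rewrite /fexp -sumEFin; apply: eq_bigr => o _.
rewrite integralZl //; last exact: integrable_indic.
by rewrite integral_indic // setIT /law muleC EFinM fineK // fin_num_measure.
Qed.

Lemma law_ge0 (Om : finType) (f : T -> Om) o : 0 <= law f o.
Proof. by rewrite /law fine_ge0. Qed.

Lemma law_sum (Om : finType) (f : T -> Om) :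
  (forall o, measurable (f @^-1` [set o])) -> \sum_o law f o = 1.
Proof.
move=> mf; have := fexp_law (fun=> 1) mf.
rewrite (_ : 'E_P[_]%E = 1%E); last exact: expectation_cst.
by rewrite /fexp => -[->]; apply: eq_bigr => o _; rewrite mulr1.
Qed.

Lemma prob_law (Om : finType) (f : T -> Om) (Q : pred Om) :
  (forall o, measurable (f @^-1` [set o])) ->
  P [set w | Q (f w)] = (fexp (law f) (fun o => (Q o)%:R))%:E.
Proof.
move=> mf; rewrite -fexp_law // -expectation_indic; last exact: measurable_finite_preimage.
by congr ('E_P[_])%E; apply/funext => w; rewrite indicE; congr (_%:R); congr nat_of_bool;
  apply/idP/idP => [|Qw]; rewrite ?inE // mem_set.
Qed.

End finite_valued.

Section patterns.
Context {R : realType}.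
Implicit Types (x : nat -> R) (n : nat).

Definition patx n x : {ffun 'I_n * 'I_n -> bool} := [ffun ij : 'I_n * 'I_n => x ij.1 < x ij.2].

(* A path with pattern [o]; when there is none [o] has probability 0 under
   every law considered, and the value does not matter. *)
Definition rpath n (o : {ffun 'I_n * 'I_n -> bool}) : nat -> R :=
  xget (fun=> 0) [set x | patx n x = o].

Lemma rpathK n x : patx n (rpath (patx n x)) = patx n x.
Proof. exact: (@xgetPex _ (fun=> 0) [set x' | patx n x' = patx n x] (ex_intro _ x erefl)). Qed.

Definition ordinal_stat n (A : Type) (F : (nat -> R) -> A) : Prop :=
  forall x x', patx n x = patx n x' -> F x = F x'.

Lemma patx_cmp n x x' i j : patx n x = patx n x' -> (i < n)%N -> (j < n)%N ->
  cmp x i j = cmp x' i j.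
Proof.
move=> /ffunP h hi hj; have := h (Ordinal hi, Ordinal hj); have := h (Ordinal hj, Ordinal hi).
by rewrite !ffunE /cmp /= => -> ->.
Qed.

Lemma ordinal_Ystat n G i : (i < n)%N -> ordinal_stat n (fun x => Ystat G x i).
Proof.
move=> hi x x' e; apply: Ystat_eq => j /andP[_ ji]; apply: (patx_cmp e) => //.
exact: ltn_trans hi.
Qed.

Lemma ordinal_mann_kendall n G : ordinal_stat n (mann_kendall G n).
Proof.
move=> x x' e; rewrite /mann_kendall; congr (_ * _).
rewrite [LHS]big_nat [RHS]big_nat; apply: eq_bigr => i /andP[_ iG].
by apply: eq_big_nat => j ij; apply: (patx_cmp e); lia.
Qed.

Lemma ordinal_studentized n G b c : ordinal_stat n (studentized G b c n).
Proof.
move=> x x' e; rewrite /studentized (ordinal_mann_kendall G e); congr (_ / _).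
rewrite /tau_hat; congr (Num.sqrt (_ * _)).
have eY i : (i < n)%N -> Ystat G x i = Ystat G x' i by move=> hi; exact: (ordinal_Ystat G hi).
have em : Ymean G n x = Ymean G n x'.
  by rewrite /Ymean; congr (_ * _); apply: eq_big_nat => i /andP[_ /eY].
rewrite /sigma2_hat em; congr (_ * _ + _ * _).
  by apply: eq_big_nat => i /andP[_ /eY ->].
apply: eq_bigr => j _; apply: eq_big_nat => i /andP[_ ij].
by rewrite !eY //; lia.
Qed.

End patterns.

Section process.
Context (R : realType) (d : measure_display) (T : measurableType d)
  (P : probability T R) (X : nat -> {RV P >-> R}).

Definition pat n h (w : T) := patx n (fun i => X (i + h)%N w).

Lemma sigma_of_pattern n h (I : set nat) o :
  (forall i, (i < n)%N -> I (i + h)%N) -> sigma_of X I (pat n h @^-1` [set o]).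
Proof.
move=> hI; pose S := \bigcup_(i in I) preimage_set_system setT (X i) measurable.
have mX i : I i -> measurable_fun setT (X i : g_sigma_algebraType S -> R).
  move=> Ii _ B mB; apply: sub_sigma_algebra; exists i => //; exists B => //.
have := @measurable_ffun_fiber _ (g_sigma_algebraType S) ('I_n * 'I_n)%type
  (fun ij w => X (ij.1 + h)%N w < X (ij.2 + h)%N w) o.
apply=> ij; apply: measurable_fun_ltr; apply: mX; exact: hI.
Qed.

(** Such an event is a union of fibres of the pattern, of which there are finitely many. *)
Lemma sigma_of_pattern_dep n h (I : set nat) (Q : T -> bool) :
  (forall i, (i < n)%N -> I (i + h)%N) ->
  (forall w w', pat n h w = pat n h w' -> Q w = Q w') -> sigma_of X I [set w | Q w].
Proof.
move=> hI hQ; pose Q' o := `[< exists2 w, pat n h w = o & Q w >].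
pose S := \bigcup_(i in I) preimage_set_system setT (X i) measurable.
have -> : [set w | Q w] = [set w | Q' (pat n h w)].
  apply/seteqP; split=> w /=; first by move=> Qw; apply/asboolP; exists w.
  by move=> /asboolP[w' /hQ ->].
apply: (@measurable_finite_preimage _ (g_sigma_algebraType S)) => o.
exact: sigma_of_pattern.
Qed.

Lemma pattern_fiber n h o : measurable (pat n h @^-1` [set o]).
Proof.
apply: (@measurable_ffun_fiber _ T ('I_n * 'I_n)%type
  (fun ij w => X (ij.1 + h)%N w < X (ij.2 + h)%N w) o) => ij.
by apply: measurable_fun_ltr.
Qed.

Hypothesis X_stationary : stationary X.

Lemma law_pattern_shift n h : law P (pat n h) = law P (pat n 0).
Proof.
apply/funext => o; rewrite /law; congr fine.
pose B := (fun v : n.-tuple R => [ffun ij : 'I_n * 'I_n => tnth v ij.1 < tnth v ij.2]) @^-1`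
    [set o].
have mB : measurable B.
  apply: (@measurable_ffun_fiber _ _ ('I_n * 'I_n)%type
    (fun ij (v : n.-tuple R) => tnth v ij.1 < tnth v ij.2) o) => ij.
  by apply: measurable_fun_ltr; exact: measurable_tnth.
have key (f : nat -> T -> R) : [set w | B [tuple of [seq f i w | i <- iota_tuple n 0]]] =
   (fun w => patx n (f^~ w)) @^-1` [set o].
  apply/seteqP; split=> w /=; rewrite /B /= => <-; apply/ffunP => ij; rewrite !ffunE;
    by rewrite !tnth_map !(tnth_nth 0%N) /= !nth_iota.
have := X_stationary (iota_tuple n 0) h mB.
rewrite (key (fun i => X (i + h)%N)) (key (fun i => X i)) => ->.
rewrite (_ : pat n 0 = fun w => patx n (fun i => X i w)) //.
by apply/funext => w; congr patx; apply/funext => i; rewrite addn0.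
Qed.

(** The bridge to finite spaces: by stationarity every shift of the path has the same law of
    patterns, and an ordinal statistic may be evaluated at the representative [rpath]. *)
Lemma expectation_ordinal n h (F : (nat -> R) -> R) : ordinal_stat n F ->
  'E_P[fun w => F (fun i => X (i + h)%N w)]%E = (fexp (law P (pat n 0)) (fun o => F (rpath o)))%:E.
Proof.
move=> nF; rewrite -(law_pattern_shift n h) -fexp_law; last exact: pattern_fiber.
by congr ('E_P[_])%E; apply/funext => w; apply: nF; rewrite rpathK.
Qed.

Lemma prob_ordinal n (F : (nat -> R) -> bool) : ordinal_stat n F ->
  P [set w | F (sample_path X w)] = (fexp (law P (pat n 0)) (fun o => (F (rpath o))%:R))%:E.
Proof.
move=> nF; rewrite -(@prob_law _ _ _ _ _ _ (fun o => F (rpath o))); last exact: pattern_fiber.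
congr (P _); apply/seteqP; split=> w /=; rewrite (nF _ (rpath (pat n 0 w))) // rpathK;
  congr patx; by apply/funext => i; rewrite addn0.
Qed.

Variable G : nat.
Local Notation m := (mu X G).

Lemma Ystat_shift (x : nat -> R) i h : (G <= i)%N ->
  Ystat G (fun k => x (k + h)%N) i = Ystat G x (i + h).
Proof.
move=> Gi; rewrite /Ystat (_ : (i + h - G = i - G + h)%N); last by lia.
by rewrite big_addn addnK.
Qed.

Lemma law_pat_sum n : \sum_o law P (pat n 0) o = 1.
Proof. by apply: law_sum; exact: pattern_fiber. Qed.

Lemma sample_path0 w : sample_path X w = (fun i => X (i + 0)%N w).
Proof. by apply/funext => i; rewrite addn0. Qed.

Lemma Yproc_shift i w : (G <= i)%N -> Yproc X G i w = Ystat G (fun k => X (k + (i - G))%N w) G.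
Proof. by move=> Gi; rewrite (@Ystat_shift (fun k => X k w)) // subnKC. Qed.

Lemma expectation_Yproc i : (G <= i)%N -> 'E_P[Yproc X G i]%E = m%:E.
Proof.
move=> Gi.
have h j : (G <= j)%N -> 'E_P[Yproc X G j]%E =
   (fexp (law P (pat G.+1 0)) (fun o => Ystat G (rpath o) G))%:E.
  move=> Gj; rewrite -(@expectation_ordinal _ (j - G) (fun x => Ystat G x G)); last exact:
      ordinal_Ystat.
  by congr ('E_P[_])%E; apply/funext => w; exact: Yproc_shift.
by rewrite h // /mu h.
Qed.

Definition Zstat i (x : nat -> R) : R := if (G <= i)%N then Ystat G x i - m else 0.

Lemma ordinal_Zstat n i : (i < n)%N -> ordinal_stat n (Zstat i).
Proof. by move=> hi x x' e; rewrite /Zstat (ordinal_Ystat G hi e). Qed.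

Definition Zbound : R := G%:R + `|m|.

Lemma Zstat_le i x : `|Zstat i x| <= Zbound.
Proof.
rewrite /Zstat; case: ifP => _; last by rewrite normr0 addr_ge0.
by rewrite (le_trans (ler_normB _ _)) // lerD2r Ystat_le.
Qed.

(** Computed on patterns of [(G + l).+1] observations, the fewest that determine both factors;
    larger samples give the same value by [cov_Z]. *)
Definition cov_lag l : R :=
  fexp (law P (pat (G + l).+1 0)) (fun o => Zstat G (rpath o) * Zstat (G + l) (rpath o)).

Lemma expectation_Z i l : (G <= i)%N ->
  'E_P[fun w => (Zstat i (sample_path X w) * Zstat (i + l) (sample_path X w))%R]%E = (cov_lag l)%:E.
Proof.
move=> Gi; rewrite /cov_lag -(@expectation_ordinal _ (i - G) (fun x => Zstat G x * Zstat (G +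
    l) x)).
  congr ('E_P[_])%E; apply/funext => w; rewrite /Zstat Gi leqnn leq_addr (leq_trans Gi)
      ?leq_addr //.
  rewrite !(@Ystat_shift (fun k => X k w)) ?leq_addr // subnKC //.
  by rewrite (_ : (G + l + (i - G) = i + l)%N) //; lia.
move=> x x' e; rewrite !(@ordinal_Zstat (G + l).+1 _ _ x x') //.
by rewrite ltnS leq_addr.
Qed.

Lemma covariance_Y l : covariance P (Yproc X G G) (Yproc X G (G + l)) = (cov_lag l)%:E.
Proof.
rewrite covariance.unlock !expectation_Yproc ?leq_addr //= -(@expectation_Z G l) //.
by congr ('E_P[_])%E; apply/funext => w; rewrite /Zstat leqnn leq_addr.
Qed.

Lemma mean_Z n i : (i < n)%N -> fexp (law P (pat n 0)) (fun o => Zstat i (rpath o)) = 0.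
Proof.
move=> hi; have [Gi|iG] := leqP G i; last first.
  rewrite -[RHS](fexp_cst (law_pat_sum n)); apply: eq_fexp => o.
  by rewrite /Zstat leqNgt iG.
have := @expectation_ordinal n 0 (fun x => Ystat G x i) (ordinal_Ystat G hi).
have -> : 'E_P[fun w => Ystat G (fun k => X (k + 0)%N w) i]%E = m%:E.
  rewrite -(expectation_Yproc Gi); congr ('E_P[_])%E; apply/funext => w.
  by rewrite /Yproc sample_path0.
case=> mE; transitivity (fexp (law P (pat n 0)) (fun o => Ystat G (rpath o) i) -
    fexp (law P (pat n 0)) (fun=> m)).
  by rewrite -fexpB; apply: eq_fexp => o; rewrite /Zstat Gi.
by rewrite (fexp_cst (law_pat_sum n)) -mE subrr.
Qed.

Lemma cov_Z n i l : (G <= i)%N -> (i + l < n)%N ->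
  fexp (law P (pat n 0)) (fun o => Zstat i (rpath o) * Zstat (i + l) (rpath o)) = cov_lag l.
Proof.
move=> Gi il; apply: EFin_inj; rewrite -(@expectation_Z i l) //.
rewrite -(@expectation_ordinal n 0 (fun x => Zstat i x * Zstat (i + l) x)).
  by congr ('E_P[_])%E; apply/funext => w; rewrite sample_path0.
move=> x x' e; rewrite !(@ordinal_Zstat n _ _ x x') //.
by rewrite (leq_ltn_trans _ il) // leq_addr.
Qed.

End process.

(** * Mixing coefficients of the process and of its windows *)

Section alpha.
Context (R : realType) (d : measure_display) (T : measurableType d)
  (P : probability T R) (X : nat -> {RV P >-> R}).

Lemma sigma_of_measurable (I : set nat) (A : set T) : sigma_of X I A -> measurable A.
Proof.
move: A; apply: smallest_sub; first exact: sigma_algebra_measurable.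
by move=> A [i _ [B mB <-]]; exact: measurable_funP.
Qed.

Lemma sigma_ofS (I J : set nat) : I `<=` J -> sigma_of X I `<=` sigma_of X J.
Proof. by move=> IJ; apply: sub_sigma_algebra2; apply: bigcup_subset. Qed.

Lemma cov_event_le1 (A B : set T) : measurable A -> measurable B ->
  (`|P (A `&` B) - P A * P B| <= 1)%E.
Proof.
move=> mA mB; have mAB : measurable (A `&` B) by exact: measurableI.
have h C : measurable C -> 0 <= fine (P C) <= 1.
  by move=> mC; rewrite fine_ge0 //= -lee_fin fineK ?fin_num_measure // probability_le1.
have /andP[a0 a1] := h _ mA; have /andP[b0 b1] := h _ mB; have /andP[c0 c1] := h _ mAB.
rewrite -(fineK (fin_num_measure P _ mA)) -(fineK (fin_num_measure P _ mB)).
rewrite -(fineK (fin_num_measure P _ mAB)) -EFinM -EFinB abse_EFin lee_fin.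
have ab0 := mulr_ge0 a0 b0; have ab1 := mulr_ile1 a0 b0 a1 b1.
by move: c0 c1 ab0 ab1; rewrite ler_norml; lra.
Qed.

Lemma alpha_le1 n : (alpha X n <= 1)%E.
Proof.
apply: ge_ereal_sup => _ [m [A [B [pA fB ->]]]].
by apply: cov_event_le1; [exact: sigma_of_measurable pA | exact: sigma_of_measurable fB].
Qed.

Lemma alpha_ub n m A B : past X m A -> future X (m + n) B ->
  (`|P (A `&` B) - P A * P B| <= alpha X n)%E.
Proof. by move=> pA fB; apply: ereal_sup_ubound; exists m, A, B. Qed.

Lemma alpha_ge0 n : (0 <= alpha X n)%E.
Proof.
apply: le_trans (@alpha_ub n 0 set0 set0 _ _); first exact: abse_ge0.
- exact: sigma_algebra0.
- exact: sigma_algebra0.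
Qed.

Lemma alpha_fin n : alpha X n \is a fin_num.
Proof. by rewrite ge0_fin_numE ?alpha_ge0 // (le_lt_trans (alpha_le1 n)) // ltry. Qed.

Lemma alpha_anti k l : (k <= l)%N -> (alpha X l <= alpha X k)%E.
Proof.
move=> kl; apply: ge_ereal_sup => _ [m [A [B [pA fB ->]]]]; apply: (alpha_ub pA).
have kls : [set i | (m + l <= i)%N] `<=` [set i | (m + k <= i)%N].
  by move=> i /=; apply: leq_trans; rewrite leq_add2l.
exact: (sigma_ofS kls fB).
Qed.

Variable G : nat.

(* Y_i reads X_{i-G}, ..., X_i, so a gap of [k] between Y's leaves a gap of
   [k - G] between X's. *)
Definition window_alpha (k : nat) : R := if (k <= G)%N then 1 else fine (alpha X (k - G)).

Let fa_ge0 n : 0 <= fine (alpha X n). Proof. by rewrite fine_ge0 // alpha_ge0. Qed.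

Lemma window_alpha_ge0 k : 0 <= window_alpha k.
Proof. by rewrite /window_alpha; case: ifP. Qed.

Lemma window_alpha_anti k l : (k <= l)%N -> window_alpha l <= window_alpha k.
Proof.
move=> kl; rewrite /window_alpha; case: (leqP l G) => [lG|Gl].
  by rewrite (leq_trans kl).
case: ifP => [_|_]; first by rewrite -lee_fin fineK ?alpha_fin ?alpha_le1.
by rewrite -lee_fin !fineK ?alpha_fin // alpha_anti // leq_sub2r.
Qed.

Hypothesis alpha_summable : (\sum_(1 <= n <oo) alpha X n < +oo)%E.

Definition window_bound : R := G%:R + fine (\sum_(1 <= n <oo) alpha X n)%E.

Lemma window_alpha_sum N : \sum_(1 <= h < N) window_alpha h <= window_bound.
Proof.
pose S : \bar R := (\sum_(1 <= n <oo) alpha X n)%E.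
have S0 : (0 <= S)%E by apply: nneseries_ge0 => n _ _; exact: alpha_ge0.
have Sfin : S \is a fin_num by rewrite ge0_fin_numE.
have part M : \sum_(1 <= h < M) fine (alpha X h) <= fine S.
  rewrite -lee_fin fineK // -sumEFin.
  under eq_bigr do rewrite fineK ?alpha_fin //.
  by apply: nneseries_lim_ge => n _ _; exact: alpha_ge0.
have [NG|GN] := leqP N G.+1.
  apply: (@le_trans _ _ G%:R); last by rewrite /window_bound lerDl fine_ge0.
  apply: (@le_trans _ _ (\sum_(1 <= h < N) 1)); last by rewrite sumr_const_nat ler_nat; lia.
  rewrite big_nat [leRHS]big_nat; apply: ler_sum => h /andP[_ hN].
  by rewrite /window_alpha ifT //; lia.
have h1 : (1 <= G.+1)%N by [].
rewrite (big_cat_nat h1 (ltnW GN)) /= /window_bound lerD //.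
  apply: (@le_trans _ _ (\sum_(1 <= h < G.+1) 1)); last by rewrite sumr_const_nat subn1.
  rewrite big_nat [leRHS]big_nat; apply: ler_sum => h /andP[_ hN].
  by rewrite /window_alpha -ltnS hN.
apply: le_trans (part (N - G)%N).
rewrite (_ : G.+1 = (1 + G)%N) // big_addn.
rewrite big_nat [leRHS]big_nat; apply: ler_sum => h /andP[h0 _].
by rewrite /window_alpha addnK ifF //; lia.
Qed.

End alpha.

Section series.
Context {R : realType} (f : nat -> R) (B : R).
Hypothesis f_ge0 : forall n, 0 <= f n.
Hypothesis f_sum : forall N, \sum_(0 <= n < N) f n <= B.

Lemma nonneg_series_cvg : cvgn (series f).
Proof.
apply: nondecreasing_is_cvgn; first by apply: nondecreasing_series => n _ _; exact: f_ge0.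
by exists B => _ [n _ <-]; exact: f_sum.
Qed.

Lemma nonneg_series_tail (e : R) : 0 < e -> exists L, forall N, \sum_(L <= n < N) f n <= e.
Proof.
move=> e0; have c := nonneg_series_cvg.
have nd : nondecreasing_seq (series f) by apply: nondecreasing_series => n _ _; exact: f_ge0.
have /cvgrPdist_le /(_ e e0) [L _ hL] := c; exists L => N.
have [NL|LN] := leqP N L; first by rewrite big_geq // ltW.
have := hL L (leqnn L); rewrite /= ger0_norm; last first.
  by rewrite subr_ge0 (nondecreasing_cvgn_le nd c).
have := nondecreasing_cvgn_le nd c N.
rewrite {1}/series /= (big_cat_nat (leq0n L) (ltnW LN)) /= -/(series f L).
by move: (limn _) => l; rewrite /series /=; lra.
Qed.

Lemma dominated_series_cvg (g : nat -> R) (C : R) :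
  (forall n, `|g n| <= C * f n) -> cvgn (series g).
Proof.
move=> gf; apply: normed_cvg; apply: (@series_le_cvg _ _ (fun n => C * f n)).
- by move=> n; exact: normr_ge0.
- by move=> n; apply: le_trans (gf n).
- exact: gf.
- rewrite (_ : series _ = C *: series f); first exact: is_cvgZr nonneg_series_cvg.
  by apply/funext => n; rewrite /series /= -mulr_sumr.
Qed.

End series.

Section window_array.
Context (R : realType) (d : measure_display) (T : measurableType d)
  (P : probability T R) (X : nat -> {RV P >-> R}) (G : nat).
Hypothesis X_stationary : stationary X.
Local Notation p n := (law P (pat X n 0)).
Local Notation z n := (fun (i : nat) (o : {ffun 'I_n * 'I_n -> bool}) => Zstat X G i (rpath o)).

Lemma Zstat_rpath n i w : (i < n)%N ->
  Zstat X G i (rpath (pat X n 0 w)) = Zstat X G i (sample_path X w).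
Proof.
move=> hi; apply: (ordinal_Zstat X G hi); rewrite rpathK /pat.
by congr patx; apply/funext => j; rewrite addn0.
Qed.

(** For [k <= G] the bound is the trivial one, and when [m + k] reaches [n] the second event is
    constant. Otherwise both events are pulled back to the process, where they belong to [past] and
    [future]. *)
Lemma window_mixing n : mixing_le (p n) (z n) n (window_alpha X G).
Proof.
have p0 : forall o, 0 <= p n o by move=> o; exact: law_ge0.
have p1 := law_pat_sum X n.
move=> m k A B AI BI; rewrite /window_alpha; case: leqP => [_|Gk].
  exact: fexp_cov_pred_le1.
have [nm|mkn] := leqP n (m + k).
  have Bc o o' : B o = B o' by apply: BI => i /andP[mi iN]; lia.
  have [q0 _|Om0] := pickP (fun o : {ffun 'I_n * 'I_n -> bool} => true); last first.
    by move: p1; rewrite big_pred0 // => /eqP; rewrite eq_sym oner_eq0.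
  have -> : fexp (p n) (fun o => (A o && B o)%:R) = (B q0)%:R * fexp (p n) (fun o => (A o)%:R).
    rewrite -fexpZ; apply: eq_fexp => o; rewrite (Bc o q0).
    by case: (A o); case: (B _); rewrite ?mul1r ?mul0r.
  have -> : fexp (p n) (fun o => (B o)%:R) = (B q0)%:R.
    by rewrite -[RHS](fexp_cst p1); apply: eq_fexp => o; rewrite (Bc o q0).
  by rewrite mulrC subrr normr0 fine_ge0 // alpha_ge0.
pose AA := [set w | A (pat X n 0 w)]; pose BB := [set w | B (pat X n 0 w)].
(* The least index of an observation read by the [Y]s of index at least [m + k]: [B] factors through
   the pattern of the path from [h] on. *)
pose h := (m + (k - G))%N.
have pA : past X m AA.
  apply: (@sigma_of_pattern_dep _ _ _ _ _ m.+1 0) => [i im|w w' e].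
    by rewrite /= addn0 -ltnS.
  apply: AI => i im; rewrite !Zstat_rpath; [|lia..].
  by rewrite !sample_path0; apply: (ordinal_Zstat X G (n := m.+1)).
have fB : future X (m + (k - G)) BB.
  apply: (@sigma_of_pattern_dep _ _ _ _ _ (n - h) h) => [i im|w w' e].
    by rewrite /= -/h leq_addl.
  apply: BI => i /andP[mi iN]; rewrite !Zstat_rpath //.
  have hi : (G <= i - h)%N by rewrite /h; lia.
  have hie : (i - h + h = i)%N by rewrite subnK // /h; lia.
  rewrite /Zstat; case: ifP => // _; congr (_ - _).
  have ih : (i - h < n - h)%N by rewrite /h; lia.
  have := ordinal_Ystat G ih e.
  by rewrite (@Ystat_shift _ G (fun j => X j w)) // (@Ystat_shift _ G (fun j => X j w')) // hie.
have := alpha_ub pA fB.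
have -> : AA `&` BB = [set w | (fun o => A o && B o) (pat X n 0 w)].
  by apply/seteqP; split=> w /=; [case=> -> -> | move/andP].
rewrite (prob_law P (fun o => A o && B o) (@pattern_fiber _ _ _ _ X n 0)).
rewrite /AA /BB !prob_law; [|exact: pattern_fiber..].
by rewrite -EFinM -EFinB abse_EFin -lee_fin fineK // alpha_fin.
Qed.

Lemma window_weak_array n :
  weak_array n G (Zbound X G) (window_alpha X G) (cov_lag X G) (p n) (z n).
Proof.
split.
- by move=> o; exact: law_ge0.
- exact: law_pat_sum.
- by move=> i o; exact: Zstat_le.
- by move=> i hi; exact: mean_Z.
- by move=> i l Gi il; exact: cov_Z.
- exact: window_mixing.
Qed.

Lemma cov_lag_le l : `|cov_lag X G l| <= 4 * Zbound X G * Zbound X G * window_alpha X G l.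
Proof.
pose n := (G + l).+1; have za := window_weak_array n.
have hl : (G + l < n)%N by [].
have hG : (G < n)%N by rewrite /n ltnS leq_addr.
rewrite -(wa_cov za (leqnn G) hl).
have := @cov_mixing_le _ _ (p n) (z n) (wa_sum za) n _ G l (z n G) (z n (G + l)%N) _ _ (wa_mix za).
rewrite (wa_mean za hl) mulr0 subr0; apply.
- by move=> o o' oo'; apply: oo'.
- by move=> o o' oo'; apply: oo'; rewrite leqnn.
- exact: (wa_bound za).
- exact: (wa_bound za).
Qed.

Hypothesis alpha_summable : (\sum_(1 <= n <oo) alpha X n < +oo)%E.

Let f l := window_alpha X G l.+1.
Let f_ge0 l : 0 <= f l. Proof. exact: window_alpha_ge0. Qed.
Let f_sum N : \sum_(0 <= l < N) f l <= window_bound X G.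
Proof. by have := window_alpha_sum G alpha_summable N.+1; rewrite big_add1. Qed.

Definition lrv : R := cov_lag X G 0 + 2 * limn (series (fun l => cov_lag X G l.+1)).

Lemma cov_lag_cvg : cvgn (series (fun l => cov_lag X G l.+1)).
Proof. by apply: (dominated_series_cvg f_ge0 f_sum) => l; exact: cov_lag_le. Qed.

Lemma window_lag_limits : lag_limits (window_alpha X G) (cov_lag X G) lrv.
Proof.
split=> e e0.
  have [L hL] := nonneg_series_tail f_ge0 f_sum e0; exists L => N.
  by under eq_bigr do rewrite ger0_norm ?window_alpha_ge0 //.
have e20 : 0 < e / 2 by rewrite divr_gt0.
have /cvgrPdist_le /(_ _ e20) [L _ hL] := cov_lag_cvg.
exists L => L' /hL /=; rewrite /lrv distrC /series /=.
move: (limn _) => l; set s := \sum_(_ <= _ < _) _ => h.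
rewrite (_ : _ - _ = 2 * (s - l)); last by ring.
by rewrite normrM ger0_norm // -ler_pdivlMl // mulrC.
Qed.

(** [sigma2] is defined as a limit of signed partial sums in the extended reals; the covariances
    being dominated by summable mixing coefficients, that limit is the real number [lrv]. *)
Lemma sigma2E : sigma2 X G = lrv%:E.
Proof.
rewrite /sigma2 /lrv [RHS]EFinD [X in _ = (_ + X)%E]EFinM; congr (_ + _ * _)%E.
  by have := covariance_Y X_stationary G 0; rewrite addn0.
apply: cvg_lim => //; rewrite -cvg_shiftS /=.
rewrite (_ : (fun n => _) = EFin \o series (fun l => cov_lag X G l.+1)).
  by apply: cvg_EFin; [exact: nearW | exact: cov_lag_cvg].
apply/funext => n; rewrite big_add1 /= /series /= -sumEFin.
by apply: eq_bigr => l _; exact: covariance_Y.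
Qed.

End window_array.

(** * Conversion of the hypotheses and conclusion *)

Lemma near_infty_exists (Q : nat -> Prop) :
  (\forall n \near \oo, Q n) -> exists N, forall n, (N <= n)%N -> Q n.
Proof. by move=> [N _ hN]; exists N => n Nn; exact: hN. Qed.

Lemma littleo_sqrt (R : realType) (b : nat -> nat) :
  (fun n => (b n)%:R : R^o) =o_\oo (fun n => Num.sqrt (n%:R : R) : R^o) ->
  forall e : R, 0 < e -> exists N, forall n, (N <= n)%N ->
  (b n)%:R <= e * Num.sqrt n%:R.
Proof.
move=> /eqoP bo e e0; have [N _ hN] := bo e e0; exists N => n /hN /=.
by rewrite !ger0_norm ?sqrtr_ge0.
Qed.

Lemma noties_ae (R : realType) (d : measure_display) (T : measurableType d)
    (P : probability T R) (X : nat -> {RV P >-> R}) :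
  (forall i j : nat, i <> j -> P [set w | X i w = X j w] = 0%E) ->
  {ae P, forall w, injective (sample_path X w)}.
Proof.
move=> noties; have h i j : {ae P, forall w, X i w = X j w -> i = j}.
  have [->|/eqP ij] := eqVneq i j; first by apply: aeW.
  exists [set w | X i w = X j w]; split; [|exact: noties|by move=> w /= /existsNP[/[swap]]].
  have := @measurable_fun_eqr _ _ _ setT (X i) (X j) (@measurable_funPT _ _ _ _ (X i))
      (@measurable_funPT _ _ _ _ (X j)).
  move=> /(_ measurableT [set true] I); rewrite setTI.
  by congr measurable; apply/seteqP; split=> w /= /eqP.
have := ae_foralln (fun i => ae_foralln (h i)).
by apply: filterS => w hw i j; exact: hw.
Qed.

Theorem theorem4p2 (R : realType) (d : measure_display) (T : measurableType d)
    (P : probability T R) (X : nat -> {RV P >-> R}) (G : nat) (b : nat -> nat)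
    (X_stationary : stationary X)
    (X_mixing : alpha_mixing X)
    (X_noties : forall i j : nat, i <> j -> P [set w | X i w = X j w] = 0%E)
    (alpha_summable : (\sum_(1 <= n <oo) alpha X n < +oo)%E)
    (G_gt0 : (0 < G)%N)
    (b_gt0 : forall n, (0 < b n)%N)
    (b_littleo : (fun n => (b n)%:R : R^o) =o_\oo
                 (fun n => Num.sqrt (n%:R : R) : R^o))
    (b_infty : b n @[n --> \oo] --> \oo) :
  ((0 < sigma2 X G)%E ->
   cvg_in_distribution P
     (fun n w => studentized G (b n) (nu X G) n (sample_path X w))
     (normal_prob 0 1))
  /\
  {ae P, forall w,
    sup (range (fun t : R =>
      `|permutation_cdf (studentized G (b n) 0 n) n (sample_path X w) t - Phi t|))
    @[n --> \oo] --> (0 : R)}.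
Proof.
have b_small := littleo_sqrt b_littleo.
have b_large B : exists N, forall n, (N <= n)%N -> (B <= b n)%N.
  by move/cvgnyPge: b_infty => /(_ B)/near_infty_exists.
split; last first.
  apply: filterS (noties_ae X_noties) => w w_inj.
  exact: permutation_clt.
rewrite (sigma2E G X_stationary alpha_summable) lte_fin => s20 t _.
rewrite [X in _ --> X](_ : _ = (Phi t)%:E); last by rewrite PhiE.
(* For each [n] the distribution function is computed on the space of patterns of that size; the
   threshold of [studentized_clt] is common to all these spaces. *)
pose F n := fexp (law P (pat X n 0))
  (fun o => (studentized G (b n) (nu X G) n (rpath o) <= t)%R%:R).
rewrite (_ : (fun n => _) = EFin \o F); last first.
  apply/funext => n /=; rewrite /F.
  rewrite -(@prob_ordinal _ _ _ _ _ n (fun x => studentized G (b n) (nu X G) n x <= t)) //.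
  by move=> x x' e; rewrite (ordinal_studentized G (b n) (nu X G) e).
apply: cvg_EFin; first exact: nearW.
apply/cvgrPdist_le => e e0.
have c0 : 0 <= G%:R ^+ 2 :> R by rewrite exprn_ge0.
have K0 : 0 <= Zbound X G by rewrite addr_ge0.
have [N hN] := studentized_clt G K0 s20
  (window_lag_limits G X_stationary alpha_summable) (window_alpha_ge0 X G)
  (@window_alpha_anti _ _ _ _ X G) (window_alpha_sum G alpha_summable)
  b_gt0 b_small b_large t c0 e0.
exists (maxn N G.+1) => // n /=; rewrite geq_max => /andP[Nn Gn].
have n0 : (0 < n)%N by exact: leq_trans Gn.
have dK i (o : {ffun 'I_n * 'I_n -> bool}) : `|Ystat G (rpath o) i - mu X G| <= Zbound X G.
  by rewrite (le_trans (ler_normB _ _)) // lerD2r Ystat_le.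
have dz i (o : {ffun 'I_n * 'I_n -> bool}) : (G <= i)%N ->
    Ystat G (rpath o) i - mu X G = Zstat X G i (rpath o).
  by move=> Gi; rewrite /Zstat Gi.
have := hN n Nn _ _ _ _ _ (window_weak_array G X_stationary n) dK dz
  (fun o => mk_rem_le (rpath o) G_gt0 Gn).
rewrite distrC; congr (`|_ - _| <= _); apply: eq_fexp => o.
by rewrite /nu studentizedE.
Qed.
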